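(* Let $\mathcal G$ be a Gray category with duals. The 3-morphisms $\Gamma_\nu\colon *\#{*}\#\nu\Rrightarrow\nu$ and $\Theta_\nu\colon\#\#\nu\Rrightarrow\nu$ defined, for each 2-morphism $\nu\colon F\Rightarrow G$ of $\mathcal G$, by (Gray product sign omitted) $$\Gamma_\nu=(T_G\circ1_\nu)\cdot(1_{\eta_G^*G}\circ\sigma_{\nu,\eta_{G^\#}})\cdot(1_{\eta_G^*G\circ\nu G^\#G}\circ T_FG^\#G\circ1_{F\eta_{G^\#}})\cdot(\sigma_{\eta_F^*,\eta_G^*G\circ\nu G^\#G}\circ1_{F\eta_{F^\#}G^\#G\circ F\eta_{G^\#}}),$$ \begin{align*}\Theta_\nu=&(1_\nu\circ\epsilon^*_{\eta_G^*F})\cdot(1_{\nu\circ\eta_G^*F}\circ\epsilon^*_{\nu G^\#F}\circ1_{\eta_GF})\cdot(1_\nu\circ(T_F^* )^{-1}\circ1_{\eta_G^*F\circ\nu G^\#F\circ\nu^*G^\#F\circ\eta_GF})\\&\cdot(1_{\nu\circ F\eta^*_{F^\#}\circ\eta_FF\circ\eta_G^*F\circ\nu G^\#F}\circ T_FG^\#F\circ1_{\nu^*G^\#F\circ\eta_GF})\\&\cdot(1_{\nu\circ F\eta^*_{F^\#}\circ\eta_FF}\circ\sigma_{\eta_F^*,\,\eta_G^*F\circ\nu G^\#F}\circ1_{F\eta_{F^\#}G^\#F\circ\nu^*G^\#F\circ\eta_GF})\\&\cdot(1_{\nu\circ F\eta^*_{F^\#}}\circ\epsilon_{\eta_FF}\circ1_{F(\#\nu)F\circ\nu^*G^\#F\circ\eta_GF})\cdot(1_\nu\circ\sigma_{\nu^*,\,\eta^*_{F^\#}\circ(\#\nu)F}\circ1_{\eta_GF})\cdot(\epsilon_\nu\circ1_{\#\#\nu})\end{align*}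 define natural isomorphisms of functors of 2-strict tricategories $\Gamma\colon *\#{*}\#\to1$ and $\Theta\colon\#\#\to1$.
   Context: \textbf{Gray categories.} A Gray category $\mathcal G$ consists of: a set of objects; for any objects $\mathcal C,\mathcal D$ a strict 2-category $\mathcal G(\mathcal C,\mathcal D)$, whose objects, 1-morphisms and 2-morphisms are called 1-morphisms $F\colon\mathcal C\to\mathcal D$, 2-morphisms $\mu\colon F\Rightarrow G$ and 3-morphisms $\Psi\colon\mu\Rrightarrow\nu$ of $\mathcal G$, with horizontal composition $\circ$ and vertical composition $\cdot$ (the right factor is applied first); a Gray product $\Box$, giving $G\Box F\colon\mathcal C\to\mathcal E$ for 1-morphisms $F\colon\mathcal C\to\mathcal D$, $G\colon\mathcal D\to\mathcal E$ and products $\Phi\Box F$, $G\Box\Psi$ of a 1-morphism with a 2- or 3-morphism, such that $-\Box F$, $G\Box-$ are strict 2-functors and $\Box$ is strictly associative and unital (units $1_{\mathcal C}$); and invertible 3-morphisms (the tensorator) $\sigma_{\mu,\nu}\colon(\mu\Box F_2)\circ(G_1\Box\nu)\Rrightarrow(G_2\Box\nu)\circ(\mu\Box F_1)$ for $\nu\colon F_1\Rightarrow F_2$ in $\mathcal G(\mathcal C,\mathcal D)$, $\mu\colon G_1\Rightarrow G_2$ in $\mathcal G(\mathcal D,\mathcal E)$, which are identities if $\mu$ or $\nu$ is an identity, are natural in $\mu$ and $\nu$, and satisfy $\sigma_{\mu,\bar\nu\circ\nu}=((G_2\Box\bar\nu)\circ\sigma_{\mu,\nu})\cdot(\sigma_{\mu,\bar\nu}\circ(G_1\Box\nu))$,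 $\sigma_{\bar\mu\circ\mu,\nu}=(\sigma_{\bar\mu,\nu}\circ(\mu\Box F_1))\cdot((\bar\mu\Box F_2)\circ\sigma_{\mu,\nu})$, $\sigma_{\mu\Box F,\nu}=\sigma_{\mu,F\Box\nu}$, $\sigma_{F\Box\mu,\nu}=F\Box\sigma_{\mu,\nu}$, $\sigma_{\mu,\nu\Box F}=\sigma_{\mu,\nu}\Box F$ whenever defined. The Gray product of 2- or 3-morphisms $\Psi$ (over $G_1,G_2$) and $\Phi$ (over $F_1,F_2$) is $\Psi\Box\Phi=(\Psi\Box F_2)\circ(G_1\Box\Phi)$. The sign $\Box$ may be omitted. \textbf{Duals.} For a 2-category $\mathcal C$, $\mathcal C^{op}$ is the 2-category with both compositions reversed. A planar 2-category is a 2-category $\mathcal C$ with a strict 2-functor $*\colon\mathcal C\to\mathcal C^{op}$ that is the identity on objects (so $a\colon A\to A'$, $\alpha\colon a\to b$ give $a^*\colon A'\to A$, $\alpha^*\colon b^*\to a^*$), with $**=1$, and 2-morphisms $\epsilon_a\colon1_{A'}\to a\circ a^*$ for all 1-morphisms $a\colon A\to A'$ such that, whenever defined, $(\alpha\circ1_{a^*})\cdot\epsilon_a=(1_b\circ\alpha^* )\cdot\epsilon_b$, $(1_a\circ\epsilon_{a^*}^* )\cdot(\epsilon_a\circ1_a)=1_a$, $(1_a\circ\epsilon_c\circ1_{a^*})\cdot\epsilon_a=\epsilon_{a\circ c}$. A Gray category with duals is a Gray category $\mathcal G$ with: (1) a planar structure on each $\mathcal G(\mathcal C,\mathcal D)$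 (so $\mu\colon F\Rightarrow G$ has $\mu^*\colon G\Rightarrow F$ and $\epsilon_\mu\colon1_G\Rrightarrow\mu\circ\mu^*$) such that $(K\Box\mu\Box H)^*=K\Box\mu^*\Box H$ and $K\Box\epsilon_\mu\Box H=\epsilon_{K\Box\mu\Box H}$ for 1-morphisms $H,K$; (2) for each 1-morphism $F\colon\mathcal C\to\mathcal D$ a 1-morphism $F^\#\colon\mathcal D\to\mathcal C$, a 2-morphism $\eta_F\colon1_{\mathcal D}\Rightarrow F\Box F^\#$ and an invertible 3-morphism $T_F\colon(\eta_F^*\Box F)\circ(F\Box\eta_{F^\#})\Rrightarrow1_F$ such that (a) $F^{\#\#}=F$; (b) $1_{\mathcal C}^\#=1_{\mathcal C}$, $\eta_{1_{\mathcal C}}=1_{1_{\mathcal C}}$, $T_{1_{\mathcal C}}=1_{1_{1_{\mathcal C}}}$; (c) $(F\Box G)^\#=G^\#\Box F^\#$, $\eta_{F\Box G}=(F\Box\eta_G\Box F^\#)\circ\eta_F$, $T_{F\Box G}=(T_F\Box G\circ F\Box T_G)\cdot(1_{\eta_F^*\Box F\Box G}\circ\sigma_{F\Box\eta_G^*,\eta_{F^\#}\Box G}\circ1_{F\Box G\Box\eta_{G^\#}})$; (d) $(1_{\eta_F^*}\circ T_F\Box F^\#)\cdot(\sigma_{\eta_F^*,\eta_F^*}\circ1_{F\Box\eta_{F^\#}\Box F^\#})\cdot(1_{\eta_F^*}\circ F\Box T_{F^\#}^* )=1_{\eta_F^*}$. We also write $*x=x^*$ and $\#F=F^\#$. \textbf{The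 functors $*$ and $\#$.} $*$ is the identity on objects and 1-morphisms. $\#$ is the identity on objects, $F\mapsto F^\#$ on 1-morphisms, and for $\nu\colon F\Rightarrow G$, $\Psi\colon\nu\Rrightarrow\mu$: $\#\nu=(F^\#\eta_G^* )\circ(F^\#\nu G^\#)\circ(\eta_{F^\#}G^\#)\colon G^\#\Rightarrow F^\#$, $\#\Psi=1_{F^\#\eta_G^*}\circ(F^\#\Psi G^\#)\circ1_{\eta_{F^\#}G^\#}$. These are functors of 2-strict tricategories $*\colon\mathcal G\to\mathcal G^{op}$ (target with $\circ$ and $\cdot$ reversed; coherence for $\circ$ and units trivial, coherence for $\Box$ given by $\sigma_{\mu^*,\nu^*}$) and $\#\colon\mathcal G\to\mathcal G_{op}$ (target with $\Box$ and $\circ$ reversed), where $\#$ has coherence 3-isomorphisms $\Phi_F=T^*_{F^\#}\colon1_{F^\#}\Rrightarrow\#1_F$; for $\rho\colon E\Rightarrow F$, $\nu\colon F\Rightarrow G$, $\Phi_{\rho,\nu}\colon\#\rho\circ\#\nu\Rrightarrow\#(\nu\circ\rho)$, $$\Phi_{\rho,\nu}=(1_{E^\#\eta_G^*\circ E^\#\nu G^\#}\circ E^\#T_FG^\#\circ1_{E^\#\rho G^\#\circ\eta_{E^\#}G^\#})\cdot(\sigma_{E^\#\eta_F^*,\eta_G^*\circ\nu G^\#}\circ1_{E^\#F\eta_{F^\#}G^\#\circ E^\#\rho G^\#\circ\eta_{E^\#}G^\#})\cdot(1_{E^\#\eta_F^*}\circ\sigma_{E^\#\rho\circ\eta_{E^\#},\#\nu});$$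 and for $\Box$-composable $\mu\colon F\Rightarrow G$, $\nu\colon H\Rightarrow K$, $\kappa_{\mu,\nu}\colon\#\nu\Box\#\mu\Rrightarrow\#(\mu\Box\nu)$, $$\kappa_{\mu,\nu}=(1_{H^\#F^\#\eta_G^*\circ H^\#F^\#G\eta_K^*G^\#\circ H^\#F^\#\mu KK^\#G^\#}\circ H^\#\sigma_{\eta_{F^\#},\nu}K^\#G^\#\circ1_{\eta_{H^\#}K^\#G^\#})\cdot(1_{H^\#F^\#\eta_G^*}\circ H^\#\sigma_{F^\#\mu\circ\eta_{F^\#},\eta_K^*}G^\#\circ1_{H^\#\nu K^\#G^\#\circ\eta_{H^\#}K^\#G^\#})\cdot\sigma_{\#\nu,\#\mu}.$$ \textbf{Natural isomorphisms.} The functors $*\#{*}\#$, $\#\#$ and $1$ from $\mathcal G$ to $\mathcal G$ agree on objects and 1-morphisms; a natural isomorphism (with trivial components on objects and 1-morphisms) is a family of invertible 3-morphisms indexed by 2-morphisms $\nu$, natural with respect to 3-morphisms $\Psi\colon\mu\Rrightarrow\nu$, and compatible with the coherence data of the functors for units, $\circ$ and $\Box$. Explicitly, for $\Gamma$: $\Gamma_\nu\cdot{*\#{*}\#}\Psi=\Psi\cdot\Gamma_\mu$; $\Gamma_{1_F}\cdot( *\#{*}\Phi_F)=*\Phi_{F^\#}$; $(\Gamma_\mu\circ\Gamma_\nu)\cdot *\Phi_{*\#\nu,*\#\mu}=\Gamma_{\mu\circ\nu}\cdot( *\#{*}\Phi_{\nu,\mu})$; $\Gamma_{\mu\Box\nu}\cdot(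 *\#{*}\kappa_{\mu,\nu})=(\Gamma_\mu\Box\Gamma_\nu)\cdot\sigma^{-1}_{*\#{*}\#\mu,*\#{*}\#\nu}\cdot *\kappa_{*\#\nu,*\#\mu}\cdot *\#\sigma_{*\#\nu,*\#\mu}$. For $\Theta$: $\Theta_\nu\cdot\#\#\Psi=\Psi\cdot\Theta_\mu$; $\Theta_{1_F}=\Phi_{F^\#}^{-1}\cdot(\#\Phi_F)^{-1}$; $\Theta_{\mu\circ\nu}\cdot\#\Phi_{\nu,\mu}\cdot\Phi_{\#\mu,\#\nu}=\Theta_\mu\circ\Theta_\nu$; $\Theta_{\mu\Box\nu}\cdot\#\kappa_{\mu,\nu}\cdot\kappa_{\#\nu,\#\mu}=\Theta_\mu\Box\Theta_\nu$. *)

(* Defs.v *)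
From Stdlib Require Import ClassicalEpsilon.

Set Implicit Arguments.
Unset Strict Implicit.
Unset Printing Implicit Defensive.

(* A Gray category is presented in single-sorted form: one type of k-morphisms
   for each k = 0, 1, 2, 3, with source and target maps.  The strict
   associativity and unit laws of the Gray product and of the composition of
   2-morphisms are then plain equalities, without transports.  The partial
   operations are total functions about which the axioms say something only on
   composable arguments: their values elsewhere are arbitrary, and every
   definition and theorem below uses them on composable arguments only.
   The right factor of a composite is applied first. *)

Record gray_data := {
  ob : Type;
  m1 : Type;
  m2 : Type;
  m3 : Type;
  s1 : m1 -> ob;   t1 : m1 -> ob;
  s2 : m2 -> m1;   t2 : m2 -> m1;
  s3 : m3 -> m2;   t3 : m3 -> m2;
  id1 : ob -> m1;
  id2 : m1 -> m2;
  id3 : m2 -> m3;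
  box1 : m1 -> m1 -> m1;       (* G [box] F *)
  wl2 : m1 -> m2 -> m2;        (* G [box] mu *)
  wr2 : m2 -> m1 -> m2;        (* mu [box] F *)
  wl3 : m1 -> m3 -> m3;        (* G [box] Psi *)
  wr3 : m3 -> m1 -> m3;        (* Psi [box] F *)
  comp2 : m2 -> m2 -> m2;      (* horizontal composition, 2-morphisms *)
  comp3 : m3 -> m3 -> m3;      (* horizontal composition, 3-morphisms *)
  vcomp : m3 -> m3 -> m3;      (* vertical composition *)
  sigma : m2 -> m2 -> m3       (* the tensorator *)
}.

Declare Scope gray_scope.
Delimit Scope gray_scope with gray.
Local Open Scope gray_scope.

(* The paper's single sign [box] becomes [□] on 1-morphisms, [◁] and [▷] for
   the products of a 1- and a 2-morphism, [◀] and [▶] for those of a 1- and a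
   3-morphism; its sign [∘] becomes [∘] on 2-morphisms and [⊚] on 3-morphisms;
   [•] is the vertical composition. *)
Notation "G □ F" := (box1 G F) (at level 36, left associativity) : gray_scope.
Notation "G ◁ mu" := (wl2 G mu) (at level 37, right associativity) : gray_scope.
Notation "mu ▷ F" := (wr2 mu F) (at level 38, left associativity) : gray_scope.
Notation "G ◀ Psi" := (wl3 G Psi) (at level 37, right associativity) : gray_scope.
Notation "Psi ▶ F" := (wr3 Psi F) (at level 38, left associativity) : gray_scope.
Notation "mu ∘ nu" := (comp2 mu nu) (at level 40, left associativity) : gray_scope.
Notation "Psi ⊚ Phi" := (comp3 Psi Phi) (at level 42, left associativity) : gray_scope.
Notation "Psi • Phi" := (vcomp Psi Phi) (at level 45, left associativity) : gray_scope.

(* Source and target of a k-morphism in lower dimensions. *)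
Definition s21 (G : gray_data) (mu : m2 G) : ob G := s1 (s2 mu).
Definition t21 (G : gray_data) (mu : m2 G) : ob G := t1 (s2 mu).
Definition s32 (G : gray_data) (Psi : m3 G) : m1 G := s2 (s3 Psi).
Definition t32 (G : gray_data) (Psi : m3 G) : m1 G := t2 (s3 Psi).
Definition s31 (G : gray_data) (Psi : m3 G) : ob G := s21 (s3 Psi).
Definition t31 (G : gray_data) (Psi : m3 G) : ob G := t21 (s3 Psi).

Definition arr3 (G : gray_data) (Psi : m3 G) (mu nu : m2 G) : Prop :=
  s3 Psi = mu /\ t3 Psi = nu.

Definition arr2 (G : gray_data) (mu : m2 G) (F F' : m1 G) : Prop :=
  s2 mu = F /\ t2 mu = F'.

Definition arr1 (G : gray_data) (F : m1 G) (C D : ob G) : Prop :=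
  s1 F = C /\ t1 F = D.

Definition is_inverse (G : gray_data) (Psi Psi' : m3 G) : Prop :=
  arr3 Psi' (t3 Psi) (s3 Psi) /\
  Psi' • Psi = id3 (s3 Psi) /\ Psi • Psi' = id3 (t3 Psi).

Definition invertible (G : gray_data) (Psi : m3 G) : Prop :=
  exists Psi', is_inverse Psi Psi'.

(* The inverse of an invertible 3-morphism; arbitrary if there is none. *)
Definition inv3 (G : gray_data) (Psi : m3 G) : m3 G :=
  epsilon (inhabits Psi) (is_inverse Psi).

(* The Gray product of two 2-morphisms, and of two 3-morphisms. *)
Definition box2 (G : gray_data) (mu nu : m2 G) : m2 G :=
  (mu ▷ t2 nu) ∘ (s2 mu ◁ nu).
Definition box3 (G : gray_data) (Psi Phi : m3 G) : m3 G :=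
  (Psi ▶ t32 Phi) ⊚ (s32 Psi ◀ Phi).

(* The 2- and 3-morphisms form strict 2-categories G(C,D): there are neither
   2-morphisms between non-parallel 1-morphisms nor 3-morphisms between
   non-parallel 2-morphisms, so one set of axioms covers all pairs C, D. *)
Record hom_2categories (G : gray_data) : Prop := {
  glob2 : forall mu : m2 G, s1 (t2 mu) = s1 (s2 mu) /\ t1 (t2 mu) = t1 (s2 mu);
  glob3 : forall Psi : m3 G, s2 (t3 Psi) = s2 (s3 Psi) /\ t2 (t3 Psi) = t2 (s3 Psi);
  id2_arr : forall F : m1 G, arr2 (id2 F) F F;
  id3_arr : forall mu : m2 G, arr3 (id3 mu) mu mu;
  comp2_arr : forall mu nu : m2 G, s2 mu = t2 nu ->
    arr2 (mu ∘ nu) (s2 nu) (t2 mu);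
  vcomp_arr : forall Psi Phi : m3 G, s3 Psi = t3 Phi ->
    arr3 (Psi • Phi) (s3 Phi) (t3 Psi);
  comp3_arr : forall Psi Phi : m3 G, s32 Psi = t32 Phi ->
    arr3 (Psi ⊚ Phi) (s3 Psi ∘ s3 Phi) (t3 Psi ∘ t3 Phi);
  comp2_assoc : forall mu nu rho : m2 G, s2 mu = t2 nu -> s2 nu = t2 rho ->
    (mu ∘ nu) ∘ rho = mu ∘ (nu ∘ rho);
  comp2_idl : forall mu : m2 G, id2 (t2 mu) ∘ mu = mu;
  comp2_idr : forall mu : m2 G, mu ∘ id2 (s2 mu) = mu;
  vcomp_assoc : forall Psi Phi Xi : m3 G, s3 Psi = t3 Phi -> s3 Phi = t3 Xi ->
    (Psi • Phi) • Xi = Psi • (Phi • Xi);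
  vcomp_idl : forall Psi : m3 G, id3 (t3 Psi) • Psi = Psi;
  vcomp_idr : forall Psi : m3 G, Psi • id3 (s3 Psi) = Psi;
  comp3_assoc : forall Psi Phi Xi : m3 G, s32 Psi = t32 Phi -> s32 Phi = t32 Xi ->
    (Psi ⊚ Phi) ⊚ Xi = Psi ⊚ (Phi ⊚ Xi);
  comp3_idl : forall Psi : m3 G, id3 (id2 (t32 Psi)) ⊚ Psi = Psi;
  comp3_idr : forall Psi : m3 G, Psi ⊚ id3 (id2 (s32 Psi)) = Psi;
  comp3_id : forall mu nu : m2 G, s2 mu = t2 nu -> id3 mu ⊚ id3 nu = id3 (mu ∘ nu);
  interchange : forall Psi' Psi Phi' Phi : m3 G,
    s3 Psi' = t3 Psi -> s3 Phi' = t3 Phi -> s32 Psi = t32 Phi ->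
    (Psi' • Psi) ⊚ (Phi' • Phi) = (Psi' ⊚ Phi') • (Psi ⊚ Phi)
}.

Record gray_product (G : gray_data) : Prop := {
  id1_arr : forall C : ob G, arr1 (id1 C) C C;
  box1_arr : forall H F : m1 G, s1 H = t1 F -> arr1 (H □ F) (s1 F) (t1 H);
  (* [H □ -] is a strict 2-functor *)
  wl2_arr : forall (H : m1 G) (mu : m2 G), s1 H = t21 mu ->
    arr2 (H ◁ mu) (H □ s2 mu) (H □ t2 mu);
  wl3_arr : forall (H : m1 G) (Psi : m3 G), s1 H = t31 Psi ->
    arr3 (H ◀ Psi) (H ◁ s3 Psi) (H ◁ t3 Psi);
  wl2_id : forall H F : m1 G, s1 H = t1 F -> H ◁ id2 F = id2 (H □ F);
  wl2_comp : forall (H : m1 G) (mu nu : m2 G), s1 H = t21 mu -> s2 mu = t2 nu ->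
    H ◁ (mu ∘ nu) = (H ◁ mu) ∘ (H ◁ nu);
  wl3_id : forall (H : m1 G) (mu : m2 G), s1 H = t21 mu -> H ◀ id3 mu = id3 (H ◁ mu);
  wl3_vcomp : forall (H : m1 G) (Psi Phi : m3 G), s1 H = t31 Psi -> s3 Psi = t3 Phi ->
    H ◀ (Psi • Phi) = (H ◀ Psi) • (H ◀ Phi);
  wl3_comp : forall (H : m1 G) (Psi Phi : m3 G), s1 H = t31 Psi -> s32 Psi = t32 Phi ->
    H ◀ (Psi ⊚ Phi) = (H ◀ Psi) ⊚ (H ◀ Phi);
  (* [- □ F] is a strict 2-functor *)
  wr2_arr : forall (mu : m2 G) (F : m1 G), s21 mu = t1 F ->
    arr2 (mu ▷ F) (s2 mu □ F) (t2 mu □ F);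
  wr3_arr : forall (Psi : m3 G) (F : m1 G), s31 Psi = t1 F ->
    arr3 (Psi ▶ F) (s3 Psi ▷ F) (t3 Psi ▷ F);
  wr2_id : forall H F : m1 G, s1 H = t1 F -> id2 H ▷ F = id2 (H □ F);
  wr2_comp : forall (mu nu : m2 G) (F : m1 G), s21 mu = t1 F -> s2 mu = t2 nu ->
    (mu ∘ nu) ▷ F = (mu ▷ F) ∘ (nu ▷ F);
  wr3_id : forall (mu : m2 G) (F : m1 G), s21 mu = t1 F -> id3 mu ▶ F = id3 (mu ▷ F);
  wr3_vcomp : forall (Psi Phi : m3 G) (F : m1 G), s31 Psi = t1 F -> s3 Psi = t3 Phi ->
    (Psi • Phi) ▶ F = (Psi ▶ F) • (Phi ▶ F);
  wr3_comp : forall (Psi Phi : m3 G) (F : m1 G), s31 Psi = t1 F -> s32 Psi = t32 Phi ->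
    (Psi ⊚ Phi) ▶ F = (Psi ▶ F) ⊚ (Phi ▶ F);
  (* strict associativity *)
  box1_assoc : forall K H F : m1 G, s1 K = t1 H -> s1 H = t1 F ->
    (K □ H) □ F = K □ (H □ F);
  wl2_assoc : forall (K H : m1 G) (mu : m2 G), s1 K = t1 H -> s1 H = t21 mu ->
    (K □ H) ◁ mu = K ◁ (H ◁ mu);
  wlr2_assoc : forall (K : m1 G) (mu : m2 G) (F : m1 G), s1 K = t21 mu -> s21 mu = t1 F ->
    (K ◁ mu) ▷ F = K ◁ (mu ▷ F);
  wr2_assoc : forall (mu : m2 G) (H F : m1 G), s21 mu = t1 H -> s1 H = t1 F ->
    (mu ▷ H) ▷ F = mu ▷ (H □ F);
  wl3_assoc : forall (K H : m1 G) (Psi : m3 G), s1 K = t1 H -> s1 H = t31 Psi ->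
    (K □ H) ◀ Psi = K ◀ (H ◀ Psi);
  wlr3_assoc : forall (K : m1 G) (Psi : m3 G) (F : m1 G), s1 K = t31 Psi -> s31 Psi = t1 F ->
    (K ◀ Psi) ▶ F = K ◀ (Psi ▶ F);
  wr3_assoc : forall (Psi : m3 G) (H F : m1 G), s31 Psi = t1 H -> s1 H = t1 F ->
    (Psi ▶ H) ▶ F = Psi ▶ (H □ F);
  (* strict units *)
  box1_idl : forall F : m1 G, id1 (t1 F) □ F = F;
  box1_idr : forall F : m1 G, F □ id1 (s1 F) = F;
  wl2_unit : forall mu : m2 G, id1 (t21 mu) ◁ mu = mu;
  wr2_unit : forall mu : m2 G, mu ▷ id1 (s21 mu) = mu;
  wl3_unit : forall Psi : m3 G, id1 (t31 Psi) ◀ Psi = Psi;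
  wr3_unit : forall Psi : m3 G, Psi ▶ id1 (s31 Psi) = Psi
}.

Record tensorator (G : gray_data) : Prop := {
  sigma_arr : forall mu nu : m2 G, s21 mu = t21 nu ->
    arr3 (sigma mu nu) ((mu ▷ t2 nu) ∘ (s2 mu ◁ nu)) ((t2 mu ◁ nu) ∘ (mu ▷ s2 nu));
  sigma_inv : forall mu nu : m2 G, s21 mu = t21 nu -> invertible (sigma mu nu);
  sigma_idl : forall (H : m1 G) (nu : m2 G), s1 H = t21 nu ->
    sigma (id2 H) nu = id3 (H ◁ nu);
  sigma_idr : forall (mu : m2 G) (F : m1 G), s21 mu = t1 F ->
    sigma mu (id2 F) = id3 (mu ▷ F);
  sigma_natl : forall (Psi : m3 G) (nu : m2 G), s31 Psi = t21 nu ->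
    sigma (t3 Psi) nu • ((Psi ▶ t2 nu) ⊚ id3 (s32 Psi ◁ nu)) =
    (id3 (t32 Psi ◁ nu) ⊚ (Psi ▶ s2 nu)) • sigma (s3 Psi) nu;
  sigma_natr : forall (mu : m2 G) (Phi : m3 G), s21 mu = t31 Phi ->
    sigma mu (t3 Phi) • (id3 (mu ▷ t32 Phi) ⊚ (s2 mu ◀ Phi)) =
    ((t2 mu ◀ Phi) ⊚ id3 (mu ▷ s32 Phi)) • sigma mu (s3 Phi);
  sigma_compr : forall mu nu' nu : m2 G, s21 mu = t21 nu -> s2 nu' = t2 nu ->
    sigma mu (nu' ∘ nu) =
    (id3 (t2 mu ◁ nu') ⊚ sigma mu nu) • (sigma mu nu' ⊚ id3 (s2 mu ◁ nu));
  sigma_compl : forall mu' mu nu : m2 G, s21 mu = t21 nu -> s2 mu' = t2 mu ->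
    sigma (mu' ∘ mu) nu =
    (sigma mu' nu ⊚ id3 (mu ▷ s2 nu)) • (id3 (mu' ▷ t2 nu) ⊚ sigma mu nu);
  sigma_mid : forall (mu : m2 G) (F : m1 G) (nu : m2 G),
    s21 mu = t1 F -> s1 F = t21 nu ->
    sigma (mu ▷ F) nu = sigma mu (F ◁ nu);
  sigma_left : forall (F : m1 G) (mu nu : m2 G), s1 F = t21 mu -> s21 mu = t21 nu ->
    sigma (F ◁ mu) nu = F ◀ sigma mu nu;
  sigma_right : forall (mu nu : m2 G) (F : m1 G), s21 mu = t21 nu -> s21 nu = t1 F ->
    sigma mu (nu ▷ F) = sigma mu nu ▶ F
}.

Record is_gray_category (G : gray_data) : Prop := {
  gray_hom : hom_2categories G;
  gray_box : gray_product G;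
  gray_sigma : tensorator G
}.

Record dual_data := {
  dual_gray :> gray_data;
  star2 : m2 dual_gray -> m2 dual_gray;
  star3 : m3 dual_gray -> m3 dual_gray;
  eps : m2 dual_gray -> m3 dual_gray;
  sharp1 : m1 dual_gray -> m1 dual_gray;
  eta : m1 dual_gray -> m2 dual_gray;
  T : m1 dual_gray -> m3 dual_gray
}.

Notation "mu ^*" := (star2 mu) (at level 2, left associativity, format "mu ^*") : gray_scope.
Notation "Psi ^⋆" := (star3 Psi) (at level 2, left associativity, format "Psi ^⋆") : gray_scope.
Notation "F ^#" := (sharp1 F) (at level 2, left associativity, format "F ^#") : gray_scope.

Record planar_homs (G : dual_data) : Prop := {
  (* [*] is a strict 2-functor to the 2-category with both compositions
     reversed, the identity on objects of G(C,D), and an involution *)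
  star2_arr : forall mu : m2 G, arr2 mu^* (t2 mu) (s2 mu);
  star3_arr : forall Psi : m3 G, arr3 Psi^⋆ (t3 Psi)^* (s3 Psi)^*;
  star2_id : forall F : m1 G, (id2 F)^* = id2 F;
  star2_comp : forall mu nu : m2 G, s2 mu = t2 nu -> (mu ∘ nu)^* = nu^* ∘ mu^*;
  star3_id : forall mu : m2 G, (id3 mu)^⋆ = id3 mu^*;
  star3_vcomp : forall Psi Phi : m3 G, s3 Psi = t3 Phi -> (Psi • Phi)^⋆ = Phi^⋆ • Psi^⋆;
  star3_comp : forall Psi Phi : m3 G, s32 Psi = t32 Phi -> (Psi ⊚ Phi)^⋆ = Phi^⋆ ⊚ Psi^⋆;
  star2_inv : forall mu : m2 G, mu^*^* = mu;
  star3_inv : forall Psi : m3 G, Psi^⋆^⋆ = Psi;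
  eps_arr : forall mu : m2 G, arr3 (eps mu) (id2 (t2 mu)) (mu ∘ mu^*);
  eps_nat : forall Psi : m3 G,
    (Psi ⊚ id3 (s3 Psi)^*) • eps (s3 Psi) = (id3 (t3 Psi) ⊚ Psi^⋆) • eps (t3 Psi);
  eps_zigzag : forall mu : m2 G,
    (id3 mu ⊚ (eps mu^*)^⋆) • (eps mu ⊚ id3 mu) = id3 mu;
  eps_comp : forall mu nu : m2 G, s2 mu = t2 nu ->
    (id3 mu ⊚ eps nu ⊚ id3 mu^*) • eps mu = eps (mu ∘ nu);
  (* compatibility with the Gray product *)
  star2_box : forall (K : m1 G) (mu : m2 G) (H : m1 G), s1 K = t21 mu -> s21 mu = t1 H ->
    (K ◁ mu ▷ H)^* = K ◁ mu^* ▷ H;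
  eps_box : forall (K : m1 G) (mu : m2 G) (H : m1 G), s1 K = t21 mu -> s21 mu = t1 H ->
    K ◀ eps mu ▶ H = eps (K ◁ mu ▷ H)
}.

Record object_duals (G : dual_data) : Prop := {
  sharp1_arr : forall F : m1 G, arr1 F^# (t1 F) (s1 F);
  eta_arr : forall F : m1 G, arr2 (eta F) (id1 (t1 F)) (F □ F^#);
  T_arr : forall F : m1 G,
    arr3 (T F) (((eta F)^* ▷ F) ∘ (F ◁ eta F^#)) (id2 F);
  T_inv : forall F : m1 G, invertible (T F);
  sharp1_inv : forall F : m1 G, F^#^# = F;
  sharp1_id : forall C : ob G, (id1 C : m1 G)^# = id1 C;
  eta_id : forall C : ob G, eta (id1 C : m1 G) = id2 (id1 C);
  T_id : forall C : ob G, T (id1 C : m1 G) = id3 (id2 (id1 C));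
  sharp1_box : forall F H : m1 G, s1 F = t1 H -> (F □ H)^# = H^# □ F^#;
  eta_box : forall F H : m1 G, s1 F = t1 H ->
    eta (F □ H) = (F ◁ eta H ▷ F^#) ∘ eta F;
  T_box : forall F H : m1 G, s1 F = t1 H ->
    T (F □ H) =
    ((T F ▶ H) ⊚ (F ◀ T H)) •
    (id3 ((eta F)^* ▷ (F □ H))
     ⊚ sigma (F ◁ (eta H)^*) (eta F^# ▷ H)
     ⊚ id3 ((F □ H) ◁ eta H^#));
  T_swallowtail : forall F : m1 G,
    (id3 (eta F)^* ⊚ (T F ▶ F^#)) •
    (sigma (eta F)^* (eta F)^* ⊚ id3 (F ◁ eta F^# ▷ F^#)) •
    (id3 (eta F)^* ⊚ (F ◀ (T F^#)^⋆)) = id3 (eta F)^*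
}.

Record gray_category_with_duals := {
  gcd_data :> dual_data;
  gcd_gray : is_gray_category gcd_data;
  gcd_planar : planar_homs gcd_data;
  gcd_duals : object_duals gcd_data
}.

(* The functor # on 2-morphisms nu : F => G and on 3-morphisms between such,
   and its coherence 3-isomorphisms. *)
Definition sharp2 (C : dual_data) (nu : m2 C) : m2 C :=
  let F := s2 nu in let G := t2 nu in
  (F^# ◁ (eta G)^*) ∘ (F^# ◁ nu ▷ G^#) ∘ (eta F^# ▷ G^#).

Definition sharp3 (C : dual_data) (Psi : m3 C) : m3 C :=
  let F := s32 Psi in let G := t32 Psi in
  id3 (F^# ◁ (eta G)^*) ⊚ (F^# ◀ Psi ▶ G^#) ⊚ id3 (eta F^# ▷ G^#).

Definition Phi0 (C : dual_data) (F : m1 C) : m3 C := (T F^#)^⋆.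

Definition Phi2 (C : dual_data) (rho nu : m2 C) : m3 C :=
  let E := s2 rho in let F := t2 rho in let G := t2 nu in
  (id3 ((E^# ◁ (eta G)^*) ∘ (E^# ◁ nu ▷ G^#))
   ⊚ (E^# ◀ T F ▶ G^#)
   ⊚ id3 ((E^# ◁ rho ▷ G^#) ∘ (eta E^# ▷ G^#))) •
  (sigma (E^# ◁ (eta F)^*) ((eta G)^* ∘ (nu ▷ G^#))
   ⊚ id3 (((E^# □ F) ◁ eta F^# ▷ G^#) ∘ (E^# ◁ rho ▷ G^#) ∘ (eta E^# ▷ G^#))) •
  (id3 (E^# ◁ (eta F)^*) ⊚ sigma ((E^# ◁ rho) ∘ eta E^#) (sharp2 nu)).

Definition kappa (C : dual_data) (mu nu : m2 C) : m3 C :=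
  let F := s2 mu in let G := t2 mu in let H := s2 nu in let K := t2 nu in
  (id3 (((H^# □ F^#) ◁ (eta G)^*)
        ∘ ((H^# □ F^# □ G) ◁ (eta K)^* ▷ G^#)
        ∘ ((H^# □ F^#) ◁ mu ▷ (K □ K^# □ G^#)))
   ⊚ (H^# ◀ sigma (eta F^#) nu ▶ (K^# □ G^#))
   ⊚ id3 (eta H^# ▷ (K^# □ G^#))) •
  (id3 ((H^# □ F^#) ◁ (eta G)^*)
   ⊚ (H^# ◀ sigma ((F^# ◁ mu) ∘ eta F^#) (eta K)^* ▶ G^#)
   ⊚ id3 ((H^# ◁ nu ▷ (K^# □ G^#)) ∘ (eta H^# ▷ (K^# □ G^#)))) •
  sigma (sharp2 nu) (sharp2 mu).

(* [star_sharp_sq] is [*#*#] and [sharp_sq] is [##]. *)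
Definition star_sharp_sq2 (C : dual_data) (nu : m2 C) : m2 C := (sharp2 (sharp2 nu)^*)^*.
Definition star_sharp_sq3 (C : dual_data) (Psi : m3 C) : m3 C := (sharp3 (sharp3 Psi)^⋆)^⋆.
Definition sharp_sq2 (C : dual_data) (nu : m2 C) : m2 C := sharp2 (sharp2 nu).
Definition sharp_sq3 (C : dual_data) (Psi : m3 C) : m3 C := sharp3 (sharp3 Psi).

(* Natural isomorphisms [*#*#] -> 1 and [##] -> 1 with trivial components on
   objects and 1-morphisms.
   [*#*Phi_F] reads [(sharp3 (Phi0 F)^⋆)^⋆]. *)
Record natiso_star_sharp_sq (C : dual_data) (Gam : m2 C -> m3 C) : Prop := {
  star_sharp_sq_arr : forall nu : m2 C, arr3 (Gam nu) (star_sharp_sq2 nu) nu;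
  star_sharp_sq_inv : forall nu : m2 C, invertible (Gam nu);
  star_sharp_sq_nat : forall Psi : m3 C, Gam (t3 Psi) • star_sharp_sq3 Psi = Psi • Gam (s3 Psi);
  star_sharp_sq_unit : forall F : m1 C,
    Gam (id2 F) • (sharp3 (Phi0 F)^⋆)^⋆ = (Phi0 F^#)^⋆;
  star_sharp_sq_comp : forall mu nu : m2 C, s2 mu = t2 nu ->
    (Gam mu ⊚ Gam nu) • (Phi2 (sharp2 nu)^* (sharp2 mu)^*)^⋆ =
    Gam (mu ∘ nu) • (sharp3 (Phi2 nu mu)^⋆)^⋆;
  star_sharp_sq_box : forall mu nu : m2 C, s21 mu = t21 nu ->
    Gam (box2 mu nu) • (sharp3 (kappa mu nu)^⋆)^⋆ =
    box3 (Gam mu) (Gam nu) • inv3 (sigma (star_sharp_sq2 mu) (star_sharp_sq2 nu))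
      • (kappa (sharp2 nu)^* (sharp2 mu)^*)^⋆
      • (sharp3 (sigma (sharp2 nu)^* (sharp2 mu)^*))^⋆
}.

Record natiso_sharp_sq (C : dual_data) (Th : m2 C -> m3 C) : Prop := {
  sharp_sq_arr : forall nu : m2 C, arr3 (Th nu) (sharp_sq2 nu) nu;
  sharp_sq_inv : forall nu : m2 C, invertible (Th nu);
  sharp_sq_nat : forall Psi : m3 C, Th (t3 Psi) • sharp_sq3 Psi = Psi • Th (s3 Psi);
  sharp_sq_unit : forall F : m1 C,
    Th (id2 F) = inv3 (Phi0 F^#) • inv3 (sharp3 (Phi0 F));
  sharp_sq_comp : forall mu nu : m2 C, s2 mu = t2 nu ->
    Th (mu ∘ nu) • sharp3 (Phi2 nu mu) • Phi2 (sharp2 mu) (sharp2 nu) =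
    Th mu ⊚ Th nu;
  sharp_sq_box : forall mu nu : m2 C, s21 mu = t21 nu ->
    Th (box2 mu nu) • sharp3 (kappa mu nu) • kappa (sharp2 nu) (sharp2 mu) =
    box3 (Th mu) (Th nu)
}.

Definition Gamma (C : dual_data) (nu : m2 C) : m3 C :=
  let F := s2 nu in let G := t2 nu in
  (T G ⊚ id3 nu) •
  (id3 ((eta G)^* ▷ G) ⊚ sigma nu (eta G^#)) •
  (id3 (((eta G)^* ▷ G) ∘ (nu ▷ (G^# □ G)))
   ⊚ (T F ▶ (G^# □ G))
   ⊚ id3 (F ◁ eta G^#)) •
  (sigma (eta F)^* (((eta G)^* ▷ G) ∘ (nu ▷ (G^# □ G)))
   ⊚ id3 ((F ◁ eta F^# ▷ (G^# □ G)) ∘ (F ◁ eta G^#))).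

Definition Theta (C : dual_data) (nu : m2 C) : m3 C :=
  let F := s2 nu in let G := t2 nu in
  (id3 nu ⊚ (eps ((eta G)^* ▷ F))^⋆) •
  (id3 (nu ∘ ((eta G)^* ▷ F)) ⊚ (eps (nu ▷ (G^# □ F)))^⋆ ⊚ id3 (eta G ▷ F)) •
  (id3 nu
   ⊚ inv3 (T F)^⋆
   ⊚ id3 (((eta G)^* ▷ F) ∘ (nu ▷ (G^# □ F)) ∘ (nu^* ▷ (G^# □ F)) ∘ (eta G ▷ F))) •
  (id3 (nu ∘ (F ◁ (eta F^#)^*) ∘ (eta F ▷ F) ∘ ((eta G)^* ▷ F) ∘ (nu ▷ (G^# □ F)))
   ⊚ (T F ▶ (G^# □ F))
   ⊚ id3 ((nu^* ▷ (G^# □ F)) ∘ (eta G ▷ F))) •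
  (id3 (nu ∘ (F ◁ (eta F^#)^*) ∘ (eta F ▷ F))
   ⊚ sigma (eta F)^* (((eta G)^* ▷ F) ∘ (nu ▷ (G^# □ F)))
   ⊚ id3 ((F ◁ eta F^# ▷ (G^# □ F)) ∘ (nu^* ▷ (G^# □ F)) ∘ (eta G ▷ F))) •
  (id3 (nu ∘ (F ◁ (eta F^#)^*))
   ⊚ eps (eta F ▷ F)
   ⊚ id3 ((F ◁ sharp2 nu ▷ F) ∘ (nu^* ▷ (G^# □ F)) ∘ (eta G ▷ F))) •
  (id3 nu ⊚ sigma nu^* ((eta F^#)^* ∘ (sharp2 nu ▷ F)) ⊚ id3 (eta G ▷ F)) •
  (eps nu ⊚ id3 (sharp_sq2 nu)).

(* Main.v *)
(* A 2-morphism [nu : F => G] and its dual [#nu] are related by two invertible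
   3-morphisms built from [T], a pairing
     [phi_nu : eta_F^* ∘ F #nu -> eta_G^* ∘ nu G^#]
   and a copairing
     [psi_nu : #nu G ∘ eta_{G^#} -> F^# nu ∘ eta_{F^#}].
   Both are natural in [nu], turn [Phi_F] into an identity (this is the swallowtail
   axiom), and turn [Phi_{rho,nu}] and [kappa_{mu,nu}] into pastings of such
   3-morphisms with tensorators.  Whiskering a 3-morphism with a dual 1-morphism
   and composing with [eta] or [eta^*] is faithful, so every axiom may be tested
   after this operation.

   For [Gamma], let [chi_b] be the star of [psi_{b^*}].  Then
     [(eta_G^* ∘ Gamma_nu G^#) • chi_{#nu} = phi_nu],
   and the laws of [phi] and [chi] give those of [Gamma].

   For [Theta], [phi_nu] and [epsilon] combine to
     [omega_nu : nu^* F^# ∘ G #nu ∘ eta_G -> eta_F],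
   and [Theta_nu F^# ∘ eta_F] is [psi_{#nu}] followed by the mate
   [G #nu ∘ eta_G -> nu F^# ∘ eta_F] of [omega_nu]; the laws of [psi] and [omega] give
   those of [Theta].  As in a category with duals, where monoidal transformations are
   invertible, the inverse of this mate is obtained from [omega_{nu^*}] and the image
   of [epsilon_{nu^*}] under [#].

   Equations between 3-morphisms are verified on explicit paths of whiskered
   generators, taken up to the interchange law. *)
From Corelib Require Import ssreflect.
From Stdlib Require Import List Lia ClassicalEpsilon.
Require Import Defs.
Import ListNotations.
Set Implicit Arguments.
Unset Strict Implicit.
Unset Printing Implicit Defensive.
Set SsrOldRewriteGoalsOrder.
Local Open Scope gray_scope.

(** [*#*] bends a 2-morphism in the sense opposite to [#], so [*#*#] is a half turn followed by its
    reverse: zigzags and tensorators suffice to define [Gamma], and [eps] does not occur in it. [##]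
    is a full turn in one sense. To undo it, [nu] has to be paired with [nu^*]; this is why [Theta]
    contains [eps] and why [phi] enters it only through [omega].

    The cells [eps] are in general not invertible. The invertibility of [Theta] therefore cannot be
    read off its factors, unlike that of [Gamma]; it has to come from a duality between [#nu] and
    [#nu^*].

    The coherence cells [Phi2] and [kappa] are long composites of tensorators. Tested against [eta],
    they enter the laws of [Gamma] and [Theta] only through a few composition laws of [phi], [chi],
    [psi] and [omega], and these laws are where the tensorators are moved. With words and paths,
    strict associativity and units become equalities of lists, so that each remaining move is an
    interchange or a named equation. *)

Definition is2 (G : gray_data) (mu : m2 G) (f g : m1 G) (c d : ob G) : Prop :=
  arr2 mu f g /\ arr1 f c d /\ arr1 g c d.
Definition is3 (G : gray_data) (A : m3 G) (a b : m2 G) (f g : m1 G) (c d : ob G) : Prop :=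
  arr3 A a b /\ is2 a f g c d /\ is2 b f g c d.

(** The axioms are guarded by equations between sources and targets. With all boundaries unfolded,
    congruence closure settles these side conditions. *)
Ltac crush :=
  intros; unfold is3, is2, arr3, arr2, arr1, s32, t32, s31, t31, s21, t21 in *;
  repeat match goal with H : _ /\ _ |- _ => destruct H end;
  repeat split; try congruence.

(** * Boundaries of composites, and interchange with explicit boundaries *)

Section Typing.
Context (G : gray_data) (HG : is_gray_category G).

Local Notation is2 := (@is2 G).
Local Notation is3 := (@is3 G).
Let H2 := gray_hom HG.
Let HB := gray_box HG.

Lemma is1_id c : arr1 (id1 c : m1 G) c c.
Proof. exact: (id1_arr HB). Qed.
Lemma is1_box H F c d e : arr1 H d e -> arr1 F c d -> arr1 (H □ F : m1 G) c e.
Proof. move=> hH hF; have : s1 H = t1 F by crush. move=> /(box1_arr HB); crush. Qed.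
Lemma is2_id f c d : arr1 f c d -> is2 (id2 f) f f c d.
Proof. move=> hf; have := id2_arr H2 f; crush. Qed.
Lemma is2_comp mu nu f g h c d :
  is2 mu g h c d -> is2 nu f g c d -> is2 (mu ∘ nu) f h c d.
Proof. move=> h1 h2; have : s2 mu = t2 nu by crush. move=> /(comp2_arr H2); crush. Qed.
Lemma is2_wl K mu f g c d e : arr1 K d e -> is2 mu f g c d ->
  is2 (K ◁ mu) (K □ f) (K □ g) c e.
Proof. move=> hK h; have : s1 K = t21 mu by crush. move=> /(wl2_arr HB) h'.
  have h1 : arr1 (K □ f) c e by apply: is1_box (hK) _; case: h => _ [].
  have h2 : arr1 (K □ g) c e by apply: is1_box (hK) _; case: h => _ [].
  split => //; crush. Qed.
Lemma is2_wr K mu f g c d e : arr1 K c d -> is2 mu f g d e ->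
  is2 (mu ▷ K) (f □ K) (g □ K) c e.
Proof. move=> hK h; have : s21 mu = t1 K by crush. move=> /(wr2_arr HB) h'.
  have h1 : arr1 (f □ K) c e by apply: (is1_box (d := d)) => //; case: h => _ [].
  have h2 : arr1 (g □ K) c e by apply: (is1_box (d := d)) => //; case: h => _ [].
  split => //; crush. Qed.
Lemma is3_id a f g c d : is2 a f g c d -> is3 (id3 a) a a f g c d.
Proof. move=> h; have := id3_arr H2 a; crush. Qed.
Lemma is3_vc A B a b e f g c d :
  is3 A b e f g c d -> is3 B a b f g c d -> is3 (A • B) a e f g c d.
Proof. move=> h1 h2; have : s3 A = t3 B by crush. move=> /(vcomp_arr H2); crush. Qed.
Lemma is3_hc A B a a' b b' f g h c d :
  is3 A a a' g h c d -> is3 B b b' f g c d -> is3 (A ⊚ B) (a ∘ b) (a' ∘ b') f h c d.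
Proof. move=> h1 h2; have : s32 A = t32 B by crush.
  move=> /(comp3_arr H2) h3. case: h1 => h1 [h4 h5]; case: h2 => h2 [h6 h7].
  split; last by split; apply: is2_comp; eassumption.
  crush. Qed.
Lemma is3_wl K A a b f g c d e : arr1 K d e -> is3 A a b f g c d ->
  is3 (K ◀ A) (K ◁ a) (K ◁ b) (K □ f) (K □ g) c e.
Proof. move=> hK h; have : s1 K = t31 A by crush. move=> /(wl3_arr HB) h'.
  case: h => h [h4 h5]; split; last by split; apply: is2_wl; eassumption. crush. Qed.
Lemma is3_wr K A a b f g c d e : arr1 K c d -> is3 A a b f g d e ->
  is3 (A ▶ K) (a ▷ K) (b ▷ K) (f □ K) (g □ K) c e.
Proof. move=> hK h; have : s31 A = t1 K by crush. move=> /(wr3_arr HB) h'.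
  case: h => h [h4 h5]; split; last by split; apply: is2_wr; eassumption. crush. Qed.

Lemma interchange_lr A B a a' b b' f g h c d :
  is3 A a a' g h c d -> is3 B b b' f g c d ->
  (A ⊚ id3 b') • (id3 a ⊚ B) = (id3 a' ⊚ B) • (A ⊚ id3 b).
Proof.
move=> hA hB.
have iA := id3_arr H2 a; have iA' := id3_arr H2 a'.
have iB := id3_arr H2 b; have iB' := id3_arr H2 b'.
rewrite -(interchange H2); try by crush.
rewrite -(interchange H2); try by crush.
have [[<- <-] _] := hA; have [[<- <-] _] := hB.
by rewrite !(vcomp_idl H2) !(vcomp_idr H2).
Qed.

Lemma hc_vcr (A B : m3 G) q : s3 A = t3 B -> s32 A = t2 q ->
  (A • B) ⊚ id3 q = (A ⊚ id3 q) • (B ⊚ id3 q).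
Proof.
move=> h1 h2; have hq := id3_arr H2 q; have hB := glob3 H2 B.
rewrite -(interchange H2); try by crush.
by case: hq => hq hq'; rewrite -{2}hq' (vcomp_idl H2).
Qed.
Lemma hc_vcl (A B : m3 G) p : s3 A = t3 B -> s2 p = t32 A ->
  id3 p ⊚ (A • B) = (id3 p ⊚ A) • (id3 p ⊚ B).
Proof.
move=> h1 h2; have hp := id3_arr H2 p; have hB := glob3 H2 B.
rewrite -(interchange H2); try by crush.
by case: hp => hp hp'; rewrite -{2}hp' (vcomp_idl H2).
Qed.
End Typing.

(** * Words and paths *)

(* A list of 1-morphisms stands for its Gray product.  A 2-morphism is a word of
   letters, each an atom whiskered on the left and on the right by such lists, and a
   3-morphism a path of steps; a step applies a whiskered atom between the words
   [post] and [pre].  In all lists the head is the factor applied last. *)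
Section Words.
Context (G : gray_data).

Fixpoint ev1 (c : ob G) (w : list (m1 G)) : m1 G :=
  match w with [] => id1 c | F :: w => F □ ev1 c w end.
Fixpoint wt1 (d : ob G) (w : list (m1 G)) (c : ob G) : Prop :=
  match w with [] => d = c | F :: w => t1 F = d /\ wt1 (s1 F) w c end.

(** The boundary of an atom consists of lists rather than single 1-morphisms, so that [eta F] ends
    in the two-element list of [F] and [F^#] and each factor can be matched separately. *)
Record atom2 := Atom2 {
  cell2 : m2 G; dom2 : ob G; cod2 : ob G; src2 : list (m1 G); tgt2 : list (m1 G) }.
Definition wta2 (a : atom2) : Prop :=
  wt1 (cod2 a) (src2 a) (dom2 a) /\ wt1 (cod2 a) (tgt2 a) (dom2 a) /\
  arr2 (cell2 a) (ev1 (dom2 a) (src2 a)) (ev1 (dom2 a) (tgt2 a)).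

Record letter2 := Letter2 { left2 : list (m1 G); core2 : atom2; right2 : list (m1 G) }.
Definition srcl (k : letter2) := left2 k ++ src2 (core2 k) ++ right2 k.
Definition tgtl (k : letter2) := left2 k ++ tgt2 (core2 k) ++ right2 k.
Definition evl (c : ob G) (k : letter2) : m2 G :=
  ev1 (cod2 (core2 k)) (left2 k) ◁ cell2 (core2 k) ▷ ev1 c (right2 k).
Definition wtl (d c : ob G) (k : letter2) : Prop :=
  wt1 d (left2 k) (cod2 (core2 k)) /\ wta2 (core2 k) /\ wt1 (dom2 (core2 k)) (right2 k) c.

Fixpoint ev2 (c : ob G) (f : list (m1 G)) (w : list letter2) : m2 G :=
  match w with [] => id2 (ev1 c f) | k :: w => evl c k ∘ ev2 c f w end.
Fixpoint wt2 (d c : ob G) (g : list (m1 G)) (w : list letter2) (f : list (m1 G)) : Prop :=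
  match w with
  | [] => g = f /\ wt1 d f c
  | k :: w => g = tgtl k /\ wtl d c k /\ wt2 d c (srcl k) w f
  end.

Definition whl (L R : list (m1 G)) (k : letter2) : letter2 :=
  Letter2 (L ++ left2 k) (core2 k) (right2 k ++ R).
Definition wh2 L R (w : list letter2) : list letter2 := map (whl L R) w.

(** Source and target are words, so a cell such as [T F] replaces two letters by none. The lower
    boundaries are stored because an empty word determines no 1-morphism and an empty list no
    object. *)
Record atom3 := Atom3 {
  cell3 : m3 G; dom3 : ob G; cod3 : ob G; src31 : list (m1 G); tgt31 : list (m1 G);
  src3 : list letter2; tgt3 : list letter2 }.
Definition wta3 (X : atom3) : Prop :=
  wt2 (cod3 X) (dom3 X) (tgt31 X) (src3 X) (src31 X) /\
  wt2 (cod3 X) (dom3 X) (tgt31 X) (tgt3 X) (src31 X) /\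
  arr3 (cell3 X) (ev2 (dom3 X) (src31 X) (src3 X)) (ev2 (dom3 X) (src31 X) (tgt3 X)).

Record step := Step {
  post : list letter2; left3 : list (m1 G); core3 : atom3; right3 : list (m1 G);
  pre : list letter2 }.
Definition srcs (s : step) := post s ++ wh2 (left3 s) (right3 s) (src3 (core3 s)) ++ pre s.
Definition tgts (s : step) := post s ++ wh2 (left3 s) (right3 s) (tgt3 (core3 s)) ++ pre s.
Definition inner (s : step) := left3 s ++ src31 (core3 s) ++ right3 s.
Definition outer (s : step) := left3 s ++ tgt31 (core3 s) ++ right3 s.
Definition evc (c : ob G) (s : step) : m3 G :=
  ev1 (cod3 (core3 s)) (left3 s) ◀ cell3 (core3 s) ▶ ev1 c (right3 s).
Definition evs (c : ob G) (f : list (m1 G)) (s : step) : m3 G :=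
  id3 (ev2 c (outer s) (post s)) ⊚ (evc c s ⊚ id3 (ev2 c f (pre s))).
Definition wts (d c : ob G) (g f : list (m1 G)) (s : step) : Prop :=
  wt2 d c g (post s) (outer s) /\
  (wt1 d (left3 s) (cod3 (core3 s)) /\ wta3 (core3 s) /\ wt1 (dom3 (core3 s)) (right3 s) c) /\
  wt2 d c (inner s) (pre s) f.

Fixpoint ev3 (c : ob G) (f : list (m1 G)) (w : list letter2) (P : list step) : m3 G :=
  match P with [] => id3 (ev2 c f w) | s :: P => evs c f s • ev3 c f w P end.
Fixpoint wt3 (d c : ob G) (g f : list (m1 G)) (v : list letter2) (P : list step)
  (w : list letter2) : Prop :=
  match P with
  | [] => v = w /\ wt2 d c g w f
  | s :: P => v = tgts s /\ wts d c g f s /\ wt3 d c g f (srcs s) P w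
  end.

Definition whs (p : list letter2) (L R : list (m1 G)) (q : list letter2) (s : step) : step :=
  Step (p ++ wh2 L R (post s)) (L ++ left3 s) (core3 s) (right3 s ++ R) (wh2 L R (pre s) ++ q).
Definition wh3 p L R q (P : list step) : list step := map (whs p L R q) P.
End Words.

Arguments ev1 {G} c w : simpl nomatch.

Section WordsTheory.
Context (G : gray_data) (HG : is_gray_category G).
Let H2 := gray_hom HG.
Let HB := gray_box HG.

Lemma ev1_arr (d : ob G) w c : wt1 d w c -> arr1 (ev1 c w) c d.
Proof.
elim: w d => [|F w IH] d /=; first by move=> ->; exact: (is1_id HG).
by move=> [hF /IH h]; apply: (is1_box HG) h; crush.
Qed.

Lemma wt1_app (d : ob G) u e v c : wt1 d u e -> wt1 e v c -> wt1 d (u ++ v) c.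
Proof. by elim: u d => [|F u IH] d /= => [-> //|[hF /IH h] /h]. Qed.

Lemma ev1_app (d : ob G) u e v c : wt1 d u e -> wt1 e v c ->
  ev1 c (u ++ v) = ev1 e u □ ev1 c v.
Proof.
elim: u d => [|F u IH] d /= hu hv.
  by case: (ev1_arr hv) => _ {1}<-; rewrite (box1_idl HB).
case: hu => hF hu; rewrite (IH _ hu hv) (box1_assoc HB) //.
  by case: (ev1_arr hu).
by case: (ev1_arr hu) (ev1_arr hv) => -> _ [_ ->].
Qed.

Lemma wtl_src (d c : ob G) k : wtl d c k -> wt1 d (srcl k) c.
Proof. by move=> [hL [[hs _] hR]]; apply: wt1_app hL _; apply: wt1_app hs hR. Qed.
Lemma wtl_tgt (d c : ob G) k : wtl d c k -> wt1 d (tgtl k) c.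
Proof. by move=> [hL [[_ [ht _]] hR]]; apply: wt1_app hL _; apply: wt1_app ht hR. Qed.

Lemma evl_is2 (d c : ob G) k : wtl d c k ->
  is2 (evl c k) (ev1 c (srcl k)) (ev1 c (tgtl k)) c d.
Proof.
move=> [hL [[hs [ht ha]] hR]].
rewrite /srcl /tgtl (ev1_app hL (wt1_app hs hR)) (ev1_app hL (wt1_app ht hR)).
rewrite (ev1_app hs hR) (ev1_app ht hR).
have a1 := (ev1_arr hL); have a2 := (ev1_arr hs); have a3 := (ev1_arr ht); have a4 := (ev1_arr hR).
have b2 := is1_box HG a1 a2; have b3 := is1_box HG a1 a3.
rewrite -!(box1_assoc HB); try by crush.
apply: (is2_wr HG) => //; first exact: a4.
by apply: (is2_wl HG) => //; first exact: a1.
Qed.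

Lemma wt2_src (d c : ob G) g w f : wt2 d c g w f -> wt1 d f c.
Proof. by elim: w g => [|k w IH] g /= [h1 h2] //; case: h2 => _ /IH. Qed.
Lemma wt2_tgt (d c : ob G) g w f : wt2 d c g w f -> wt1 d g c.
Proof. by case: w => [|k w] /= => [[-> //]|[-> [/wtl_tgt h _]]]. Qed.

Lemma ev2_is2 (d c : ob G) g w f : wt2 d c g w f ->
  is2 (ev2 c f w) (ev1 c f) (ev1 c g) c d.
Proof.
elim: w g => [|k w IH] g /=; first by move=> [-> /ev1_arr]; exact: (is2_id HG).
by move=> [-> [/evl_is2 h1 /IH h2]]; apply: (is2_comp HG) h1 h2.
Qed.

Lemma wt2_app (d c : ob G) g u h v f : wt2 d c g u h -> wt2 d c h v f -> wt2 d c g (u ++ v) f.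
Proof. by elim: u g => [|k u IH] g /= => [[-> //]|[-> [hk /IH hu] /hu hv]]. Qed.
Lemma wt2_split (d c : ob G) g u v f : wt2 d c g (u ++ v) f ->
  exists h, wt2 d c g u h /\ wt2 d c h v f.
Proof.
elim: u g => [|k u IH] g /=; first by move=> h; exists g; split=> //; split=> //; exact: wt2_tgt h.
by move=> [-> [hk /IH [h [h1 h2]]]]; exists h.
Qed.
Lemma wt2_inj (d c : ob G) g u h h' : wt2 d c g u h -> wt2 d c g u h' -> h = h'.
Proof. by elim: u g => [|k u IH] g /= => [[<- _] [<- _]|[_ [_ /IH hu]] [_ [_ /hu]]]. Qed.

Lemma ev2_app (d c : ob G) g u h v f : wt2 d c g u h -> wt2 d c h v f ->
  ev2 c f (u ++ v) = ev2 c h u ∘ ev2 c f v.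
Proof.
elim: u g => [|k u IH] g /= hu hv.
  case: hu => _ _; have [[_ e] _] := ev2_is2 hv; by rewrite -{1}e (comp2_idl H2).
case: hu => _ [/evl_is2 hk hu]; rewrite (IH _ hu hv) (comp2_assoc H2) //.
  by move: hk (ev2_is2 hu); crush.
by move: (ev2_is2 hu) (ev2_is2 hv); crush.
Qed.

Lemma wtl_wh (d c d' c' : ob G) L R k : wt1 d' L d -> wt1 c R c' -> wtl d c k ->
  wtl d' c' (whl L R k).
Proof.
by move=> hL hR [h1 [h2 h3]]; split; [exact: wt1_app hL h1|split=> //; exact: wt1_app h3 hR].
Qed.
Lemma srcl_wh L R (k : letter2 G) : srcl (whl L R k) = L ++ srcl k ++ R.
Proof. by rewrite /srcl /= -!app_assoc. Qed.
Lemma tgtl_wh L R (k : letter2 G) : tgtl (whl L R k) = L ++ tgtl k ++ R.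
Proof. by rewrite /tgtl /= -!app_assoc. Qed.
Lemma wt2_wh (d c d' c' : ob G) L R g w f : wt1 d' L d -> wt1 c R c' -> wt2 d c g w f ->
  wt2 d' c' (L ++ g ++ R) (wh2 L R w) (L ++ f ++ R).
Proof.
move=> hL hR; elim: w g => [|k w IH] g /=.
  by move=> [-> h]; split=> //; apply: wt1_app hL _; exact: wt1_app h hR.
move=> [-> [hk /IH h]]; rewrite tgtl_wh srcl_wh; split=> //; split=> //.
exact: wtl_wh hk.
Qed.

Lemma evl_wh (d c d' c' : ob G) L R k : wt1 d' L d -> wt1 c R c' -> wtl d c k ->
  evl c' (whl L R k) = ev1 d L ◁ evl c k ▷ ev1 c' R.
Proof.
move=> hL hR [h1 [[h2 [h3 h4]] h5]]; rewrite /evl /=.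
rewrite (ev1_app hL h1) (ev1_app h5 hR).
have a1 := (ev1_arr hL); have a2 := (ev1_arr h1); have a3 := (ev1_arr h5); have a4 := (ev1_arr hR).
have [a5 a6] := conj (ev1_arr h2) (ev1_arr h3).
have b1 : is2 (cell2 (core2 k)) _ _ _ _ := conj h4 (conj a5 a6).
have b2 := is2_wl HG a2 b1; have b3 := is2_wr HG a3 b1; have b4 := is2_wr HG a3 b2.
rewrite (wl2_assoc HB); try by crush.
have b5 := is2_wl HG a1 b2.
rewrite -(wr2_assoc HB); try by crush.
rewrite (wlr2_assoc HB) //; crush.
Qed.

Lemma ev2_wh (d c d' c' : ob G) L R g w f : wt1 d' L d -> wt1 c R c' -> wt2 d c g w f ->
  ev2 c' (L ++ f ++ R) (wh2 L R w) = ev1 d L ◁ ev2 c f w ▷ ev1 c' R.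
Proof.
move=> hL hR; have a1 := ev1_arr hL; have a2 := ev1_arr hR.
elim: w g => [|k w IH] g /=.
  move=> [_ h]; have a3 := ev1_arr h.
  rewrite (wl2_id HB); last by crush.
  have b := is1_box HG a1 a3.
  rewrite (wr2_id HB); last by crush.
  rewrite (ev1_app hL (wt1_app h hR)) (ev1_app h hR) (box1_assoc HB) //; crush.
move=> [_ [hk hw]]; rewrite (IH _ hw) (evl_wh hL hR hk).
have b1 := evl_is2 hk; have b2 := ev2_is2 hw.
have b3 := is2_wl HG a1 b1; have b4 := is2_wl HG a1 b2.
rewrite (wl2_comp HB); try by crush.
rewrite (wr2_comp HB) //; crush.
Qed.
End WordsTheory.

(** * Typing, evaluation and whiskering of paths *)

Section Paths.
Context (G : gray_data) (HG : is_gray_category G).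
Let H2 := gray_hom HG.
Let HB := gray_box HG.

Lemma wts_core (d c : ob G) g f s : wts d c g f s ->
  wt2 d c (outer s) (wh2 (left3 s) (right3 s) (src3 (core3 s))) (inner s) /\
  wt2 d c (outer s) (wh2 (left3 s) (right3 s) (tgt3 (core3 s))) (inner s).
Proof. by move=> [_ [[h2 [[h3 [h4 _]] h5]] _]]; split; apply: wt2_wh; eassumption. Qed.

Lemma wts_src (d c : ob G) g f s : wts d c g f s -> wt2 d c g (srcs s) f.
Proof.
move=> h; have [h1 _] := wts_core h; case: h => hp [_ hq].
by apply: wt2_app hp _; apply: wt2_app h1 hq.
Qed.
Lemma wts_tgt (d c : ob G) g f s : wts d c g f s -> wt2 d c g (tgts s) f.
Proof.
move=> h; have [_ h1] := wts_core h; case: h => hp [_ hq].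
by apply: wt2_app hp _; apply: wt2_app h1 hq.
Qed.

Lemma evc_is3 (d c : ob G) g f s : wts d c g f s ->
  is3 (evc c s) (ev2 c (inner s) (wh2 (left3 s) (right3 s) (src3 (core3 s))))
    (ev2 c (inner s) (wh2 (left3 s) (right3 s) (tgt3 (core3 s))))
    (ev1 c (inner s)) (ev1 c (outer s)) c d.
Proof.
move=> h; have [b1 b2] := wts_core h; case: h => _ [[h2 [[h3 [h4 h6]] h5]] _].
split; last by split; apply: (ev2_is2 HG).
rewrite /inner (ev2_wh HG h2 h5 h3) (ev2_wh HG h2 h5 h4).
have c1 := ev2_is2 HG h3; have c2 := ev2_is2 HG h4.
have c3 : is3 (cell3 (core3 s)) _ _ _ _ _ _ := conj h6 (conj c1 c2).
have c4 := is3_wl HG (ev1_arr HG h2) c3.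
by case: (is3_wr HG (ev1_arr HG h5) c4).
Qed.

Lemma evs_is3 (d c : ob G) g f s : wts d c g f s ->
  is3 (evs c f s) (ev2 c f (srcs s)) (ev2 c f (tgts s)) (ev1 c f) (ev1 c g) c d.
Proof.
move=> h; have [h1 h2] := wts_core h; have h3 := evc_is3 h; case: h => hp [_ hq].
rewrite /srcs /tgts (ev2_app HG hp (wt2_app h1 hq)) (ev2_app HG hp (wt2_app h2 hq)).
rewrite (ev2_app HG h1 hq) (ev2_app HG h2 hq).
have ip := is3_id HG (ev2_is2 HG hp); have iq := is3_id HG (ev2_is2 HG hq).
exact: (is3_hc HG ip (is3_hc HG h3 iq)).
Qed.

Lemma wt3_src (d c : ob G) g f v P w : wt3 d c g f v P w -> wt2 d c g w f.
Proof. by elim: P v => [|s P IH] v /= => [[_ //]|[_ [_ /IH]]]. Qed.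
Lemma wt3_tgt (d c : ob G) g f v P w : wt3 d c g f v P w -> wt2 d c g v f.
Proof. by case: P => [|s P] /= => [[-> //]|[-> [/wts_tgt]]]. Qed.

Lemma ev3_is3 (d c : ob G) g f v P w : wt3 d c g f v P w ->
  is3 (ev3 c f w P) (ev2 c f w) (ev2 c f v) (ev1 c f) (ev1 c g) c d.
Proof.
elim: P v => [|s P IH] v /=; first by move=> [-> h]; apply: (is3_id HG (ev2_is2 HG h)).
by move=> [-> [/evs_is3 h1 /IH h2]]; exact: (is3_vc HG h1 h2).
Qed.

Lemma wt3_app (d c : ob G) g f v P u Q w :
  wt3 d c g f v P u -> wt3 d c g f u Q w -> wt3 d c g f v (P ++ Q) w.
Proof. by elim: P v => [|s P IH] v /= => [[-> //]|[-> [hs /IH h] /h]]. Qed.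
Lemma wt3_split (d c : ob G) g f v P Q w : wt3 d c g f v (P ++ Q) w ->
  exists u, wt3 d c g f v P u /\ wt3 d c g f u Q w.
Proof.
elim: P v => [|s P IH] v /=.
  by move=> h; exists v; split=> //; split=> //; exact: wt3_tgt h.
by move=> [-> [hs /IH [u [h1 h2]]]]; exists u.
Qed.

Lemma ev3_app (d c : ob G) g f v P u Q w :
  wt3 d c g f v P u -> wt3 d c g f u Q w -> ev3 c f w (P ++ Q) = ev3 c f u P • ev3 c f w Q.
Proof.
elim: P v => [|s P IH] v /= hP hQ.
  have [[_ e] _] := ev3_is3 hQ; case: hP => e' _.
  by rewrite -{1}e (vcomp_idl H2).
case: hP => _ [hs hP]; rewrite (IH _ hP hQ) (vcomp_assoc H2) //.
  by move: (evs_is3 hs) (ev3_is3 hP); crush.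
by move: (ev3_is3 hP) (ev3_is3 hQ); crush.
Qed.

Lemma wts_wh (d c d' c' : ob G) p L R q g f g' f' s :
  wt2 d' c' g' p (L ++ g ++ R) -> wt1 d' L d -> wt1 c R c' -> wt2 d' c' (L ++ f ++ R) q f' ->
  wts d c g f s -> wts d' c' g' f' (whs p L R q s).
Proof.
move=> hp hL hR hq [h1 [[h2 [h3 h4]] h5]]; split; last split.
- apply: (wt2_app hp); rewrite /outer /= -!app_assoc.
  by have := wt2_wh hL hR h1; rewrite /outer -!app_assoc.
- split; first exact: wt1_app hL h2.
  by split=> //; exact: wt1_app h4 hR.
- apply: wt2_app _ hq; rewrite /inner /= -!app_assoc.
  by have := wt2_wh hL hR h5; rewrite /inner -!app_assoc.
Qed.

Lemma wh2_app (L R : list (m1 G)) u v : wh2 L R (u ++ v) = wh2 L R u ++ wh2 L R v.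
Proof. exact: map_app. Qed.
Lemma wh2_wh2 (L R L' R' : list (m1 G)) u : wh2 L R (wh2 L' R' u) = wh2 (L ++ L') (R' ++ R) u.
Proof. by rewrite /wh2 map_map; apply: map_ext => k; rewrite /whl /= !app_assoc. Qed.

Lemma srcs_wh (p : list (letter2 G)) L R q s :
  srcs (whs p L R q s) = p ++ wh2 L R (srcs s) ++ q.
Proof. by rewrite /srcs /= !wh2_app wh2_wh2 -!app_assoc. Qed.
Lemma tgts_wh (p : list (letter2 G)) L R q s :
  tgts (whs p L R q s) = p ++ wh2 L R (tgts s) ++ q.
Proof. by rewrite /tgts /= !wh2_app wh2_wh2 -!app_assoc. Qed.

Lemma wt3_wh (d c d' c' : ob G) p L R q g f g' f' v P w :
  wt2 d' c' g' p (L ++ g ++ R) -> wt1 d' L d -> wt1 c R c' -> wt2 d' c' (L ++ f ++ R) q f' ->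
  wt3 d c g f v P w ->
  wt3 d' c' g' f' (p ++ wh2 L R v ++ q) (wh3 p L R q P) (p ++ wh2 L R w ++ q).
Proof.
move=> hp hL hR hq; elim: P v => [|s P IH] v /=.
  move=> [-> h]; split=> //; apply: wt2_app hp _; apply: wt2_app _ hq; exact: (wt2_wh hL hR h).
move=> [-> [hs /IH h]]; rewrite tgts_wh srcs_wh; split=> //; split=> //.
exact: (wts_wh hp hL hR hq hs).
Qed.

Lemma evc_wh (d c d' c' : ob G) p L R q g f s :
  wt1 d' L d -> wt1 c R c' -> wts d c g f s ->
  evc c' (whs p L R q s) = ev1 d L ◀ evc c s ▶ ev1 c' R.
Proof.
move=> hL hR [_ [[h2 [[h3 [h4 h6]] h5]] _]]; rewrite /evc /=.
rewrite (ev1_app HG hL h2) (ev1_app HG h5 hR).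
have a1 := ev1_arr HG hL; have a2 := ev1_arr HG h2.
have a3 := ev1_arr HG h5; have a4 := ev1_arr HG hR.
have c1 := ev2_is2 HG h3; have c2 := ev2_is2 HG h4.
have c3 : is3 (cell3 (core3 s)) _ _ _ _ _ _ := conj h6 (conj c1 c2).
have c4 := is3_wl HG a2 c3; have c5 := is3_wr HG a3 c4; have c6 := is3_wl HG a1 c4.
rewrite (wl3_assoc HB); try by crush.
rewrite -(wr3_assoc HB); try by crush.
rewrite (wlr3_assoc HB) //; crush.
Qed.

Lemma evs_wh (d c d' c' : ob G) p L R q g f g' f' s :
  wt2 d' c' g' p (L ++ g ++ R) -> wt1 d' L d -> wt1 c R c' -> wt2 d' c' (L ++ f ++ R) q f' ->
  wts d c g f s ->
  evs c' f' (whs p L R q s) =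
  id3 (ev2 c' (L ++ g ++ R) p) ⊚ ((ev1 d L ◀ evs c f s ▶ ev1 c' R) ⊚ id3 (ev2 c' f' q)).
Proof.
move=> hp hL hR hq hs; rewrite /evs (evc_wh _ _ hL hR hs) /=.
have a1 := ev1_arr HG hL; have a4 := ev1_arr HG hR.
have hc := evc_is3 hs; case: (hs) => h1 [_ h5].
have b1 := is3_id HG (ev2_is2 HG h1); have b5 := is3_id HG (ev2_is2 HG h5).
have e1 : outer (whs p L R q s) = L ++ outer s ++ R by rewrite /outer /= -!app_assoc.
have h1' := wt2_wh hL hR h1; have h5' := wt2_wh hL hR h5.
rewrite e1 (ev2_app HG hp h1') (ev2_app HG h5' hq).
rewrite (ev2_wh HG hL hR h1) (ev2_wh HG hL hR h5).
have e2 := is3_hc HG hc b5.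
rewrite (wl3_comp HB); try by crush.
rewrite (wl3_comp HB); try by crush.
rewrite !(wl3_id HB); try by crush.
have d1 := is3_wl HG a1 b1; have d2 := is3_wl HG a1 hc; have d3 := is3_wl HG a1 b5.
rewrite !(wl3_id HB) in d1 d3; try by crush.
have d4 := is3_hc HG d2 d3.
rewrite (wr3_comp HB); try by crush.
rewrite (wr3_comp HB); try by crush.
rewrite !(wr3_id HB); try by crush.
have ip := is3_id HG (ev2_is2 HG hp); have iq := is3_id HG (ev2_is2 HG hq).
have f1 := is3_wr HG a4 d1; have f2 := is3_wr HG a4 d2; have f3 := is3_wr HG a4 d3.
rewrite !(wr3_id HB) in f1 f3; try by crush.
have i1 := is2_wr HG a4 (is2_wl HG a1 (ev2_is2 HG h1)).
have i5 := is2_wr HG a4 (is2_wl HG a1 (ev2_is2 HG h5)).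
have jp := ev2_is2 HG hp; have jq := ev2_is2 HG hq.
have k := ev2_wh HG hL hR h1; have k' := ev2_is2 HG h1'; rewrite k in k'.
have l := ev2_wh HG hL hR h5; have l' := ev2_is2 HG h5'; rewrite l in l'.
rewrite -!(comp3_id H2); try by crush.
have eg : ev1 d L □ ev1 c g □ ev1 c' R = ev1 c' (L ++ g ++ R) by crush.
have ef : ev1 d L □ ev1 c f □ ev1 c' R = ev1 c' (L ++ f ++ R) by crush.
rewrite ef in f3; rewrite eg in f1.
have m1 := is3_hc HG f3 iq; have m2 := is3_hc HG f2 m1; have m3 := is3_hc HG f2 f3.
rewrite !(comp3_assoc H2) //; crush.
Qed.

(** The value of a path in a context depends only on the value of the path. Hence an equation
    between two paths may be applied inside any larger path. *)
Lemma ev3_wh (d c d' c' : ob G) p L R q g f g' f' v P w :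
  wt2 d' c' g' p (L ++ g ++ R) -> wt1 d' L d -> wt1 c R c' -> wt2 d' c' (L ++ f ++ R) q f' ->
  wt3 d c g f v P w ->
  ev3 c' f' (p ++ wh2 L R w ++ q) (wh3 p L R q P) =
  id3 (ev2 c' (L ++ g ++ R) p) ⊚ ((ev1 d L ◀ ev3 c f w P ▶ ev1 c' R) ⊚ id3 (ev2 c' f' q)).
Proof.
move=> hp hL hR hq; have a1 := ev1_arr HG hL; have a4 := ev1_arr HG hR.
have jp := ev2_is2 HG hp; have jq := ev2_is2 HG hq.
have ip := is3_id HG jp; have iq := is3_id HG jq.
elim: P v => [|s P IH] v /=.
  move=> [_ h]; have b := ev2_is2 HG h; have hw := wt2_wh hL hR h.
  rewrite (ev2_app HG hp (wt2_app hw hq)) (ev2_app HG hw hq).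
  have i := is2_wl HG a1 b; have j := ev2_is2 HG hw.
  rewrite (wl3_id HB); try by crush.
  rewrite (wr3_id HB); try by crush.
  rewrite -(ev2_wh HG hL hR h) !(comp3_id H2) //; try by crush.
  have := is2_comp HG j jq; crush.
move=> [_ [hs hP]]; rewrite (IH _ hP) (evs_wh hp hL hR hq hs).
have e1 := evs_is3 hs; have e2 := ev3_is3 hP.
have k1 := is3_wl HG a1 e1; have k2 := is3_wl HG a1 e2.
rewrite (wl3_vcomp HB); try by crush.
rewrite (wr3_vcomp HB); try by crush.
have l1 := is3_wr HG a4 k1; have l2 := is3_wr HG a4 k2.
have hw := ev2_is2 HG (wt2_wh hL hR (wt3_src hP)).
have hw' := is2_wr HG a4 (is2_wl HG a1 (ev2_is2 HG (wt3_src hP))).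
rewrite (ev2_wh HG hL hR (wt3_src hP)) in hw.
have eg : ev1 d L □ ev1 c g □ ev1 c' R = ev1 c' (L ++ g ++ R) by crush.
have ef : ev1 d L □ ev1 c f □ ev1 c' R = ev1 c' (L ++ f ++ R) by crush.
rewrite eg ef in l1 l2.
have m1 := is3_hc HG l1 iq; have m2 := is3_hc HG l2 iq.
rewrite (hc_vcr HG) ?(hc_vcl HG) //; crush.
Qed.

(** Once the gap [m] between the two cells is absorbed into the right one, this is the interchange
    law for two factors. *)
Lemma swap_ev (d c : ob G) g f p g1 f1 (Y X : m3 G) ys yt xs xt m h1 h2 q :
  wt2 d c g p g1 -> wt2 d c f1 q f ->
  wt2 d c g1 ys h1 -> wt2 d c g1 yt h1 -> wt2 d c h1 m h2 ->
  wt2 d c h2 xs f1 -> wt2 d c h2 xt f1 ->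
  arr3 Y (ev2 c h1 ys) (ev2 c h1 yt) -> arr3 X (ev2 c f1 xs) (ev2 c f1 xt) ->
  (id3 (ev2 c g1 p) ⊚ (Y ⊚ id3 (ev2 c f (m ++ xt ++ q)))) •
  (id3 (ev2 c h2 (p ++ ys ++ m)) ⊚ (X ⊚ id3 (ev2 c f q))) =
  (id3 (ev2 c h2 (p ++ yt ++ m)) ⊚ (X ⊚ id3 (ev2 c f q))) •
  (id3 (ev2 c g1 p) ⊚ (Y ⊚ id3 (ev2 c f (m ++ xs ++ q)))).
Proof.
move=> hp hq hys hyt hm hxs hxt hY hX.
rewrite !(ev2_app HG hp (wt2_app hys hm)) !(ev2_app HG hp (wt2_app hyt hm)).
rewrite !(ev2_app HG hys hm) !(ev2_app HG hyt hm).
rewrite !(ev2_app HG hm (wt2_app hxs hq)) !(ev2_app HG hm (wt2_app hxt hq)).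
rewrite !(ev2_app HG hxs hq) !(ev2_app HG hxt hq).
have bp := ev2_is2 HG hp; have bq := ev2_is2 HG hq; have bys := ev2_is2 HG hys.
have byt := ev2_is2 HG hyt; have bm := ev2_is2 HG hm.
have bxs := ev2_is2 HG hxs; have bxt := ev2_is2 HG hxt.
have tY : is3 Y _ _ _ _ _ _ := conj hY (conj bys byt).
have tX : is3 X _ _ _ _ _ _ := conj hX (conj bxs bxt).
have ip := is3_id HG bp; have iq := is3_id HG bq; have im := is3_id HG bm.
have iys := is3_id HG bys; have iyt := is3_id HG byt.
have ixs := is3_id HG bxs; have ixt := is3_id HG bxt.
have e1 := is3_hc HG iys im; have e2 := is3_hc HG iyt im; have e3 := is3_hc HG ixs iq.
have e4 := is3_hc HG ixt iq; have e5 := is3_hc HG tX iq; have e6 := is3_hc HG im e5.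
have e7 := is3_hc HG im tX.
rewrite -!(comp3_id H2); try by crush.
have := interchange_lr HG tY e6.
rewrite -!(comp3_id H2); try by crush.
move=> E.
rewrite !(comp3_assoc H2); try by crush.
have k1 := is3_hc HG tY (is3_hc HG im e4); have k2 := is3_hc HG iys e6.
have k3 := is3_hc HG iyt e6; have k4 := is3_hc HG tY (is3_hc HG im e3).
rewrite -!(hc_vcl HG); try by crush.
Qed.

End Paths.

(** * Interchange and rewriting in paths *)

Section Paths3.
Context (G : gray_data) (HG : is_gray_category G).
Let H2 := gray_hom HG.
(* The steps [s' :: s] act on disjoint parts of the word: [s'] left of [s]. *)
Definition swap_left (s' s : step G) : list (step G) :=
  let n := length (post s') + length (src3 (core3 s')) in
  let m := skipn n (post s) in
  let xs := wh2 (left3 s) (right3 s) (src3 (core3 s)) in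
  let yt := wh2 (left3 s') (right3 s') (tgt3 (core3 s')) in
  [Step (post s' ++ yt ++ m) (left3 s) (core3 s) (right3 s) (pre s);
   Step (post s') (left3 s') (core3 s') (right3 s') (m ++ xs ++ pre s)].
Definition swap_right (s' s : step G) : list (step G) :=
  let n := length (post s) + length (tgt3 (core3 s)) in
  let m := skipn n (post s') in
  let xs := wh2 (left3 s) (right3 s) (src3 (core3 s)) in
  let yt := wh2 (left3 s') (right3 s') (tgt3 (core3 s')) in
  [Step (post s) (left3 s) (core3 s) (right3 s) (m ++ yt ++ pre s');
   Step (post s ++ xs ++ m) (left3 s') (core3 s') (right3 s') (pre s')].
(** Only lengths are compared, so the test computes for arbitrary cells. That the words themselves
    agree follows from typing, since the source of [s'] and the target of [s] are the same word. *)
Definition goes_left (s' s : step G) : bool :=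
  Nat.leb (length (post s') + length (src3 (core3 s'))) (length (post s)).
Definition goes_right (s' s : step G) : bool :=
  Nat.leb (length (post s) + length (tgt3 (core3 s))) (length (post s')).

(** Typing is carried along with the value: a path obtained by rewriting never has to be typed
    afresh. *)
Definition path_le (d c : ob G) g f v w (P Q : list (step G)) : Prop :=
  wt3 d c g f v P w -> wt3 d c g f v Q w /\ ev3 c f w P = ev3 c f w Q.

Lemma path_trans (d c : ob G) g f v w P Q R :
  path_le d c g f v w P Q -> path_le d c g f v w Q R -> path_le d c g f v w P R.
Proof. by move=> h1 h2 /h1 [/h2 [h3 <-] <-]. Qed.

Lemma split_prefix (A : Type) (p' y q' p r : list A) :
  p' ++ y ++ q' = p ++ r -> length p' + length y <= length p ->
  let m := skipn (length p' + length y) p in p = p' ++ y ++ m /\ q' = m ++ r.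
Proof.
move=> e h m.
have e0 : length (p' ++ y) - length p = 0 by rewrite length_app; lia.
have e1 : firstn (length p' + length y) p = p' ++ y.
  have := f_equal (firstn (length (p' ++ y))) e.
  by rewrite app_assoc (firstn_app _ (p' ++ y)) (firstn_app _ p) e0 PeanoNat.Nat.sub_diag firstn_all /= !app_nil_r length_app.
have ep : p = p' ++ y ++ m by rewrite -{1}(firstn_skipn (length p' + length y) p) e1 -app_assoc.
by split=> //; move: e; rewrite {1}ep -!app_assoc => /app_inv_head /app_inv_head.
Qed.

Lemma swap_left_le (d c : ob G) g f v w s' s :
  goes_left s' s = true -> path_le d c g f v w [s'; s] (swap_left s' s).
Proof.
move=> /PeanoNat.Nat.leb_le hl /= [-> [hs' [e [hs [e0 h0]]]]]; subst w.
have E' : length (wh2 (left3 s') (right3 s') (src3 (core3 s'))) = length (src3 (core3 s')).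
  exact: length_map.
rewrite -E' in hl; have [ep eq] := split_prefix e hl.
rewrite E' in ep eq; rewrite /swap_left.
set m := skipn _ _ in ep eq *.
have [b1 b2] := wts_core hs'; have [b3 b4] := wts_core hs.
case: (hs') => hp' [_ hq']; case: (hs) => hp [_ hq].
rewrite ep in hp; have [k1 [hk1 /wt2_split [k2 [hy hm]]]] := wt2_split hp.
have e1 := wt2_inj hp' hk1; subst k1; have e2 := wt2_inj b1 hy; subst k2.
have t1' : wts d c g f (Step (post s') (left3 s') (core3 s') (right3 s')
    (m ++ wh2 (left3 s) (right3 s) (src3 (core3 s)) ++ pre s)).
  case: hs' => _ [hs' _]; split=> //; split=> //=.
  by apply: wt2_app hm _; apply: wt2_app b3 hq.
have t2' : wts d c g f (Step
    (post s' ++ wh2 (left3 s') (right3 s') (tgt3 (core3 s')) ++ m)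
    (left3 s) (core3 s) (right3 s) (pre s)).
  case: hs => _ [hs _]; split; last by split.
  by apply: wt2_app hp' _; apply: wt2_app b2 hm.
split.
  split; first by rewrite /tgts /= eq -!app_assoc.
  split=> //; split; first by rewrite /srcs /tgts /= -!app_assoc.
  split=> //; rewrite /srcs /= ep -!app_assoc; split=> //.
  apply: wt2_app hp' _; apply: wt2_app b1 _; apply: wt2_app hm _; exact: wt2_app b3 hq.
have [cX _] := evc_is3 HG hs; have [cY _] := evc_is3 HG hs'.
have := swap_ev HG hp' hq b1 b2 hm b3 b4 cY cX.
rewrite -eq -ep.
have u1 := evs_is3 HG hs; have u2 := evs_is3 HG hs'.
have u3 := evs_is3 HG t1'; have u4 := evs_is3 HG t2'.
have e3 : srcs s = srcs (Step (post s') (left3 s') (core3 s') (right3 s')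
    (m ++ wh2 (left3 s) (right3 s) (src3 (core3 s)) ++ pre s)).
  by rewrite /srcs /= {1}ep -!app_assoc.
have e4 : tgts (Step (post s') (left3 s') (core3 s') (right3 s')
    (m ++ wh2 (left3 s) (right3 s) (src3 (core3 s)) ++ pre s)) = srcs (Step
    (post s' ++ wh2 (left3 s') (right3 s') (tgt3 (core3 s')) ++ m)
    (left3 s) (core3 s) (right3 s) (pre s)) by rewrite /srcs /tgts /= -!app_assoc.
move=> E; cbn [ev3].
rewrite e in u2; rewrite -e3 in u3; rewrite e4 in u3.
have i0 := is3_id HG (ev2_is2 HG (wts_src hs)).
rewrite -!(vcomp_assoc H2); try by crush.
by congr (_ • _).
Qed.

Lemma swap_right_le (d c : ob G) g f v w s' s :
  goes_right s' s = true -> path_le d c g f v w [s'; s] (swap_right s' s).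
Proof.
move=> /PeanoNat.Nat.leb_le hl /= [-> [hs' [e [hs [e0 h0]]]]]; subst w.
have E' : length (wh2 (left3 s) (right3 s) (tgt3 (core3 s))) = length (tgt3 (core3 s)).
  exact: length_map.
have e' := e; symmetry in e'.
rewrite -E' in hl; have [ep eq] := split_prefix e' hl.
rewrite E' in ep eq; rewrite /swap_right.
set m := skipn _ _ in ep eq *.
have [b1 b2] := wts_core hs'; have [b3 b4] := wts_core hs.
case: (hs') => hp' [_ hq']; case: (hs) => hp [_ hq].
rewrite ep in hp'; have [k1 [hk1 /wt2_split [k2 [hy hm]]]] := wt2_split hp'.
have e1 := wt2_inj hp hk1; subst k1; have e2 := wt2_inj b4 hy; subst k2.
have t1' : wts d c g f (Step (post s) (left3 s) (core3 s) (right3 s)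
    (m ++ wh2 (left3 s') (right3 s') (tgt3 (core3 s')) ++ pre s')).
  case: hs => _ [hs _]; split=> //; split=> //=.
  by apply: wt2_app hm _; apply: wt2_app b2 hq'.
have t2' : wts d c g f (Step
    (post s ++ wh2 (left3 s) (right3 s) (src3 (core3 s)) ++ m)
    (left3 s') (core3 s') (right3 s') (pre s')).
  case: hs' => _ [hs' _]; split; last by split.
  by apply: wt2_app hp _; apply: wt2_app b3 hm.
split.
  split; first by rewrite /tgts /= ep -!app_assoc.
  split=> //; split; first by rewrite /srcs /tgts /= -!app_assoc.
  split=> //; rewrite /srcs /= eq -!app_assoc; split=> //.
  apply: wt2_app hp _; apply: wt2_app b3 _; apply: wt2_app hm _; exact: wt2_app b1 hq'.
have [cX _] := evc_is3 HG hs; have [cY _] := evc_is3 HG hs'.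
have := swap_ev HG hp hq' b3 b4 hm b1 b2 cX cY.
rewrite -eq -ep.
have u1 := evs_is3 HG hs; have u2 := evs_is3 HG hs'.
have u3 := evs_is3 HG t1'; have u4 := evs_is3 HG t2'.
have e3 : srcs s = srcs (Step (post s ++ wh2 (left3 s) (right3 s) (src3 (core3 s)) ++ m)
    (left3 s') (core3 s') (right3 s') (pre s')).
  by rewrite /srcs /= {1}eq -!app_assoc.
have e4 : tgts (Step (post s ++ wh2 (left3 s) (right3 s) (src3 (core3 s)) ++ m)
    (left3 s') (core3 s') (right3 s') (pre s')) = srcs (Step (post s) (left3 s) (core3 s)
    (right3 s) (m ++ wh2 (left3 s') (right3 s') (tgt3 (core3 s')) ++ pre s')).
  by rewrite /srcs /tgts /= -!app_assoc.
move=> E; cbn [ev3].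
rewrite e in u2; rewrite -e3 e4 in u4.
have i0 := is3_id HG (ev2_is2 HG (wts_src hs)).
rewrite -!(vcomp_assoc H2); try by crush.
by congr (_ • _).
Qed.

Lemma path_le_cons (d c : ob G) g f w s P Q :
  (forall v, path_le d c g f v w P Q) -> forall v, path_le d c g f v w (s :: P) (s :: Q).
Proof. by rewrite /path_le /= => h v [-> [hs /h [h1 ->]]]. Qed.
Lemma path_le_app (d c : ob G) g f v w P Q R :
  (forall u, path_le d c g f v u P Q) -> path_le d c g f v w (P ++ R) (Q ++ R).
Proof.
move=> h /wt3_split [u [hP hR]]; have [hQ e] := h u hP.
by split; [exact: wt3_app hQ hR|rewrite (ev3_app HG hP hR) (ev3_app HG hQ hR) e].
Qed.

(** Steps that are not independent are left in place, so that swapping is sound at every index. *)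
Definition swap2 (s' s : step G) : list (step G) :=
  if goes_left s' s then swap_left s' s
  else if goes_right s' s then swap_right s' s else [s'; s].
Fixpoint swap_at (k : nat) (P : list (step G)) : list (step G) :=
  match k, P with
  | 0, s' :: s :: P => swap2 s' s ++ P
  | S k, s :: P => s :: swap_at k P
  | _, P => P
  end.
Lemma swap_at_le (d c : ob G) g f w k P :
  forall v, path_le d c g f v w P (swap_at k P).
Proof.
elim: k P => [|k IH] [|s' P] //= v; last exact: path_le_cons.
case: P => [|s P] //.
apply: (path_le_app (P := [s'; s])) => u; rewrite /swap2.
case el: (goes_left s' s); first exact: swap_left_le.
by case er: (goes_right s' s); first exact: swap_right_le.
Qed.

Definition swaps (ks : list nat) (P : list (step G)) := fold_left (fun P k => swap_at k P) ks P.
Lemma swaps_le (d c : ob G) g f v w ks P : path_le d c g f v w P (swaps ks P).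
Proof.
elim: ks P => [|k ks IH] P //=; apply: path_trans (IH _); exact: swap_at_le.
Qed.

(** Steps further to the left are pushed towards the tail, that is, they are applied earlier. The
    branch returning the empty path is never reached, because [swap_left] always yields two
    steps. *)
Fixpoint insert (s : step G) (P : list (step G)) : list (step G) :=
  match P with
  | [] => [s]
  | s1 :: P1 =>
    if goes_left s s1 then
      match swap_left s s1 with a :: b :: _ => a :: insert b P1 | _ => [] end
    else s :: P
  end.
Definition sort (P : list (step G)) := fold_right insert [] P.
Lemma insert_le (d c : ob G) g f w s P : forall v, path_le d c g f v w (s :: P) (insert s P).
Proof.
elim: P s => [|s1 P IH] s v //=.
case el: (goes_left s s1) => //.
apply: (path_trans (Q := swap_left s s1 ++ P)).
  by apply: (path_le_app (P := [s; s1])) => u; exact: swap_left_le.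
exact: (path_le_cons (IH _)).
Qed.
Lemma sort_le (d c : ob G) g f w P : forall v, path_le d c g f v w P (sort P).
Proof.
elim: P => [|s P IH] //= v; eapply path_trans; last by apply: insert_le.
exact: (path_le_cons IH).
Qed.

Definition start (P : list (step G)) (w : list (letter2 G)) : list (letter2 G) :=
  match P with [] => w | s :: _ => tgts s end.
Lemma start_wt (d c : ob G) g f v P w : wt3 d c g f v P w -> v = start P w.
Proof. by case: P => [|s P] /= [->]. Qed.

Lemma wt1_cancel_r (d d' : ob G) L u e : wt1 d (L ++ u) e -> wt1 d' u e -> wt1 d L d'.
Proof.
elim: L d => [|F L IH] d /=; last by move=> [hF /IH h] /h.
by case: u => [|F u] /= => [-> ->|[<- _] [<- _]].
Qed.
Lemma wt1_cancel_l (c c' e : ob G) u R : wt1 e (u ++ R) c -> wt1 e u c' -> wt1 c' R c.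
Proof. by elim: u e => [|F u IH] e /= => [h <- //|[_ /IH h] [_ /h]]. Qed.

Lemma wt2_boundary (d c : ob G) k u g f g' f' :
  wt2 d c g (k :: u) f -> wt2 d c g' (k :: u) f' -> g = g' /\ f = f'.
Proof.
move=> /= [-> [_ h]] [-> [_ h']]; split=> //.
elim: u (srcl k) h h' => [|l u IH] h /=; first by move=> [<- _] [<- _].
by move=> [_ [_ h1]] [_ [_ /(IH _ h1)]].
Qed.

(** The first letter of a non-empty word fixes the objects at which the whiskering lists begin and
    end; typing of the context can thus be recovered from that of the ambient word. *)
Lemma context_wt (d c ds cs : ob G) g f gs fs k u p L R q :
  wt2 d c g (p ++ wh2 L R (k :: u) ++ q) f -> wt2 ds cs gs (k :: u) fs ->
  wt1 d L ds /\ wt1 cs R c /\ wt2 d c g p (L ++ gs ++ R) /\ wt2 d c (L ++ fs ++ R) q f.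
Proof.
move=> /wt2_split [h [hp /wt2_split [h' [hu hq]]]] hs.
case: (hu) => _ [[k1 [_ k3]] _]; case: (hs) => _ [[l1 [_ l3]] _].
have hL := wt1_cancel_r k1 l1; have hR := wt1_cancel_l k3 l3.
have [e e'] := wt2_boundary hu (wt2_wh hL hR hs).
by rewrite -e -e'.
Qed.

Lemma start_wh p L R q P (w : list (letter2 G)) :
  start (wh3 p L R q P) (p ++ wh2 L R w ++ q) = p ++ wh2 L R (start P w) ++ q.
Proof. by case: P => [|s P] //=; rewrite tgts_wh. Qed.

(** The context of a rule is found syntactically, and its typing is read off the ambient path. This
    requires a letter in the source or in the target of the rule, whence the hypothesis on
    [vs ++ ws]. *)
Lemma rule_le (d c ds cs : ob G) g f v w gs fs vs ws S S' P1 P2 p L R q :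
  wt3 ds cs gs fs vs S ws -> wt3 ds cs gs fs vs S' ws ->
  ev3 cs fs ws S = ev3 cs fs ws S' ->
  vs ++ ws <> [] -> start P2 w = p ++ wh2 L R ws ++ q ->
  path_le d c g f v w (P1 ++ wh3 p L R q S ++ P2) (P1 ++ wh3 p L R q S' ++ P2).
Proof.
move=> hS hS' e ne st /wt3_split [u1 [h1 /wt3_split [u2 [h2 h3]]]].
have e2 := start_wt h3; rewrite st in e2; subst u2.
have e1 := start_wt h2; rewrite start_wh -(start_wt hS) in e1; subst u1.
have [hL [hR [hp hq]]] : wt1 d L ds /\ wt1 cs R c /\ wt2 d c g p (L ++ gs ++ R) /\
    wt2 d c (L ++ fs ++ R) q f.
  move: (wt3_tgt h2) (wt3_src h2) (wt3_tgt hS) (wt3_src hS).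
  case: vs ne {hS hS' h1 h2} => [|k vs] ne hv hw hvs hws; last exact: context_wt hv hvs.
  by case: ws ne st h3 e hv hw hvs hws => [|k ws] // _ _ _ _ _ hw _ hws; exact: context_wt hw hws.
have k := wt3_wh hp hL hR hq hS; have k' := wt3_wh hp hL hR hq hS'.
split; first exact: wt3_app h1 (wt3_app k' h3).
rewrite (ev3_app HG h1 (wt3_app h2 h3)) (ev3_app HG h1 (wt3_app k' h3)).
rewrite (ev3_app HG h2 h3) (ev3_app HG k' h3).
by rewrite (ev3_wh HG hp hL hR hq hS) (ev3_wh HG hp hL hR hq hS') e.
Qed.
End Paths3.

(** * Representation of morphisms by words and paths *)

Section Repr.
Context (G : gray_data) (HG : is_gray_category G).
Let H2 := gray_hom HG.
Let HB := gray_box HG.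
Let HS := gray_sigma HG.

Definition repr1 (F : m1 G) (w : list (m1 G)) (d c : ob G) : Prop :=
  wt1 d w c /\ F = ev1 c w.
Definition repr2 (mu : m2 G) (w : list (letter2 G)) (g f : list (m1 G)) (d c : ob G) : Prop :=
  wt2 d c g w f /\ mu = ev2 c f w.
Definition repr3 (X : m3 G) (P : list (step G)) (v w : list (letter2 G))
  (g f : list (m1 G)) (d c : ob G) : Prop :=
  wt3 d c g f v P w /\ X = ev3 c f w P.

Lemma r1_id c : repr1 (id1 c) [] c c.
Proof. by []. Qed.
Lemma r1_atom F c d : arr1 F c d -> repr1 F [F] d c.
Proof. by move=> [<- <-]; split=> //=; rewrite (box1_idr HB). Qed.
Lemma r1_box H F u v e d c : repr1 H u e d -> repr1 F v d c -> repr1 (H □ F) (u ++ v) e c.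
Proof.
move=> [h1 ->] [h2 ->]; split; first exact: wt1_app h1 h2.
by rewrite (ev1_app HG h1 h2).
Qed.

Lemma r2_id F f d c : repr1 F f d c -> repr2 (id2 F) [] f f d c.
Proof. by move=> [h ->]. Qed.
Lemma r2_atom a F F' f g d c : arr2 a F F' -> repr1 F f d c -> repr1 F' g d c ->
  repr2 a [Letter2 [] (Atom2 a c d f g) []] g f d c.
Proof.
move=> ha [hf ef] [hg eg]; have a1 := ev1_arr HG hf; have a2 := ev1_arr HG hg.
split; first by rewrite /= /srcl /tgtl /wtl /wta2 /= -ef -eg !app_nil_r.
rewrite /= /evl /=.
have e : s21 a = c by crush.
have e' : t21 a = d by crush.
have e2 : s2 a = ev1 c f by crush.
by rewrite -{1}e' (wl2_unit HB) -{1}e (wr2_unit HB) -e2 (comp2_idr H2).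
Qed.
Lemma r2_comp mu nu u v h g f d c :
  repr2 mu u h g d c -> repr2 nu v g f d c -> repr2 (mu ∘ nu) (u ++ v) h f d c.
Proof.
move=> [h1 ->] [h2 ->]; split; first exact: wt2_app h1 h2.
by rewrite (ev2_app HG h1 h2).
Qed.
Lemma wr2_id1 (mu : m2 G) f g c d : is2 mu f g c d -> mu ▷ id1 c = mu.
Proof. move=> h; have e : s21 mu = c by crush. by rewrite -e (wr2_unit HB). Qed.
Lemma wl2_id1 (mu : m2 G) f g c d : is2 mu f g c d -> id1 d ◁ mu = mu.
Proof. move=> h; have e : t21 mu = d by crush. by rewrite -e (wl2_unit HB). Qed.
Lemma wr3_id1 (A : m3 G) a b f g c d : is3 A a b f g c d -> A ▶ id1 c = A.
Proof. move=> h; have e : s31 A = c by crush. by rewrite -e (wr3_unit HB). Qed.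
Lemma wl3_id1 (A : m3 G) a b f g c d : is3 A a b f g c d -> id1 d ◀ A = A.
Proof. move=> h; have e : t31 A = d by crush. by rewrite -e (wl3_unit HB). Qed.

Lemma r2_wl K k mu w g f e d c : repr1 K k e d -> repr2 mu w g f d c ->
  repr2 (K ◁ mu) (wh2 k [] w) (k ++ g) (k ++ f) e c.
Proof.
move=> [h1 ->] [h2 ->]; have h3 : wt1 c [] c by [].
have := wt2_wh h1 h3 h2; have := ev2_wh HG h1 h3 h2; rewrite !app_nil_r /repr2 => -> h; split=> //=.
by rewrite (wr2_id1 (is2_wl HG (ev1_arr HG h1) (ev2_is2 HG h2))).
Qed.
Lemma r2_wr K k mu w g f e d c : repr2 mu w g f e d -> repr1 K k d c ->
  repr2 (mu ▷ K) (wh2 [] k w) (g ++ k) (f ++ k) e c.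
Proof.
move=> [h1 ->] [h2 ->]; have h3 : wt1 e [] e by [].
have := wt2_wh h3 h2 h1; have /= := ev2_wh HG h3 h2 h1; rewrite /repr2 => -> h; split=> //=.
by rewrite (wl2_id1 (ev2_is2 HG h1)).
Qed.

Lemma wh2_nil (w : list (letter2 G)) : wh2 [] [] w = w.
Proof. by elim: w => [|[L a R] w IH] //=; rewrite IH /whl /= app_nil_r. Qed.

Lemma wt3_ctx (d c : ob G) p q g f g' f' v P w :
  wt2 d c g' p g -> wt2 d c f q f' -> wt3 d c g f v P w ->
  wt3 d c g' f' (p ++ v ++ q) (wh3 p [] [] q P) (p ++ w ++ q).
Proof.
move=> hp hq hP; have h1 : wt1 d [] d by []. have h2 : wt1 c [] c by [].
have := wt3_wh (L := []) (R := []) _ h1 h2 _ hP; rewrite /= !app_nil_r !wh2_nil.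
by move/(_ _ _ _ _ hp hq).
Qed.
Lemma ev3_ctx (d c : ob G) p q g f g' f' v P w :
  wt2 d c g' p g -> wt2 d c f q f' -> wt3 d c g f v P w ->
  ev3 c f' (p ++ w ++ q) (wh3 p [] [] q P) =
  id3 (ev2 c g p) ⊚ (ev3 c f w P ⊚ id3 (ev2 c f' q)).
Proof.
move=> hp hq hP; have h1 : wt1 d [] d by []. have h2 : wt1 c [] c by [].
have := ev3_wh HG (L := []) (R := []) _ h1 h2 _ hP; rewrite /= !app_nil_r !wh2_nil.
move/(_ _ _ _ _ hp hq) => ->.
by rewrite (wl3_id1 (ev3_is3 HG hP)) (wr3_id1 (ev3_is3 HG hP)).
Qed.

Lemma comp3_idl' (A : m3 G) a b f g c d : is3 A a b f g c d -> id3 (id2 g) ⊚ A = A.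
Proof. move=> h; have e : t32 A = g by crush. by rewrite -e (comp3_idl H2). Qed.
Lemma comp3_idr' (A : m3 G) a b f g c d : is3 A a b f g c d -> A ⊚ id3 (id2 f) = A.
Proof. move=> h; have e : s32 A = f by crush. by rewrite -e (comp3_idr H2). Qed.

Lemma comp2_idr' (mu : m2 G) f g c d : is2 mu f g c d -> mu ∘ id2 f = mu.
Proof. by move=> [[<- _] _]; rewrite (comp2_idr H2). Qed.

Lemma r3_id a w g f d c : repr2 a w g f d c -> repr3 (id3 a) [] w w g f d c.
Proof. by move=> [h ->]. Qed.
Lemma r3_atom X a b u v g f d c : arr3 X a b -> repr2 a u g f d c -> repr2 b v g f d c ->
  repr3 X [Step [] [] (Atom3 X c d f g u v) [] []] v u g f d c.
Proof.
move=> hX [hu eu] [hv ev].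
have b1 := ev2_is2 HG hu; have b2 := ev2_is2 HG hv.
rewrite eu ev in hX; have tX : is3 X _ _ _ _ _ _ := conj hX (conj b1 b2).
have f1 := wt2_src hu; have f2 := wt2_tgt hu.
split.
  rewrite /= /srcs /tgts /wts /wta3 /inner /outer /= !wh2_nil !app_nil_r; by repeat first [assumption | split].
rewrite /= /evs /evc /outer /= !app_nil_r.
rewrite (wl3_id1 tX) (wr3_id1 tX) (comp3_idr' tX) (comp3_idl' tX).
have e : s3 X = ev2 c f u by crush.
by rewrite -e (vcomp_idr H2).
Qed.
Lemma r3_vc A B P Q v u w g f d c :
  repr3 A P v u g f d c -> repr3 B Q u w g f d c -> repr3 (A • B) (P ++ Q) v w g f d c.
Proof.
move=> [h1 ->] [h2 ->]; split; first exact: wt3_app h1 h2.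
by rewrite (ev3_app HG h1 h2).
Qed.
(** A path is sequential, so interchange is used to put the right factor first: [B] acts beside the
    source of [A], then [A] beside the target of [B]. *)
Lemma r3_hc A B P Q v w v' w' h g f d c :
  repr3 A P v w h g d c -> repr3 B Q v' w' g f d c ->
  repr3 (A ⊚ B) (wh3 [] [] [] v' P ++ wh3 w [] [] [] Q) (v ++ v') (w ++ w') h f d c.
Proof.
move=> [h1 ->] [h2 ->].
have hh : wt2 d c h [] h by split=> //; apply: wt2_tgt (wt3_src h1).
have hf : wt2 d c f [] f by split=> //; apply: wt2_src (wt3_src h2).
have k1 := wt3_ctx hh (wt3_tgt h2) h1.
have k2 := wt3_ctx (wt3_src h1) hf h2; rewrite !app_nil_r in k2.
split; first exact: wt3_app k1 k2.
have e1 := ev3_ctx hh (wt3_tgt h2) h1.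
have e2 := ev3_ctx (wt3_src h1) hf h2; rewrite !app_nil_r in e2.
have t1 := ev3_is3 HG h1; have t2 := ev3_is3 HG h2.
rewrite (ev3_app HG k1 k2) e1 e2 /= (comp3_idr' t2).
have i1 := is3_id HG (ev2_is2 HG (wt3_src h1)); have i2 := is3_id HG (ev2_is2 HG (wt3_tgt h2)).
rewrite (comp3_idl' (is3_hc HG t1 i2)).
rewrite -(interchange H2); try by crush.
by case: t1 t2 => -[{2}<- _] _ [[_ {2}<-] _]; rewrite (vcomp_idr H2) (vcomp_idl H2).
Qed.
Lemma r3_wl K k A P v w g f e d c : repr1 K k e d -> repr3 A P v w g f d c ->
  repr3 (K ◀ A) (wh3 [] k [] [] P) (wh2 k [] v) (wh2 k [] w) (k ++ g) (k ++ f) e c.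
Proof.
move=> [hk ->] [hP ->]; have h0 : wt1 c [] c by [].
have h1 := wt2_tgt (wt3_src hP); have h2 := wt2_src (wt3_src hP).
have p1 : wt2 e c (k ++ g ++ []) [] (k ++ g ++ []).
  by split=> //; rewrite app_nil_r; exact: wt1_app hk h1.
have p2 : wt2 e c (k ++ f ++ []) [] (k ++ f ++ []).
  by split=> //; rewrite app_nil_r; exact: wt1_app hk h2.
have := wt3_wh p1 hk h0 p2 hP; have := ev3_wh HG p1 hk h0 p2 hP.
rewrite /= !app_nil_r /repr3 => -> h; split=> //.
have t := is3_wl HG (ev1_arr HG hk) (ev3_is3 HG hP).
rewrite (wr3_id1 t) (ev1_app HG hk h1) (ev1_app HG hk h2).
by rewrite (comp3_idr' t) (comp3_idl' t).
Qed.
Lemma r3_wr K k A P v w g f e d c : repr3 A P v w g f e d -> repr1 K k d c ->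
  repr3 (A ▶ K) (wh3 [] [] k [] P) (wh2 [] k v) (wh2 [] k w) (g ++ k) (f ++ k) e c.
Proof.
move=> [hP ->] [hk ->]; have h0 : wt1 e [] e by [].
have h1 := wt2_tgt (wt3_src hP); have h2 := wt2_src (wt3_src hP).
have p1 : wt2 e c ([] ++ g ++ k) [] ([] ++ g ++ k) by split=> //=; exact: wt1_app h1 hk.
have p2 : wt2 e c ([] ++ f ++ k) [] ([] ++ f ++ k) by split=> //=; exact: wt1_app h2 hk.
have := wt3_wh p1 h0 hk p2 hP; have := ev3_wh HG p1 h0 hk p2 hP.
rewrite /= !app_nil_r /repr3 => -> h; split=> //.
have t := is3_wr HG (ev1_arr HG hk) (ev3_is3 HG hP).
rewrite (wl3_id1 (ev3_is3 HG hP)) (ev1_app HG h1 hk) (ev1_app HG h2 hk).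
by rewrite (comp3_idr' t) (comp3_idl' t).
Qed.

(** By [sigma_left], [sigma_right] and [sigma_mid], a tensorator of whiskered atoms depends, up to
    outer whiskering, only on the two atoms and the list [M] between them. Putting [M] on the side
    of [b] gives every such tensorator the same normal form. *)
Definition sigma_atom (a : atom2 G) (M : list (m1 G)) (b : atom2 G) : atom3 G :=
  Atom3 (sigma (cell2 a) (ev1 (cod2 b) M ◁ cell2 b)) (dom2 b) (cod2 a)
    (src2 a ++ M ++ src2 b) (tgt2 a ++ M ++ tgt2 b)
    [Letter2 [] a (M ++ tgt2 b); Letter2 (src2 a ++ M) b []]
    [Letter2 (tgt2 a ++ M) b []; Letter2 [] a (M ++ src2 b)].
Definition sigma_step (x y : letter2 G) (q : list (letter2 G)) : step G :=
  Step [] (left2 x) (sigma_atom (core2 x) (right2 x ++ left2 y) (core2 y)) (right2 y) q.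
(** Iterates [sigma_compr]: the letter [x] crosses the letters of [v] one at a time. [sigma_word]
    does the same with [sigma_compl]. *)
Fixpoint sigma_letter (x : letter2 G) (v : list (letter2 G)) : list (step G) :=
  match v with
  | [] => []
  | y :: v => wh3 [whl (tgtl x) [] y] [] [] [] (sigma_letter x v) ++
              [sigma_step x y (wh2 (srcl x) [] v)]
  end.
(* [g] and [f] are the target and source of the word [v]. *)
Fixpoint sigma_word (w v : list (letter2 G)) (g f : list (m1 G)) : list (step G) :=
  match w with
  | [] => []
  | x :: w => wh3 [] [] [] (wh2 [] f w) (sigma_letter x v) ++
              wh3 [whl [] g x] [] [] [] (sigma_word w v g f)
  end.

Lemma is3_sigma (mu nu : m2 G) f g f' g' c d e : is2 mu f g d e -> is2 nu f' g' c d ->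
  is3 (sigma mu nu) ((mu ▷ g') ∘ (f ◁ nu)) ((g ◁ nu) ∘ (mu ▷ f')) (f □ f') (g □ g') c e.
Proof.
move=> h1 h2; have : s21 mu = t21 nu by crush.
move=> /(sigma_arr HS) h; case: (h1) (h2) => -[e1 e2] [h3 h4] [[e3 e4] [h5 h6]].
rewrite e1 e2 e3 e4 in h; split=> //; split.
  by apply: (is2_comp HG) (is2_wr HG h6 h1) (is2_wl HG h3 h2).
by apply: (is2_comp HG) (is2_wl HG h4 h2) (is2_wr HG h5 h1).
Qed.
Lemma sigma_step_ev (d e c : ob G) x y q : wtl d e x -> wtl e c y ->
  evc c (sigma_step x y q) = sigma (evl e x) (evl c y) /\ wta3 (core3 (sigma_step x y q)).
Proof.
case: x => L a R; case: y => L' b R' [/= h1 [[h2 [h3 h4]] h5]] [/= k1 [[k2 [k3 k4]] k5]].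
have a1 := ev1_arr HG h1; have a2 := ev1_arr HG h2; have a3 := ev1_arr HG h3.
have a5 := ev1_arr HG h5; have b1 := ev1_arr HG k1; have b2 := ev1_arr HG k2.
have b3 := ev1_arr HG k3; have b5 := ev1_arr HG k5.
have ta : is2 (cell2 a) _ _ _ _ := conj h4 (conj a2 a3).
have tb : is2 (cell2 b) _ _ _ _ := conj k4 (conj b2 b3).
have hM := wt1_app h5 k1; have aM := ev1_arr HG hM.
have t1 := is2_wr HG a5 ta; have t2 := is2_wl HG a1 t1.
have t3 := is2_wl HG b1 tb; have t4 := is2_wl HG aM tb; have t5 := is2_wl HG a1 ta.
have t6 := is2_wr HG a5 t5; have t7 := is2_wr HG b5 t3.
split.
  rewrite /evc /evl /= (ev1_app HG h5 k1).
  rewrite (sigma_right HS); try by crush.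
  rewrite (wlr2_assoc HB); try by crush.
  rewrite (sigma_left HS); try by crush.
  rewrite (sigma_mid HS); try by crush.
  rewrite (wl2_assoc HB) //; crush.
have l1 : wtl (cod2 a) (dom2 b) (Letter2 [] a (right2 (Letter2 L a R) ++ L' ++ tgt2 b)).
  by split=> //; split=> //=; apply: wt1_app h5 (wt1_app k1 k3).
have l2 : wtl (cod2 a) (dom2 b) (Letter2 (src2 a ++ R ++ L') b []).
  by split=> //=; apply: wt1_app h2 hM.
have l3 : wtl (cod2 a) (dom2 b) (Letter2 (tgt2 a ++ R ++ L') b []).
  by split=> //=; apply: wt1_app h3 hM.
have l4 : wtl (cod2 a) (dom2 b) (Letter2 [] a (R ++ L' ++ src2 b)).
  by split=> //; split=> //=; apply: wt1_app h5 (wt1_app k1 k2).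
have s : is3 (sigma (cell2 a) (ev1 (cod2 b) (R ++ L') ◁ cell2 b)) _ _ _ _ _ _ := is3_sigma ta t4.
have W1 : wt2 (cod2 a) (dom2 b) (tgt2 a ++ (R ++ L') ++ tgt2 b)
   [Letter2 [] a ((R ++ L') ++ tgt2 b); Letter2 (src2 a ++ R ++ L') b []] (src2 a ++ (R ++ L') ++ src2 b).
  rewrite /= /srcl /tgtl /= -!app_assoc !app_nil_r; do !split=> //=; try by case: l1 l2 => ? [? ?] [? [? ?]].
  by apply: wt1_app h2 _; rewrite app_assoc; apply: wt1_app hM k2.
have W2 : wt2 (cod2 a) (dom2 b) (tgt2 a ++ (R ++ L') ++ tgt2 b)
   [Letter2 (tgt2 a ++ R ++ L') b []; Letter2 [] a ((R ++ L') ++ src2 b)] (src2 a ++ (R ++ L') ++ src2 b).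
  rewrite /= /srcl /tgtl /= -!app_assoc !app_nil_r; do !split=> //=; try by case: l3 l4 => ? [? ?] [? [? ?]].
  by apply: wt1_app h2 _; rewrite app_assoc; apply: wt1_app hM k2.
split; first by [].
split; first by [].
have F : forall u w, wt1 (cod2 b) u (dom2 b) -> wt1 (cod2 a) w (dom2 a) ->
  evl (dom2 b) (Letter2 [] a ((R ++ L') ++ u)) =
    cell2 a ▷ (ev1 (cod2 b) (R ++ L') □ ev1 (dom2 b) u) /\
  evl (dom2 b) (Letter2 (w ++ R ++ L') b []) =
    ev1 (dom2 a) w ◁ ev1 (cod2 b) (R ++ L') ◁ cell2 b.
  move=> u w hu hw; rewrite /evl /= (ev1_app HG hM hu) (wl2_id1 ta) (ev1_app HG hw hM).
  have aw := ev1_arr HG hw.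
  split=> //; rewrite -(wl2_assoc HB); try by crush.
  exact: (wr2_id1 (is2_wl HG (is1_box HG aw aM) tb)).
have [F1 F2] := F _ _ k3 h2; have [F3 F4] := F _ _ k2 h3.
have E : ev1 (dom2 b) (src2 a ++ (R ++ L') ++ src2 b) =
    ev1 (dom2 a) (src2 a) □ (ev1 (cod2 b) (R ++ L') □ ev1 (dom2 b) (src2 b)).
  by rewrite (ev1_app HG h2 (wt1_app hM k2)) (ev1_app HG hM k2).
have u1 := is2_wl HG a2 (is2_wl HG aM tb).
have u2 := is2_wr HG (is1_box HG aM b2) ta.
case: s => -[s1 s2] _; split; rewrite /= ?s1 ?s2 E ?F1 ?F2 ?F3 ?F4.
  by rewrite (comp2_idr' u1).
by rewrite (comp2_idr' u2).
Qed.

Lemma r2_letter (d c : ob G) k : wtl d c k -> repr2 (evl c k) [k] (tgtl k) (srcl k) d c.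
Proof.
move=> h; split; first by split=> //; split=> //; split=> //; exact: wtl_src.
by rewrite /= (comp2_idr' (evl_is2 HG h)).
Qed.
Lemma r1_ev (d c : ob G) w : wt1 d w c -> repr1 (ev1 c w) w d c.
Proof. by []. Qed.
Lemma r2_ev (d c : ob G) g w f : wt2 d c g w f -> repr2 (ev2 c f w) w g f d c.
Proof. by []. Qed.

Lemma sigma_step_ok (d e c : ob G) x y : wtl d e x -> wtl e c y ->
  repr3 (sigma (evl e x) (evl c y)) [sigma_step x y []]
    [whl (tgtl x) [] y; whl [] (srcl y) x] [whl [] (tgtl y) x; whl (srcl x) [] y]
    (tgtl x ++ tgtl y) (srcl x ++ srcl y) d c.
Proof.
move=> hx hy; have [ev ok] := sigma_step_ev [] hx hy.
have lx := wtl_src hx; have tx := wtl_tgt hx; have ly := wtl_src hy; have ty := wtl_tgt hy.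
have h0 : wt1 e [] e by []. have h0' : wt1 c [] c by []. have h0'' : wt1 d [] d by [].
have eo : outer (sigma_step x y []) = tgtl x ++ tgtl y.
  by rewrite /outer /srcl /tgtl /= -!app_assoc.
have ei : inner (sigma_step x y []) = srcl x ++ srcl y.
  by rewrite /inner /srcl /tgtl /= -!app_assoc.
have W : wts d c (tgtl x ++ tgtl y) (srcl x ++ srcl y) (sigma_step x y []).
  rewrite /wts eo ei; split; first by split=> //; exact: wt1_app tx ty.
  split; last by split=> //; exact: wt1_app lx ly.
  by case: hx => hx _; case: hy => _ [_ hy].
have E1 : tgts (sigma_step x y []) = [whl (tgtl x) [] y; whl [] (srcl y) x].
  by rewrite /tgts /sigma_step /srcl /tgtl /= /whl /= ?app_nil_r -?app_assoc.
have E2 : srcs (sigma_step x y []) = [whl [] (tgtl y) x; whl (srcl x) [] y].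
  by rewrite /srcs /sigma_step /srcl /tgtl /= /whl /= ?app_nil_r -?app_assoc.
have E2' : wh2 (left3 (sigma_step x y [])) (right3 (sigma_step x y []))
    (src3 (core3 (sigma_step x y []))) = [whl [] (tgtl y) x; whl (srcl x) [] y].
  exact: E2.
have ws := wts_src W; rewrite E2 in ws.
split; first by rewrite /= E1 E2.
have t := evs_is3 HG W; have t' := evc_is3 HG W; rewrite E2 in t.
rewrite eo ei in t'; rewrite /= /evs eo -ev.
have -> : post (sigma_step x y []) = [] by [].
have -> : pre (sigma_step x y []) = [] by [].
rewrite /= (comp3_idr' t') (comp3_idl' t').
have -> : evl c (whl [] (tgtl y) x) ∘ (evl c (whl (srcl x) [] y) ∘ id2 (ev1 c (srcl x ++ srcl y)))
  = s3 (evc c (sigma_step x y [])).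
  have [[-> _] _] := t'.
  by rewrite E2'.
by rewrite (vcomp_idr H2).
Qed.

Lemma sigma_letter_ok (d e c : ob G) x g v f : wtl d e x -> wt2 e c g v f ->
  repr3 (sigma (evl e x) (ev2 c f v)) (sigma_letter x v)
    (wh2 (tgtl x) [] v ++ [whl [] f x]) (whl [] g x :: wh2 (srcl x) [] v)
    (tgtl x ++ g) (srcl x ++ f) d c.
Proof.
move=> hx; have rx := r2_letter hx; have tx := evl_is2 HG hx.
have lx := wtl_src hx; have tx' := wtl_tgt hx.
elim: v g => [|y v IH] g /=.
  move=> [-> hf]; have af := ev1_arr HG hf.
  rewrite (sigma_idr HS); last by crush.
  apply: r3_id; exact: (r2_wr rx (r1_ev hf)).
move=> [-> [hy hv]]; have ty := evl_is2 HG hy; have tv := ev2_is2 HG hv.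
rewrite (sigma_compr HS); try by crush.
have e1 : t2 (evl e x) = ev1 e (tgtl x) by crush.
have e2 : s2 (evl e x) = ev1 e (srcl x) by crush.
rewrite e1 e2; have hv' := wt2_src hv.
have k1 := r3_id (r2_wl (r1_ev tx') (r2_letter hy)).
have k2 := r3_id (r2_wl (r1_ev lx) (r2_ev hv)).
have k3 := r3_hc k1 (IH _ hv).
have k4 := r3_hc (sigma_step_ok hx hy) k2.
have := r3_vc k3 k4.
by rewrite /= /whs /= app_nil_r.
Qed.

Lemma sigma_word_ok (d e c : ob G) w h k g v f : wt2 d e k w h -> wt2 e c g v f ->
  repr3 (sigma (ev2 e h w) (ev2 c f v)) (sigma_word w v g f)
    (wh2 k [] v ++ wh2 [] f w) (wh2 [] g w ++ wh2 h [] v)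
    (k ++ g) (h ++ f) d c.
Proof.
move=> hw hv; have tv := ev2_is2 HG hv; have hf := wt2_src hv; have hg := wt2_tgt hv.
elim: w k hw => [|x w IH] k /=.
  move=> [-> hh]; have ah := ev1_arr HG hh.
  rewrite (sigma_idl HS); last by crush.
  rewrite app_nil_r; apply: r3_id; exact: (r2_wl (r1_ev hh) (r2_ev hv)).
move=> [-> [hx hw]]; have tx := evl_is2 HG hx; have tw := ev2_is2 HG hw.
rewrite (sigma_compl HS); try by crush.
have e1 : s2 (ev2 c f v) = ev1 c f by crush.
have e2 : t2 (ev2 c f v) = ev1 c g by crush.
rewrite e1 e2.
have k1 := r3_id (r2_wr (r2_ev hw) (r1_ev hf)).
have k2 := r3_id (r2_wr (r2_letter hx) (r1_ev hg)).
have k3 := r3_hc (sigma_letter_ok hx hv) k1.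
have k4 := r3_hc k2 (IH _ hw).
have := r3_vc k3 k4.
by rewrite /= app_nil_r -app_assoc.
Qed.

Lemma r3_sigma mu nu w v k h g f d e c : repr2 mu w k h d e -> repr2 nu v g f e c ->
  repr3 (sigma mu nu) (sigma_word w v g f)
    (wh2 k [] v ++ wh2 [] f w) (wh2 [] g w ++ wh2 h [] v) (k ++ g) (h ++ f) d c.
Proof. by move=> [h1 ->] [h2 ->]; exact: sigma_word_ok. Qed.

Definition goal3 (d c : ob G) g f v w P Q : Prop :=
  wt3 d c g f v P w -> wt3 d c g f v Q w -> ev3 c f w P = ev3 c f w Q.

Lemma eq_by_paths X Y P Q v w g f d c :
  repr3 X P v w g f d c -> repr3 Y Q v w g f d c -> goal3 d c g f v w P Q -> X = Y.
Proof. by move=> [h1 ->] [h2 ->] h; exact: h. Qed.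
Lemma goal3_l (d c : ob G) g f v w P P' Q :
  path_le d c g f v w P P' -> goal3 d c g f v w P' Q -> goal3 d c g f v w P Q.
Proof. by move=> h1 h2 /h1 [h3 ->]; exact: h2. Qed.
Lemma goal3_refl (d c : ob G) g f v w P : goal3 d c g f v w P P.
Proof. by []. Qed.

(* Variants whose matching conditions are separate equations: the words of the
   factors are computed independently before they are compared. *)
Lemma r2_comp_eq mu nu u v h g g' f d c :
  repr2 mu u h g d c -> repr2 nu v g' f d c -> g = g' -> repr2 (mu ∘ nu) (u ++ v) h f d c.
Proof. by move=> h1 h2 e; rewrite -e in h2; exact: r2_comp h1 h2. Qed.
Lemma r3_atom_eq X a b u v g f g' f' d c :
  arr3 X a b -> repr2 a u g f d c -> repr2 b v g' f' d c -> g = g' -> f = f' ->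
  repr3 X [Step [] [] (Atom3 X c d f g u v) [] []] v u g f d c.
Proof. by move=> h h1 h2 e e'; rewrite -e -e' in h2; exact: r3_atom h h1 h2. Qed.
Lemma r3_vc_eq A B P Q v u u' w g f g' f' d c :
  repr3 A P v u g f d c -> repr3 B Q u' w g' f' d c -> u = u' -> g = g' -> f = f' ->
  repr3 (A • B) (P ++ Q) v w g f d c.
Proof. by move=> h1 h2 e e' e''; rewrite -e -e' -e'' in h2; exact: r3_vc h1 h2. Qed.
Lemma r3_hc_eq A B P Q v w v' w' h g g' f d c :
  repr3 A P v w h g d c -> repr3 B Q v' w' g' f d c -> g = g' ->
  repr3 (A ⊚ B) (wh3 [] [] [] v' P ++ wh3 w [] [] [] Q) (v ++ v') (w ++ w') h f d c.
Proof. by move=> h1 h2 e; rewrite -e in h2; exact: r3_hc h1 h2. Qed.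
Lemma eq_by_paths_eq X Y P Q v w g f v' w' g' f' d c :
  repr3 X P v w g f d c -> repr3 Y Q v' w' g' f' d c ->
  v = v' -> w = w' -> g = g' -> f = f' -> goal3 d c g f v w P Q -> X = Y.
Proof. by move=> h1 h2 e1 e2 e3 e4; rewrite -e1 -e2 -e3 -e4 in h2; exact: eq_by_paths h1 h2. Qed.
(** The continuation [K] lets the paths be existential variables, filled in by traversing [X] and
    [Y], before the facts about them enter the context. *)
Lemma rule_of_eq_eq X Y S S' vs ws gs fs vs' ws' gs' fs' ds cs (K : Prop) :
  X = Y -> repr3 X S vs ws gs fs ds cs -> repr3 Y S' vs' ws' gs' fs' ds cs ->
  vs = vs' -> ws = ws' -> gs = gs' -> fs = fs' ->
  (wt3 ds cs gs fs vs S ws -> wt3 ds cs gs fs vs S' ws ->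
   ev3 cs fs ws S = ev3 cs fs ws S' -> K) -> K.
Proof.
move=> -> [h1 ->] [h2 e] e1 e2 e3 e4; rewrite -e1 -e2 -e3 -e4 in h2 e *.
by move=> h; apply: h h1 h2 e.
Qed.

Lemma eq2_of a b u v g g' f f' d c : repr2 a u g f d c -> repr2 b v g' f' d c ->
  u = v -> f = f' -> a = b.
Proof. by move=> [_ ->] [_ ->] -> ->. Qed.
Lemma arr1_of F w d c : repr1 F w d c -> arr1 F c d.
Proof. by move=> [/(ev1_arr HG) h ->]. Qed.
Lemma arr2_of a F F' w g f g' f' d c : repr2 a w g f d c -> repr1 F f' d c -> repr1 F' g' d c ->
  f = f' -> g = g' -> arr2 a F F'.
Proof. by move=> [/(ev2_is2 HG) [h _] ->] [_ ->] [_ ->] <- <-. Qed.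
Lemma arr3_of X a b P v w g f u u' g' f' g'' f'' d c : repr3 X P v w g f d c ->
  repr2 a u g' f' d c -> repr2 b u' g'' f'' d c ->
  w = u -> v = u' -> f = f' -> f = f'' -> arr3 X a b.
Proof. by move=> [/(ev3_is3 HG) [h _] ->] [_ ->] [_ ->] <- <- <- <-. Qed.
End Repr.

(** * Calculus of paths *)

Section Duals.
Context (C : gray_category_with_duals).
Let HP := gcd_planar C.
Let HD := gcd_duals C.
Let HG := gcd_gray C.
Let H2 := gray_hom HG.
Let HB := gray_box HG.
Let HS := gray_sigma HG.

Lemma leaf1_sharp (F : m1 C) c d : arr1 F c d -> arr1 F^# d c.
Proof. by move=> [<- <-]; exact: (sharp1_arr HD). Qed.
Lemma leaf2_star (mu : m2 C) f g : arr2 mu f g -> arr2 mu^* g f.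
Proof. by move=> [<- <-]; exact: (star2_arr HP). Qed.
Lemma leaf2_eta (F : m1 C) c d : arr1 F c d -> arr2 (eta F) (id1 d) (F □ F^#).
Proof. by move=> [_ <-]; exact: (eta_arr HD). Qed.
Lemma leaf2_eta_sharp (F : m1 C) c d : arr1 F c d -> arr2 (eta F^#) (id1 c) (F^# □ F).
Proof. by move=> /leaf1_sharp /leaf2_eta; rewrite (sharp1_inv HD). Qed.
Lemma leaf3_star (A : m3 C) a b : arr3 A a b -> arr3 A^⋆ b^* a^*.
Proof. by move=> [<- <-]; exact: (star3_arr HP). Qed.
Lemma leaf3_eps (mu : m2 C) f g : arr2 mu f g -> arr3 (eps mu) (id2 g) (mu ∘ mu^*).
Proof. by move=> [_ <-]; exact: (eps_arr HP). Qed.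
Lemma leaf3_eps_star (mu : m2 C) f g : arr2 mu f g -> arr3 (eps mu)^⋆ (mu ∘ mu^*) (id2 g).
Proof.
move=> h; have := leaf3_star (leaf3_eps h); rewrite (star2_id HP) (star2_comp HP) ?(star2_inv HP) //.
by case: h (leaf2_star h) => -> _ [_ ->].
Qed.
Lemma leaf3_T (F : m1 C) : arr3 (T F) (((eta F)^* ▷ F) ∘ (F ◁ eta F^#)) (id2 F).
Proof. exact: (T_arr HD). Qed.
Lemma leaf3_T_sharp (F : m1 C) :
  arr3 (T F^#) (((eta F^#)^* ▷ F^#) ∘ (F^# ◁ eta F)) (id2 F^#).
Proof. by have := T_arr HD F^#; rewrite (sharp1_inv HD). Qed.

Lemma goal3_sym (G : gray_data) (d c : ob G) g f v w P Q :
  goal3 d c g f v w P Q -> goal3 d c g f v w Q P.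
Proof. by move=> h h1 h2; rewrite h. Qed.

(** * Tactics for typing and for rewriting paths *)

Ltac gray := match goal with C : gray_category_with_duals |- _ => constr:(gcd_gray C) end.

Ltac rp1 :=
  let HG := gray in
  lazymatch goal with
  | |- repr1 (id1 _) _ _ _ => apply r1_id
  | |- repr1 (_ □ _) _ _ _ => eapply (r1_box HG); [rp1|rp1]
  | |- repr1 (ev1 _ _) _ _ _ => eassumption
  | |- _ => eapply (r1_atom HG); leaf1
  end
with leaf1 :=
  lazymatch goal with
  | |- arr1 (_ ^#) _ _ => first [eassumption | eapply leaf1_sharp; leaf1]
  | |- _ => eassumption
  end.

Ltac leaf2 :=
  lazymatch goal with
  | |- arr2 (eta (_ ^#)) _ _ => eapply leaf2_eta_sharp; leaf1
  | |- arr2 (eta _) _ _ => eapply leaf2_eta; leaf1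
  | |- arr2 (_ ^*) _ _ => first [eassumption | eapply leaf2_star; leaf2]
  | |- _ => eassumption
  end.

Ltac rp2 :=
  let HG := gray in
  lazymatch goal with
  | |- repr2 (id2 _) _ _ _ _ _ => eapply r2_id; rp1
  | |- repr2 (_ ∘ _) _ _ _ _ _ => eapply (r2_comp_eq HG); [rp2|rp2|reflexivity]
  | |- repr2 (_ ◁ _) _ _ _ _ _ => eapply (r2_wl HG); [rp1|rp2]
  | |- repr2 (_ ▷ _) _ _ _ _ _ => eapply (r2_wr HG); [rp2|rp1]
  | |- _ => eapply (r2_atom HG); [first [eassumption | leaf2] | rp1 | rp1]
  end.

Ltac leaf3 :=
  lazymatch goal with
  | |- arr3 (eps _)^⋆ _ _ => eapply leaf3_eps_star; leaf2
  | |- arr3 (eps _) _ _ => eapply leaf3_eps; leaf2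
  | |- arr3 (T (_ ^#)) _ _ => eapply leaf3_T_sharp
  | |- arr3 (T _) _ _ => eapply leaf3_T
  | |- arr3 (_ ^⋆) _ _ => first [eassumption | eapply leaf3_star; leaf3]
  | |- _ => eassumption
  end.

(** A term not headed by one of these operations becomes an atom, typed by a hypothesis or by a leaf
    lemma. Hence the lists of boundary facts in the proofs below: they make [sharp2 nu],
    [phi F G nu], [Phi2 rho nu] and the like single generators as long as they are not unfolded. *)
Ltac rp3 :=
  let HG := gray in
  lazymatch goal with
  | |- repr3 (id3 _) _ _ _ _ _ _ _ => eapply r3_id; rp2
  | |- repr3 (_ • _) _ _ _ _ _ _ _ =>
      eapply (r3_vc_eq HG); [rp3|rp3|reflexivity|reflexivity|reflexivity]
  | |- repr3 (_ ⊚ _) _ _ _ _ _ _ _ => eapply (r3_hc_eq HG); [rp3|rp3|reflexivity]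
  | |- repr3 (_ ◀ _) _ _ _ _ _ _ _ => eapply (r3_wl HG); [rp1|rp3]
  | |- repr3 (_ ▶ _) _ _ _ _ _ _ _ => eapply (r3_wr HG); [rp3|rp1]
  | |- repr3 (sigma _ _) _ _ _ _ _ _ _ => eapply (r3_sigma HG); [rp2|rp2]
  | |- _ => eapply (r3_atom_eq HG);
      [first [eassumption | leaf3] | rp2 | rp2 | reflexivity | reflexivity]
  end.

Ltac ty1 := let HG := gray in eapply (arr1_of HG); rp1.
Ltac ty2 := let HG := gray in eapply (arr2_of HG); [rp2 | rp1 | rp1 | reflexivity | reflexivity].
Ltac ty3 := let HG := gray in eapply (arr3_of HG);
  [rp3 | rp2 | rp2 | reflexivity | reflexivity | reflexivity | reflexivity].
Ltac eq2 := eapply eq2_of; [rp2 | rp2 | reflexivity | reflexivity].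

(** Only list operations and projections are unfolded, so the cells themselves stay as they are and
    paths can be compared syntactically. *)
Ltac pcompute t :=
  eval cbv beta iota zeta delta
    [app map fold_right fold_left firstn skipn length nth Nat.add Nat.sub Nat.leb
     wh2 wh3 whl whs sigma_letter sigma_word sigma_step sigma_atom srcl tgtl srcs tgts
     inner outer start swap_at swap2 swaps swap_left swap_right goes_left goes_right insert sort
     cell2 dom2 cod2 src2 tgt2 left2 core2 right2 cell3 dom3 cod3 src31 tgt31 src3 tgt3
     post left3 core3 right3 pre] in t.
Ltac psimpl := match goal with |- ?g => let g' := pcompute g in change g' end.
Ltac psimpl_in H := let t := type of H in let t' := pcompute t in change t' in H.

(* [paths] reduces an equation between 3-morphisms to one between paths, of which the
   following tactics change the left one: [sw] interchanges the steps [k] and [k+1] for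
   each [k] in a list, [srt] normalizes the order of independent steps, and [rl k E]
   rewrites with [E], whiskered as needed, from step [k] on. *)
Ltac paths :=
  let HG := gray in
  eapply eq_by_paths_eq; [rp3 | rp3 | reflexivity | reflexivity | reflexivity | reflexivity | psimpl].

Ltac sw ks := let HG := gray in
  eapply goal3_l; [apply (swaps_le HG ks) | psimpl].
Ltac srt := let HG := gray in eapply goal3_l; [apply (sort_le HG) | psimpl].
Ltac flip := apply goal3_sym.
Ltac pdone := apply goal3_refl.

Ltac rule_at P1 P2 p L R q H1 H2 H3 :=
  let HG := gray in
  lazymatch goal with |- goal3 _ _ _ _ _ _ ?P _ =>
  lazymatch type of H3 with ev3 _ _ _ ?S = _ =>
  let P' := pcompute (P1 ++ wh3 p L R q S ++ P2) in
  first [constr_eq P P' | fail 3 "rule does not match"] end end;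
  eapply goal3_l;
  [ eapply (rule_le HG (P1 := P1) (P2 := P2) (p := p) (L := L) (R := R) (q := q) H1 H2 H3);
    [discriminate | reflexivity]
  | psimpl ].
Ltac with_rule E tac :=
  let H1 := fresh in let H2 := fresh in let H3 := fresh in
  eapply (rule_of_eq_eq E);
    [rp3 | rp3 | reflexivity | reflexivity | reflexivity | reflexivity | intros H1 H2 H3];
  psimpl_in H1; psimpl_in H2; psimpl_in H3; tac H1 H2 H3; clear H1 H2 H3.
Ltac rl k E := with_rule E ltac:(fun H1 H2 H3 =>
  lazymatch type of H3 with ev3 _ _ _ ?S = _ =>
  lazymatch goal with |- goal3 _ _ _ _ _ _ ?P _ =>
  let rest := pcompute (skipn k P) in
  lazymatch rest with ?s0 :: _ =>
  lazymatch S with ?s :: _ =>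
  let P1 := pcompute (firstn k P) in
  let P2 := pcompute (skipn (k + length S) P) in
  (* The context is what the step [s0] of the path has in excess of the first step [s] of the rule,
     on each of the four sides. *)
  let p := pcompute (firstn (length (post s0) - length (post s)) (post s0)) in
  let L := pcompute (firstn (length (left3 s0) - length (left3 s)) (left3 s0)) in
  let R := pcompute (skipn (length (right3 s)) (right3 s0)) in
  let q := pcompute (skipn (length (pre s)) (pre s0)) in
  rule_at P1 P2 p L R q H1 H2 H3
  end end end end).

(* The composite [t] on the left is fixed by [e], hence so is its star by
   [eps_nat], and the given triangle identity turns the latter into [t^⋆ = 1]. *)
Lemma eps_zigzag_l (mu : m2 C) f g c d : arr2 mu f g -> arr1 f c d -> arr1 g c d ->
  ((eps mu^*)^⋆ ⊚ id3 mu^*) • (id3 mu^* ⊚ eps mu) = id3 mu^*.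
Proof.
move=> hm hf hg; have z := eps_zigzag HP mu.
have hn : arr3 (eps mu^*)^⋆ (mu^* ∘ mu) (id2 f).
  by have := leaf3_eps_star (leaf2_star hm); rewrite (star2_inv HP).
have he := leaf3_eps hm.
set e := eps mu in he z |- *; set n := (eps mu^*)^⋆ in hn z |- *; set t := _ • _.
have E : (id3 mu ⊚ t) • e = e.
  rewrite /t; paths; sw [1]; rl 0 z; pdone.
have ht : arr3 t mu^* mu^* by rewrite /t; ty3.
have ht' : arr3 t^⋆ mu mu by have := leaf3_star ht; rewrite (star2_inv HP).
have N := eps_nat HP t^⋆; rewrite (star3_inv HP) in N.
case: (ht') => e1 e2; rewrite e1 e2 -/e E in N.
have K : t^⋆ = id3 mu.
  clear e1 e2 E; clearbody t.
  have -> : t^⋆ = t^⋆ • ((id3 mu ⊚ n) • (e ⊚ id3 mu)).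
    by rewrite z; paths; pdone.
  rewrite -[RHS]z; paths; sw [0]; rl 1 N; pdone.
by rewrite -(star3_inv HP t) K (star3_id HP).
Qed.

(** * Compatibility of duals with whiskering, composition and the tensorator *)

Lemma star2_wl (K : m1 C) mu f g c d e : arr1 K d e -> arr2 mu f g -> arr1 f c d -> arr1 g c d ->
  (K ◁ mu)^* = K ◁ mu^*.
Proof.
move=> hK hm hf hg.
have h1 : arr2 (K ◁ mu) (K □ f) (K □ g) by ty2.
have h2 : arr2 (K ◁ mu^*) (K □ g) (K □ f) by ty2.
have k1 : arr1 (K □ f) c e by ty1. have k2 : arr1 (K □ g) c e by ty1.
rewrite -(wr2_id1 HG (conj h1 (conj k1 k2))) (star2_box HP); try by crush.
  by rewrite (wr2_id1 HG (conj h2 (conj k2 k1))).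
have := id1_arr HB c; crush.
Qed.
Lemma star2_wr (K : m1 C) mu f g c d e : arr1 K c d -> arr2 mu f g -> arr1 f d e -> arr1 g d e ->
  (mu ▷ K)^* = mu^* ▷ K.
Proof.
move=> hK hm hf hg; have hm' := leaf2_star hm.
rewrite -{1}(wl2_id1 HG (conj hm (conj hf hg))) (star2_box HP); try by crush.
  by rewrite (wl2_id1 HG (conj hm' (conj hg hf))).
have := id1_arr HB e; crush.
Qed.
Lemma eps_wl (K : m1 C) mu f g c d e : arr1 K d e -> arr2 mu f g -> arr1 f c d -> arr1 g c d ->
  eps (K ◁ mu) = K ◀ eps mu.
Proof.
move=> hK hm hf hg.
have h1 : arr2 (K ◁ mu) (K □ f) (K □ g) by ty2.
have k1 : arr1 (K □ f) c e by ty1. have k2 : arr1 (K □ g) c e by ty1.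
rewrite -(wr2_id1 HG (conj h1 (conj k1 k2))) -(eps_box HP); try by crush.
  have h3 : arr3 (K ◀ eps mu) (K ◁ id2 g) (K ◁ (mu ∘ mu^*)) by ty3.
  apply: (wr3_id1 HG (a := K ◁ id2 g) (b := K ◁ (mu ∘ mu^*)) (f := K □ g) (g := K □ g) (d := e)).
  by split=> //; split; split=> //; ty2.
have := id1_arr HB c; crush.
Qed.
Lemma eps_wr (K : m1 C) mu f g c d e : arr1 K c d -> arr2 mu f g -> arr1 f d e -> arr1 g d e ->
  eps (mu ▷ K) = eps mu ▶ K.
Proof.
move=> hK hm hf hg; have hm' := leaf2_star hm.
rewrite -{1}(wl2_id1 HG (conj hm (conj hf hg))) -(eps_box HP); try by crush.
  congr (_ ▶ K).
  apply: (wl3_id1 HG (a := id2 g) (b := mu ∘ mu^*) (f := g) (g := g) (c := d)).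
  by split; [exact: leaf3_eps hm|split; split=> //; ty2].
have := id1_arr HB e; crush.
Qed.
Lemma star2_o (mu nu : m2 C) f g h : arr2 mu g h -> arr2 nu f g -> (mu ∘ nu)^* = nu^* ∘ mu^*.
Proof. by move=> h1 h2; apply: (star2_comp HP); crush. Qed.
Lemma eps_o (mu nu : m2 C) f g h : arr2 mu g h -> arr2 nu f g ->
  eps (mu ∘ nu) = (id3 mu ⊚ eps nu ⊚ id3 mu^*) • eps mu.
Proof. by move=> h1 h2; rewrite (eps_comp HP) //; crush. Qed.

(** The zigzag recovers [Y] from its mate. Since [eps_nat] describes the mate of a starred
    3-morphism, this is the tool for computing stars. *)
Lemma dual_inj (m n : m2 C) Y Y' f g c d : arr2 m f g -> arr1 f c d -> arr1 g c d ->
  arr2 n g f -> arr3 Y m^* n -> arr3 Y' m^* n ->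
  (id3 m ⊚ Y) • eps m = (id3 m ⊚ Y') • eps m -> Y = Y'.
Proof.
move=> hm hf hg hn.
have hn' : arr3 (eps m^*)^⋆ (m^* ∘ m) (id2 f).
  by have := leaf3_eps_star (leaf2_star hm); rewrite (star2_inv HP).
have z := eps_zigzag_l hm hf hg.
have K X : arr3 X m^* n ->
    X = ((eps m^*)^⋆ ⊚ id3 n) • (id3 m^* ⊚ ((id3 m ⊚ X) • eps m)).
  by move=> hX; paths; flip; sw [0]; rl 1 z; pdone.
by move=> hY hY' e; rewrite (K _ hY) (K _ hY') e.
Qed.

Section SigmaNat.
Context (mu : m2 C) (f g f' g' : m1 C) (c d e : ob C).
Context (hm : arr2 mu f g) (hf : arr1 f d e) (hg : arr1 g d e).
Context (hf' : arr1 f' c d).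

Lemma sigma_nat_r X a b : arr3 X a b -> arr2 a f' g' -> arr2 b f' g' ->
  sigma mu b • (id3 (mu ▷ g') ⊚ (f ◀ X)) = ((g ◀ X) ⊚ id3 (mu ▷ f')) • sigma mu a.
Proof.
move=> hX ha hb; have := @sigma_natr _ HS mu X; rewrite /t32 /s32 /t31 /t21 /s21.
have [-> ->] := hX; have [-> ->] := ha; have [-> ->] := hm => -> //.
by have [_ ->] := hf'; have [-> _] := hf.
Qed.
End SigmaNat.

Lemma sigma_nat_l X a b nu (f g f' g' : m1 C) (c d e : ob C) :
  arr3 X a b -> arr2 a f g -> arr2 b f g -> arr1 f d e -> arr1 g d e ->
  arr2 nu f' g' -> arr1 f' c d -> arr1 g' c d ->
  sigma b nu • ((X ▶ g') ⊚ id3 (f ◁ nu)) = (id3 (g ◁ nu) ⊚ (X ▶ f')) • sigma a nu.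
Proof.
move=> hX ha hb hf hg hn hf' hg'; have := @sigma_natl _ HS X nu.
rewrite /t32 /s32 /s31 /t21 /s21.
have [-> ->] := hX; have [-> ->] := ha; have [-> ->] := hn => -> //.
by have [_ ->] := hf'; have [-> _] := hf.
Qed.

(* Both sides are the mate of [sigma mu nu] with respect to [eps]. *)
Lemma sigma_star (mu nu : m2 C) f g f' g' c d e :
  arr2 mu f g -> arr1 f d e -> arr1 g d e -> arr2 nu f' g' -> arr1 f' c d -> arr1 g' c d ->
  (sigma mu nu)^⋆ = sigma mu^* nu^*.
Proof.
move=> hm hf hg hn hf' hg'.
have e1 : (g ◁ nu)^* = g ◁ nu^* := star2_wl hg hn hf' hg'.
have e2 : (f ◁ nu)^* = f ◁ nu^* := star2_wl hf hn hf' hg'.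
have e3 : (mu ▷ f')^* = mu^* ▷ f' := star2_wr hf' hm hf hg.
have e4 : (mu ▷ g')^* = mu^* ▷ g' := star2_wr hg' hm hf hg.
have t1 : arr2 (g ◁ nu) (g □ f') (g □ g') by ty2.
have t2 : arr2 (f ◁ nu) (f □ f') (f □ g') by ty2.
have t3 : arr2 (mu ▷ f') (f □ f') (g □ f') by ty2.
have t4 : arr2 (mu ▷ g') (f □ g') (g □ g') by ty2.
have em : ((g ◁ nu) ∘ (mu ▷ f'))^* = (mu^* ▷ f') ∘ (g ◁ nu^*) by rewrite (star2_o t1 t3) e1 e3.
have en : ((mu ▷ g') ∘ (f ◁ nu))^* = (f ◁ nu^*) ∘ (mu^* ▷ g') by rewrite (star2_o t4 t2) e2 e4.
have hs : arr3 (sigma mu nu) ((mu ▷ g') ∘ (f ◁ nu)) ((g ◁ nu) ∘ (mu ▷ f')) by ty3.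
apply: (@dual_inj ((g ◁ nu) ∘ (mu ▷ f')) ((f ◁ nu^*) ∘ (mu^* ▷ g')) _ _ (f □ f') (g □ g') c e); try by (ty1 || ty2).
- by rewrite -en; exact: leaf3_star hs.
- by rewrite em; ty3.
- have := eps_nat HP (sigma mu nu); case: hs => -> -> <-.
rewrite en (eps_o t4 t2) (eps_o t1 t3) e4 e1.
rewrite (eps_wl hf hn hf' hg') (eps_wl hg hn hf' hg') (eps_wr hf' hm hf hg) (eps_wr hg' hm hf hg).
have i1 : arr2 (nu ∘ nu^*) g' g' by ty2.
have i2 : arr2 (mu ∘ mu^*) g g by ty2.
have j1 := id2_arr H2 g'; have j2 := id2_arr H2 g.
have E1 := sigma_nat_r (leaf2_star hm) hg hg' (leaf3_eps hn) j1 i1.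
have E2 := sigma_nat_l (leaf3_eps hm) j2 i2 hg hg hn hf' hg'.
by paths; rl 1 (eq_sym E1); sw [0; 3]; rl 1 E2; pdone.
Qed.

(** The axioms relate whiskering to [star2] and [eps] only. As the star of [X] is its mate with
    respect to [eps], compatibility in the top dimension follows. *)
Lemma star3_wl (K : m1 C) X a b f g c d e : arr1 K d e -> arr3 X a b ->
  arr2 a f g -> arr2 b f g -> arr1 f c d -> arr1 g c d -> (K ◀ X)^⋆ = K ◀ X^⋆.
Proof.
move=> hK hX ha hb hf hg.
have ea := star2_wl hK ha hf hg; have eb := star2_wl hK hb hf hg.
have ha' := leaf2_star ha; have hb' := leaf2_star hb; have hX' := leaf3_star hX.
have tX : arr3 (K ◀ X) (K ◁ a) (K ◁ b) by ty3.
have n := eps_nat HP (K ◀ X); case: (tX) => e1 e2; rewrite e1 e2 in n.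
have n' := eps_nat HP X; case: (hX) => e3 e4; rewrite e3 e4 in n'.
apply: (@dual_inj (K ◁ b) (K ◁ a^*) _ _ (K □ f) (K □ g) c e); try by (ty1 || ty2).
- by have := leaf3_star tX; rewrite ea.
- by rewrite eb; ty3.
- rewrite -n ea (eps_wl hK ha hf hg) (eps_wl hK hb hf hg).
have E := f_equal (wl3 K) n'.
have h1 := leaf3_eps ha; have h2 := leaf3_eps hb.
have -> : (K ◀ X ⊚ id3 (K ◁ a^*)) • (K ◀ eps a) = K ◀ ((X ⊚ id3 a^*) • eps a).
  by paths; pdone.
by rewrite E; paths; pdone.
Qed.
Lemma star3_wr (K : m1 C) X a b f g c d e : arr1 K c d -> arr3 X a b ->
  arr2 a f g -> arr2 b f g -> arr1 f d e -> arr1 g d e -> (X ▶ K)^⋆ = X^⋆ ▶ K.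
Proof.
move=> hK hX ha hb hf hg.
have ea := star2_wr hK ha hf hg; have eb := star2_wr hK hb hf hg.
have ha' := leaf2_star ha; have hb' := leaf2_star hb; have hX' := leaf3_star hX.
have tX : arr3 (X ▶ K) (a ▷ K) (b ▷ K) by ty3.
have n := eps_nat HP (X ▶ K); case: (tX) => e1 e2; rewrite e1 e2 in n.
have n' := eps_nat HP X; case: (hX) => e3 e4; rewrite e3 e4 in n'.
apply: (@dual_inj (b ▷ K) (a^* ▷ K) _ _ (f □ K) (g □ K) c e); try by (ty1 || ty2).
- by have := leaf3_star tX; rewrite ea.
- by rewrite eb; ty3.
- rewrite -n ea (eps_wr hK ha hf hg) (eps_wr hK hb hf hg).
have E := f_equal (fun Y => wr3 Y K) n'.
have h1 := leaf3_eps ha; have h2 := leaf3_eps hb.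
have -> : (X ▶ K ⊚ id3 (a^* ▷ K)) • (eps a ▶ K) = ((X ⊚ id3 a^*) • eps a) ▶ K.
  by paths; pdone.
by rewrite E; paths; pdone.
Qed.

(** * Computing the star of a composite *)

Lemma st2_id (f : m1 C) : (id2 f)^* = id2 f.
Proof. exact: star2_id HP _. Qed.
Lemma st2_o (mu nu mu' nu' : m2 C) u v h g g' f d c :
  repr2 mu u h g d c -> repr2 nu v g' f d c -> g = g' -> mu^* = mu' -> nu^* = nu' ->
  (mu ∘ nu)^* = nu' ∘ mu'.
Proof.
move=> [/(ev2_is2 HG) [h1 _] e1] [/(ev2_is2 HG) [h2 _] e2] e <- <-; subst g'; rewrite -e1 -e2 in h1 h2.
exact: star2_o h1 h2.
Qed.
Lemma st2_wl (K : m1 C) k mu mu' w g f e d c : repr1 K k e d -> repr2 mu w g f d c ->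
  mu^* = mu' -> (K ◁ mu)^* = K ◁ mu'.
Proof.
move=> [/(ev1_arr HG) h1 e1] [/(ev2_is2 HG) [h2 [h3 h4]] e2] <-; rewrite -e1 -e2 in h1 h2.
exact: star2_wl h1 h2 h3 h4.
Qed.
Lemma st2_wr (K : m1 C) k mu mu' w g f e d c : repr2 mu w g f e d -> repr1 K k d c ->
  mu^* = mu' -> (mu ▷ K)^* = mu' ▷ K.
Proof.
move=> [/(ev2_is2 HG) [h2 [h3 h4]] e2] [/(ev1_arr HG) h1 e1] <-; rewrite -e1 -e2 in h1 h2.
exact: star2_wr h1 h2 h3 h4.
Qed.
Lemma st2_star (mu : m2 C) : mu^*^* = mu.
Proof. exact: star2_inv HP _. Qed.

Lemma st3_id (a a' : m2 C) : a^* = a' -> (id3 a)^⋆ = id3 a'.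
Proof. by move=> <-; exact: star3_id HP _. Qed.
Lemma st3_vc (A B A' B' : m3 C) P Q v u u' w g f g' f' d c :
  repr3 A P v u g f d c -> repr3 B Q u' w g' f' d c -> u = u' -> f = f' ->
  A^⋆ = A' -> B^⋆ = B' -> (A • B)^⋆ = B' • A'.
Proof.
move=> [/(ev3_is3 HG) [h1 _] e1] [/(ev3_is3 HG) [h2 _] e2] e e' <- <-; subst u' f'.
rewrite -e1 -e2 in h1 h2; apply: (star3_vcomp HP); crush.
Qed.
Lemma st3_hc (A B A' B' : m3 C) P Q v w v' w' h g g' f d c :
  repr3 A P v w h g d c -> repr3 B Q v' w' g' f d c -> g = g' ->
  A^⋆ = A' -> B^⋆ = B' -> (A ⊚ B)^⋆ = B' ⊚ A'.
Proof.
move=> [/(ev3_is3 HG) h1 e1] [/(ev3_is3 HG) h2 e2] e <- <-; subst g'.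
rewrite -e1 -e2 in h1 h2; apply: (star3_comp HP); crush.
Qed.
Lemma st3_wl (K : m1 C) k A A' P v w g f e d c : repr1 K k e d -> repr3 A P v w g f d c ->
  A^⋆ = A' -> (K ◀ A)^⋆ = K ◀ A'.
Proof.
move=> [/(ev1_arr HG) h1 e1] [/(ev3_is3 HG) [h2 [h3 h4]] e2] <-; rewrite -e1 -e2 in h1 h2.
by case: h3 h4 => h3 [h5 h6] [h4 _]; exact: star3_wl h1 h2 h3 h4 h5 h6.
Qed.
Lemma st3_wr (K : m1 C) k A A' P v w g f e d c : repr3 A P v w g f e d -> repr1 K k d c ->
  A^⋆ = A' -> (A ▶ K)^⋆ = A' ▶ K.
Proof.
move=> [/(ev3_is3 HG) [h2 [h3 h4]] e2] [/(ev1_arr HG) h1 e1] <-; rewrite -e1 -e2 in h1 h2.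
by case: h3 h4 => h3 [h5 h6] [h4 _]; exact: star3_wr h1 h2 h3 h4 h5 h6.
Qed.
Lemma st3_sigma (mu nu mu' nu' : m2 C) w v k h g f d e c :
  repr2 mu w k h d e -> repr2 nu v g f e c -> mu^* = mu' -> nu^* = nu' ->
  (sigma mu nu)^⋆ = sigma mu' nu'.
Proof.
move=> [/(ev2_is2 HG) h1 e1] [/(ev2_is2 HG) h2 e2] <- <-; rewrite -e1 -e2 in h1 h2.
by case: h1 h2 => h1 [h3 h4] [h2 [h5 h6]]; exact: sigma_star h1 h3 h4 h2 h5 h6.
Qed.
Lemma st3_star (A : m3 C) : A^⋆^⋆ = A.
Proof. exact: star3_inv HP _. Qed.

Ltac st2 :=
  lazymatch goal with
  | |- (id2 _)^* = _ => eapply st2_id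
  | |- (_ ∘ _)^* = _ => eapply st2_o; [rp2 | rp2 | reflexivity | st2 | st2]
  | |- (_ ◁ _)^* = _ => eapply st2_wl; [rp1 | rp2 | st2]
  | |- (_ ▷ _)^* = _ => eapply st2_wr; [rp2 | rp1 | st2]
  | |- (_ ^*)^* = _ => eapply st2_star
  | |- _ => reflexivity
  end.
Ltac st3 :=
  lazymatch goal with
  | |- (id3 _)^⋆ = _ => eapply st3_id; st2
  | |- (_ • _)^⋆ = _ => eapply st3_vc; [rp3 | rp3 | reflexivity | reflexivity | st3 | st3]
  | |- (_ ⊚ _)^⋆ = _ => eapply st3_hc; [rp3 | rp3 | reflexivity | st3 | st3]
  | |- (_ ◀ _)^⋆ = _ => eapply st3_wl; [rp1 | rp3 | st3]
  | |- (_ ▶ _)^⋆ = _ => eapply st3_wr; [rp3 | rp1 | st3]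
  | |- (sigma _ _)^⋆ = _ => eapply st3_sigma; [rp2 | rp2 | st2 | st2]
  | |- (_ ^⋆)^⋆ = _ => eapply st3_star
  | |- _ => reflexivity
  end.
(** Passes to the mirror image of an equation. The laws of [chi] arise in this way from those of
    [psi]. *)
Lemma star_eq (X Y X' Y' : m3 C) : X = Y -> X^⋆ = X' -> Y^⋆ = Y' -> X' = Y'.
Proof. by move=> -> -> ->. Qed.

(** * The pairing [phi] and the copairing [psi] *)

Lemma sharp2E (nu : m2 C) F G : arr2 nu F G ->
  sharp2 nu = (F^# ◁ (eta G)^*) ∘ (F^# ◁ nu ▷ G^#) ∘ (eta F^# ▷ G^#).
Proof. by move=> [<- <-]. Qed.
Lemma sharp3E (X : m3 C) nu nu' F G : arr3 X nu nu' -> arr2 nu F G ->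
  sharp3 X = id3 (F^# ◁ (eta G)^*) ⊚ (F^# ◀ X ▶ G^#) ⊚ id3 (eta F^# ▷ G^#).
Proof. by rewrite /sharp3 /s32 /t32; move=> [-> _] [-> ->]. Qed.
Lemma Phi2E (rho nu : m2 C) E F G : arr2 rho E F -> arr2 nu F G ->
  Phi2 rho nu =
  (id3 ((E^# ◁ (eta G)^*) ∘ (E^# ◁ nu ▷ G^#))
   ⊚ (E^# ◀ T F ▶ G^#)
   ⊚ id3 ((E^# ◁ rho ▷ G^#) ∘ (eta E^# ▷ G^#))) •
  (sigma (E^# ◁ (eta F)^*) ((eta G)^* ∘ (nu ▷ G^#))
   ⊚ id3 (((E^# □ F) ◁ eta F^# ▷ G^#) ∘ (E^# ◁ rho ▷ G^#) ∘ (eta E^# ▷ G^#))) •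
  (id3 (E^# ◁ (eta F)^*) ⊚ sigma ((E^# ◁ rho) ∘ eta E^#) (sharp2 nu)).
Proof. by move=> [<- <-] [_ <-]. Qed.

(** The tensorator carries the star of [eta F] past the rest, and [T F] then straightens the zigzag
    of [F]. *)
Definition phi (F G : m1 C) (nu : m2 C) : m3 C :=
  (id3 ((eta G)^* ∘ (nu ▷ G^#)) ⊚ (T F ▶ G^#)) •
  (sigma (eta F)^* ((eta G)^* ∘ (nu ▷ G^#)) ⊚ id3 (F ◁ eta F^# ▷ G^#)).

Section Basic.
Context (F G : m1 C) (nu : m2 C) (c d : ob C).
Context (hF : arr1 F c d) (hG : arr1 G c d) (hn : arr2 nu F G).
Lemma sharp2_arr : arr2 (sharp2 nu) G^# F^#.
Proof. by rewrite (sharp2E hn); ty2. Qed.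
Lemma phi_arr : arr3 (phi F G nu) ((eta F)^* ∘ (F ◁ sharp2 nu)) ((eta G)^* ∘ (nu ▷ G^#)).
Proof. by rewrite /phi (sharp2E hn); ty3. Qed.
Lemma phi_nat X nu' : arr2 nu' F G -> arr3 X nu nu' ->
  phi F G nu' • (id3 (eta F)^* ⊚ (F ◀ sharp3 X)) = (id3 (eta G)^* ⊚ (X ▶ G^#)) • phi F G nu.
Proof.
move=> hn' hX; rewrite /phi (sharp3E hX hn).
have a1 : arr2 (nu ▷ G^#) (F □ G^#) (G □ G^#) by ty2.
have a2 : arr2 (nu' ▷ G^#) (F □ G^#) (G □ G^#) by ty2.
have a3 : arr3 (X ▶ G^#) (nu ▷ G^#) (nu' ▷ G^#) by ty3.
have k1 : arr1 (F □ G^#) d d by ty1. have k2 : arr1 (G □ G^#) d d by ty1.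
have k3 : arr1 (F □ F^#) d d by ty1. have k4 : arr1 (id1 d) d d by ty1.
have N := sigma_nat_r (leaf2_star (leaf2_eta hF)) k3 k1 a3 a1 a2.
by paths; sw [2]; rl 1 N; sw [0]; pdone.
Qed.
End Basic.

Lemma leaf3_T_sharp_star (F : m1 C) c d : arr1 F c d ->
  arr3 (T F^#)^⋆ (id2 F^#) ((F^# ◁ (eta F)^*) ∘ (eta F^# ▷ F^#)).
Proof.
move=> hF; have := leaf3_star (leaf3_T_sharp F).
have h1 : arr1 F^# d c by ty1. have h2 : arr1 (id1 d) d d by ty1. have h3 : arr1 (F □ F^#) d d by ty1.
have h4 : arr1 (id1 c) c c by ty1. have h5 : arr1 (F^# □ F) c c by ty1.
rewrite (star2_id HP) (@star2_o _ _ F^# (F^# □ F □ F^#) F^#); try by ty2.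
rewrite (star2_wl h1 (leaf2_eta hF) h2 h3).
by rewrite (star2_wr h1 (leaf2_star (leaf2_eta_sharp hF)) h5 h4) (star2_inv HP).
Qed.
Lemma leaf3_T_star (F : m1 C) c d : arr1 F c d ->
  arr3 (T F)^⋆ (id2 F) ((F ◁ (eta F^#)^*) ∘ (eta F ▷ F)).
Proof. by move=> /leaf1_sharp /leaf3_T_sharp_star; rewrite (sharp1_inv HD). Qed.

(* The swallowtail axiom. *)
Lemma phi_unit (F : m1 C) c d : arr1 F c d ->
  phi F F (id2 F) • (id3 (eta F)^* ⊚ (F ◀ Phi0 F)) = id3 (eta F)^*.
Proof.
move=> hF; rewrite -[RHS](T_swallowtail HD) /phi /Phi0.
have h := leaf3_T_sharp_star hF.
by paths; pdone.
Qed.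

(** The first two factors of [Phi2] form the pairing of [nu] whiskered by [E^#], which can then be
    moved as one cell. *)
Lemma Phi2_phi (E F G : m1 C) rho nu c d :
  arr1 E c d -> arr1 F c d -> arr1 G c d -> arr2 rho E F -> arr2 nu F G ->
  Phi2 rho nu =
  ((E^# ◀ phi F G nu) ⊚ id3 ((E^# ◁ rho ▷ G^#) ∘ (eta E^# ▷ G^#))) •
  (id3 (E^# ◁ (eta F)^*) ⊚ sigma ((E^# ◁ rho) ∘ eta E^#) (sharp2 nu)).
Proof.
move=> hE hF hG hr hn; rewrite (Phi2E hr hn) /phi (sharp2E hn).
by paths; pdone.
Qed.

(** The pairing of [nu ∘ rho] contains a tensorator of the star of [eta E] with everything to its
    right. Naturality carries [phi F G nu] and the tensorator of [rho] with [sharp2 nu] across it,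
    and [T E] past [sharp2 nu]; what is left is [phi E F rho]. *)
Lemma phi_comp (E F G : m1 C) rho nu c d :
  arr1 E c d -> arr1 F c d -> arr1 G c d -> arr2 rho E F -> arr2 nu F G ->
  phi E G (nu ∘ rho) • (id3 (eta E)^* ⊚ (E ◀ Phi2 rho nu)) =
  (phi F G nu ⊚ id3 (rho ▷ G^#)) • (id3 (eta F)^* ⊚ sigma rho (sharp2 nu)) •
  (phi E F rho ⊚ id3 (E ◁ sharp2 nu)).
Proof.
move=> hE hF hG hr hn; rewrite (Phi2_phi hE hF hG hr hn).
have hb := sharp2_arr hF hG hn; have hphi := phi_arr hF hG hn.
(* [phi F G nu] and [sharp2 nu] are kept abstract: only their boundaries matter for the naturality
   steps. *)
rewrite [phi E G _]/phi [phi E F rho]/phi; move: (sharp2 nu) (phi F G nu) hb hphi => b f hb hf.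
have k1 : arr1 (E □ E^#) d d by ty1. have k2 : arr1 (F □ G^#) d d by ty1.
have k3 : arr1 (E □ G^#) d d by ty1. have k4 : arr1 (id1 d) d d by ty1.
have a1 : arr2 ((eta F)^* ∘ (F ◁ b)) (F □ G^#) (id1 d) by ty2.
have a2 : arr2 ((eta G)^* ∘ (nu ▷ G^#)) (F □ G^#) (id1 d) by ty2.
have N1 := sigma_nat_r (leaf2_star (leaf2_eta hE)) k1 k2 hf a1 a2.
have s : arr3 (sigma rho b) ((rho ▷ F^#) ∘ (E ◁ b)) ((F ◁ b) ∘ (rho ▷ G^#)) by ty3.
have a3 : arr2 ((rho ▷ F^#) ∘ (E ◁ b)) (E □ G^#) (F □ F^#) by ty2.
have a4 : arr2 ((F ◁ b) ∘ (rho ▷ G^#)) (E □ G^#) (F □ F^#) by ty2.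
have N2 := sigma_nat_r (leaf2_star (leaf2_eta hE)) k1 k3 s a3 a4.
have a5 : arr2 (((eta E)^* ▷ E) ∘ (E ◁ eta E^#)) E E by ty2.
have N3 := sigma_nat_l (leaf3_T E) a5 (id2_arr H2 E) hE hE hb (leaf1_sharp hG) (leaf1_sharp hF).
by paths; rl 2 N1; sw [1;0;4]; rl 2 N2; sw [5;4;1]; rl 2 (eq_sym N3); pdone.
Qed.

(** The 2-morphisms and their targets enter the law for the Gray product only through the
    evaluation-like cells [x] and [y]. With these arbitrary, what remains is how [T_box] and [kappa]
    fit together: two tensorators cross the star of [eta H], and [T H] and [T F] cross the cells
    [k ◁ z] and [y]. *)
Lemma phi_box_core (F H : m1 C) (g k : m1 C) x y c d e :
  arr1 F d e -> arr1 H c d -> arr1 g e d -> arr1 k d c ->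
  arr2 x (F □ g) (id1 e) -> arr2 y (H □ k) (id1 d) ->
  (id3 (x ∘ (F ◁ y ▷ g)) ⊚
    (((T F ▶ H) ⊚ (F ◀ T H)) •
    (id3 ((eta F)^* ▷ (F □ H))
     ⊚ sigma (F ◁ (eta H)^*) (eta F^# ▷ H)
     ⊚ id3 ((F □ H) ◁ eta H^#))) ▶ (k □ g)) •
  (sigma ((eta F)^* ∘ (F ◁ (eta H)^* ▷ F^#)) (x ∘ (F ◁ y ▷ g)) ⊚
   id3 ((F □ H) ◁ ((H^# ◁ eta F^# ▷ H) ∘ eta H^#) ▷ (k □ g))) •
  (id3 ((eta F)^* ∘ (F ◁ (eta H)^* ▷ F^#)) ⊚ ((F □ H) ◀
    ((id3 ((H^# □ F^#) ◁ x) ⊚ (H^# ◀ sigma (eta F^#) y ▶ g) ⊚ id3 (eta H^# ▷ (k □ g))) •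
     sigma ((H^# ◁ y) ∘ (eta H^# ▷ k)) ((F^# ◁ x) ∘ (eta F^# ▷ g))))) =
  (id3 x ⊚ (T F ▶ g) ⊚ id3 (F ◁ y ▷ g)) •
  (sigma (eta F)^* x ⊚ id3 (F ◁ eta F^# ▷ g) ⊚ id3 (F ◁ y ▷ g)) •
  (id3 (eta F)^* ⊚ (F ◀ sigma y ((F^# ◁ x) ∘ (eta F^# ▷ g)))) •
  (id3 (eta F)^* ⊚ (F ◀ ((id3 y ⊚ (T H ▶ k)) • (sigma (eta H)^* y ⊚ id3 (H ◁ eta H^# ▷ k))) ▶ F^#)
    ⊚ id3 ((F □ H) ◁ (k ◁ ((F^# ◁ x) ∘ (eta F^# ▷ g))))).
Proof.
move=> hF hH hg hk hx hy.
have jH := leaf2_star (leaf2_eta hH).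
have k1 : arr1 (H □ H^#) d d by ty1. have k2 : arr1 (id1 d) d d by ty1.
have k3 : arr1 (H □ k) d d by ty1. have k4 : arr1 (F^# □ F) d d by ty1.
have s1 : arr3 (sigma (eta F^#) y) ((eta F^# ▷ id1 d) ∘ (id1 d ◁ y))
  (((F^# □ F) ◁ y) ∘ (eta F^# ▷ (H □ k))) by ty3.
have a1 : arr2 ((eta F^# ▷ id1 d) ∘ (id1 d ◁ y)) (H □ k) (F^# □ F) by ty2.
have a2 : arr2 (((F^# □ F) ◁ y) ∘ (eta F^# ▷ (H □ k))) (H □ k) (F^# □ F) by ty2.
have N1 := sigma_nat_r jH k1 k3 s1 a1 a2.
set z := (F^# ◁ x) ∘ (eta F^# ▷ g).
have hz : arr2 z g F^# by rewrite /z; ty2.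
have s2 : arr3 (sigma y z) ((y ▷ F^#) ∘ ((H □ k) ◁ z)) ((id1 d ◁ z) ∘ (y ▷ g)) by ty3.
have a3 : arr2 ((y ▷ F^#) ∘ ((H □ k) ◁ z)) (H □ k □ g) F^# by ty2.
have a4 : arr2 ((id1 d ◁ z) ∘ (y ▷ g)) (H □ k □ g) F^# by ty2.
have k6 : arr1 (H □ k □ g) e d by ty1.
have N2 := sigma_nat_r jH k1 k6 s2 a3 a4.
have a5 : arr2 (((eta H)^* ▷ H) ∘ (H ◁ eta H^#)) H H by ty2.
have a6 : arr2 (((eta F)^* ▷ F) ∘ (F ◁ eta F^#)) F F by ty2.
have k7 : arr1 (k □ g) e c by ty1. have k8 : arr1 (k □ F^#) e c by ty1.
have a7 : arr2 (k ◁ z) (k □ g) (k □ F^#) by ty2.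
have N3 := sigma_nat_l (leaf3_T H) a5 (id2_arr H2 H) hH hH a7 k7 k8.
have N4 := sigma_nat_l (leaf3_T F) a6 (id2_arr H2 F) hF hF hy k3 k2.
rewrite /z in N1 N2 N3 |- *.
by paths; sw [2;3;6]; rl 4 N1; rl 5 N2; sw [1;2;3;4;5;9;10]; rl 6 (eq_sym N3); sw [2]; rl 0 (eq_sym N4); pdone.
Qed.

Lemma kappaE (mu nu : m2 C) F G H K : arr2 mu F G -> arr2 nu H K ->
  kappa mu nu =
  (id3 (((H^# □ F^#) ◁ (eta G)^*)
        ∘ ((H^# □ F^# □ G) ◁ (eta K)^* ▷ G^#)
        ∘ ((H^# □ F^#) ◁ mu ▷ (K □ K^# □ G^#)))
   ⊚ (H^# ◀ sigma (eta F^#) nu ▶ (K^# □ G^#))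
   ⊚ id3 (eta H^# ▷ (K^# □ G^#))) •
  (id3 ((H^# □ F^#) ◁ (eta G)^*)
   ⊚ (H^# ◀ sigma ((F^# ◁ mu) ∘ eta F^#) (eta K)^* ▶ G^#)
   ⊚ id3 ((H^# ◁ nu ▷ (K^# □ G^#)) ∘ (eta H^# ▷ (K^# □ G^#)))) •
  sigma (sharp2 nu) (sharp2 mu).
Proof. by move=> [<- <-] [<- <-]. Qed.
Lemma box2E (mu nu : m2 C) F G H K : arr2 mu F G -> arr2 nu H K ->
  box2 mu nu = (mu ▷ K) ∘ (F ◁ nu).
Proof. by move=> [<- _] [_ <-]. Qed.

Lemma eta_box_star (F H : m1 C) c d e : arr1 F d e -> arr1 H c d ->
  (eta (F □ H))^* = (eta F)^* ∘ (F ◁ (eta H)^* ▷ F^#).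
Proof.
move=> hF hH; have e1 : s1 F = Defs.t1 H by crush.
have hF' := leaf1_sharp hF.
have k1 : arr1 (id1 d) d d by ty1. have k2 : arr1 (H □ H^#) d d by ty1.
have k3 : arr1 (F □ id1 d) d e by ty1. have k4 : arr1 (F □ (H □ H^#)) d e by ty1.
have a1 : arr2 (F ◁ eta H) (F □ id1 d) (F □ (H □ H^#)) by ty2.
rewrite (eta_box HD e1) (@star2_o _ _ (id1 e) (F □ F^#) (F □ H □ H^# □ F^#)); try by ty2.
by rewrite (star2_wr hF' a1 k3 k4) (star2_wl hF (leaf2_eta hH) k1 k2).
Qed.
Lemma eta_box_sharp (F H : m1 C) c d e : arr1 F d e -> arr1 H c d ->
  eta (H^# □ F^#) = (H^# ◁ eta F^# ▷ H) ∘ eta H^#.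
Proof.
move=> hF hH; have := leaf1_sharp hF; have := leaf1_sharp hH => h1 h2.
by rewrite (eta_box HD) ?(sharp1_inv HD) //; crush.
Qed.

Lemma phi_box (F G H K : m1 C) mu nu c d e :
  arr1 F d e -> arr1 G d e -> arr1 H c d -> arr1 K c d -> arr2 mu F G -> arr2 nu H K ->
  phi (F □ H) (G □ K) (box2 mu nu) • (id3 (eta (F □ H))^* ⊚ ((F □ H) ◀ kappa mu nu)) =
  (id3 (eta G)^* ⊚ (sigma mu (eta K)^* ▶ G^#) ⊚ id3 (F ◁ nu ▷ (K^# □ G^#))) •
  (phi F G mu ⊚ id3 (F ◁ ((eta K)^* ∘ (nu ▷ K^#)) ▷ G^#)) •
  (id3 (eta F)^* ⊚ (F ◀ sigma ((eta K)^* ∘ (nu ▷ K^#)) (sharp2 mu))) •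
  (id3 (eta F)^* ⊚ (F ◀ phi H K nu ▶ F^#) ⊚ id3 ((F □ H) ◁ (K^# ◁ sharp2 mu))).
Proof.
move=> hF hG hH hK hm hn.
have e1 : s1 F = Defs.t1 H by crush. have e2 : s1 G = Defs.t1 K by crush.
have hK' := leaf1_sharp hK; have hG' := leaf1_sharp hG.
have hx : arr2 ((eta G)^* ∘ (mu ▷ G^#)) (F □ G^#) (id1 e) by ty2.
have hy : arr2 ((eta K)^* ∘ (nu ▷ K^#)) (H □ K^#) (id1 d) by ty2.
have core := phi_box_core hF hH hG' hK' hx hy.
rewrite (box2E hm hn) (kappaE hm hn) /phi (eta_box_star hF hH) (eta_box_star hG hK).
rewrite (sharp1_box HD e1) (sharp1_box HD e2) (eta_box_sharp hF hH) (T_box HD e1).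
rewrite (sharp2E hm) (sharp2E hn).
have k1 : arr1 (F □ H □ H^# □ F^#) e e by ty1.
have k2 : arr1 (F □ K □ K^# □ G^#) e e by ty1.
have a0 : arr2 ((eta F)^* ∘ (F ◁ (eta H)^* ▷ F^#)) (F □ H □ H^# □ F^#) (id1 e) by ty2.
have s : arr3 (sigma mu (eta K)^* ▶ G^#) (((mu ▷ id1 d) ∘ (F ◁ (eta K)^*)) ▷ G^#)
   (((G ◁ (eta K)^*) ∘ (mu ▷ (K □ K^#))) ▷ G^#) by ty3.
have a1 : arr2 (((mu ▷ id1 d) ∘ (F ◁ (eta K)^*)) ▷ G^#) (F □ K □ K^# □ G^#) (G □ G^#) by ty2.
have a2 : arr2 (((G ◁ (eta K)^*) ∘ (mu ▷ (K □ K^#))) ▷ G^#) (F □ K □ K^# □ G^#) (G □ G^#) by ty2.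
(* In the core [mu] comes after the star of [eta K], in the target of [phi] before it; the
   tensorator [s] exchanges the two and has to be moved out of the way. *)
have N := sigma_nat_r a0 k1 k2 s a1 a2.
by paths; sw [11;10;6;5;4;7;8;9]; rl 5 N;
  sw [4;3;2;1;0;5;6;9;8;7]; rl 1 core; pdone.
Qed.

(** Mirror image of [phi]: the zigzag is now straightened at the target [G] of [nu] instead of its
    source. *)
Definition psi (F G : m1 C) (nu : m2 C) : m3 C :=
  ((F^# ◀ T G) ⊚ id3 ((F^# ◁ nu) ∘ eta F^#)) •
  (id3 (F^# ◁ (eta G)^* ▷ G) ⊚ sigma ((F^# ◁ nu) ∘ eta F^#) (eta G^#)).

Section Basic.
Context (F G : m1 C) (nu : m2 C) (c d : ob C).
Context (hF : arr1 F c d) (hG : arr1 G c d) (hn : arr2 nu F G).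
Lemma psi_arr : arr3 (psi F G nu) ((sharp2 nu ▷ G) ∘ eta G^#) ((F^# ◁ nu) ∘ eta F^#).
Proof. by rewrite /psi (sharp2E hn); ty3. Qed.
Lemma psi_nat X nu' : arr2 nu' F G -> arr3 X nu nu' ->
  psi F G nu' • ((sharp3 X ▶ G) ⊚ id3 (eta G^#)) = ((F^# ◀ X) ⊚ id3 (eta F^#)) • psi F G nu.
Proof.
move=> hn' hX; rewrite /psi (sharp3E hX hn).
have a1 : arr2 (F^# ◁ nu) (F^# □ F) (F^# □ G) by ty2.
have a2 : arr2 (F^# ◁ nu') (F^# □ F) (F^# □ G) by ty2.
have a3 : arr3 (F^# ◀ X) (F^# ◁ nu) (F^# ◁ nu') by ty3.
have k1 : arr1 (F^# □ F) c c by ty1. have k2 : arr1 (F^# □ G) c c by ty1.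
have k3 : arr1 (id1 c) c c by ty1. have k4 : arr1 (G^# □ G) c c by ty1.
have N := sigma_nat_l a3 a1 a2 k1 k2 (leaf2_eta_sharp hG) k3 k4.
by paths; sw [2]; rl 1 N; sw [0]; pdone.
Qed.
End Basic.

Lemma swallowtail_star (F : m1 C) c d : arr1 F c d ->
  ((F ◀ T F^#) ⊚ id3 (eta F)) • (id3 (F ◁ (eta F^#)^* ▷ F^#) ⊚ sigma (eta F) (eta F)) •
  (((T F)^⋆ ▶ F^#) ⊚ id3 (eta F)) = id3 (eta F).
Proof.
move=> hF; have h := leaf3_T_sharp_star hF; have h' := leaf3_T_star hF.
have := T_swallowtail HD F => E; eapply star_eq in E; [|st3|st3].
by rewrite -[RHS]E; paths; pdone.
Qed.

(** [Phi0 F] is the star of [T F^#], so this is the starred swallowtail at [F^#]. *)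
Lemma psi_unit (F : m1 C) c d : arr1 F c d ->
  psi F F (id2 F) • ((Phi0 F ▶ F) ⊚ id3 (eta F^#)) = id3 (eta F^#).
Proof.
move=> hF; have := swallowtail_star (leaf1_sharp hF); rewrite (sharp1_inv HD) => E.
have h := leaf3_T_sharp_star hF.
by rewrite -[RHS]E /psi /Phi0; paths; pdone.
Qed.

(** The single cell [T F] in [Phi2] lies between [rho] and [nu]: it can be read as part of the
    pairing of [nu] or, after interchange, of the copairing of [rho]. *)
Lemma Phi2_psi (E F G : m1 C) rho nu c d :
  arr1 E c d -> arr1 F c d -> arr1 G c d -> arr2 rho E F -> arr2 nu F G ->
  Phi2 rho nu =
  (id3 (E^# ◁ ((eta G)^* ∘ (nu ▷ G^#))) ⊚ (psi E F rho ▶ G^#)) •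
  (sigma (sharp2 rho) ((eta G)^* ∘ (nu ▷ G^#)) ⊚ id3 (eta F^# ▷ G^#)).
Proof.
move=> hE hF hG hr hn; rewrite (Phi2E hr hn) /psi (sharp2E hn) (sharp2E hr).
by paths; srt; flip; srt; pdone.
Qed.

Lemma psi_comp (E F G : m1 C) rho nu c d :
  arr1 E c d -> arr1 F c d -> arr1 G c d -> arr2 rho E F -> arr2 nu F G ->
  psi E G (nu ∘ rho) • ((Phi2 rho nu ▶ G) ⊚ id3 (eta G^#)) =
  (id3 (E^# ◁ nu) ⊚ psi E F rho) • (sigma (sharp2 rho) nu ⊚ id3 (eta F^#)) •
  (id3 (sharp2 rho ▷ G) ⊚ psi F G nu).
Proof.
move=> hE hF hG hr hn; rewrite (Phi2_psi hE hF hG hr hn).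
have ha := sharp2_arr hE hF hr; have hpsi := psi_arr hE hF hr.
rewrite [psi E G _]/psi [psi F G nu]/psi; move: (sharp2 rho) (psi E F rho) ha hpsi => a f ha hf.
have hE' := leaf1_sharp hE; have hF' := leaf1_sharp hF.
have k1 : arr1 (F^# □ F) c c by ty1. have k2 : arr1 (E^# □ F) c c by ty1.
have k3 : arr1 (id1 c) c c by ty1. have k4 : arr1 (G^# □ G) c c by ty1.
have b1 : arr2 ((a ▷ F) ∘ eta F^#) (id1 c) (E^# □ F) by ty2.
have b2 : arr2 ((E^# ◁ rho) ∘ eta E^#) (id1 c) (E^# □ F) by ty2.
have N1 := sigma_nat_l hf b1 b2 k3 k2 (leaf2_eta_sharp hG) k3 k4.
have s : arr3 (sigma nu (eta G^#)) ((nu ▷ (G^# □ G)) ∘ (F ◁ eta G^#))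
  ((G ◁ eta G^#) ∘ (nu ▷ id1 c)) by ty3.
have b3 : arr2 ((nu ▷ (G^# □ G)) ∘ (F ◁ eta G^#)) F (G □ G^# □ G) by ty2.
have b4 : arr2 ((G ◁ eta G^#) ∘ (nu ▷ id1 c)) F (G □ G^# □ G) by ty2.
have N2 := sigma_nat_r ha hF' hF s b3 b4.
have b5 : arr2 (((eta G)^* ▷ G) ∘ (G ◁ eta G^#)) G G by ty2.
have N3 := sigma_nat_r ha hF' hG (leaf3_T G) b5 (id2_arr H2 G).
by paths; rl 2 N1; sw [1;0;4]; rl 2 (eq_sym N2); sw [5;4;1]; rl 2 (eq_sym N3); pdone.
Qed.

(** As for the pairing, the core is isolated with arbitrary coevaluation-like cells [u] and [v];
    [T G] and [T K] now cross [z ▷ p] and [u]. *)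
Lemma psi_box_core (G K : m1 C) (p h : m1 C) u v c d e :
  arr1 G d e -> arr1 K c d -> arr1 p e d -> arr1 h d c ->
  arr2 u (id1 d) (p □ G) -> arr2 v (id1 c) (h □ K) ->
  (((h □ p) ◀ (((T G ▶ K) ⊚ (G ◀ T K)) •
    (id3 ((eta G)^* ▷ (G □ K))
     ⊚ sigma (G ◁ (eta K)^*) (eta G^# ▷ K)
     ⊚ id3 ((G □ K) ◁ eta K^#)))) ⊚ id3 ((h ◁ u ▷ K) ∘ v)) •
  (id3 ((h □ p) ◁ ((eta G)^* ∘ (G ◁ (eta K)^* ▷ G^#)) ▷ (G □ K)) ⊚
   sigma ((h ◁ u ▷ K) ∘ v) ((K^# ◁ eta G^# ▷ K) ∘ eta K^#)) •
  ((((id3 ((h □ p) ◁ (eta G)^*) ⊚ (h ◀ sigma u (eta K)^* ▶ G^#) ⊚ id3 (v ▷ (K^# □ G^#))) •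
     sigma ((h ◁ (eta K)^*) ∘ (v ▷ K^#)) ((p ◁ (eta G)^*) ∘ (u ▷ G^#))) ▶ (G □ K)) ⊚
   id3 ((K^# ◁ eta G^# ▷ K) ∘ eta K^#)) =
  (id3 (h ◁ u ▷ K) ⊚ (((h ◀ T K) ⊚ id3 v) • (id3 (h ◁ (eta K)^* ▷ K) ⊚ sigma v (eta K^#)))) •
  (sigma ((h ◁ (eta K)^*) ∘ (v ▷ K^#)) (u ▷ K) ⊚ id3 (eta K^#)) •
  (id3 (((h ◁ (eta K)^*) ∘ (v ▷ K^#)) ▷ (p □ G □ K)) ⊚
   (K^# ◀ (((p ◀ T G) ⊚ id3 u) • (id3 (p ◁ (eta G)^* ▷ G) ⊚ sigma u (eta G^#))) ▶ K) ⊚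
   id3 (eta K^#)).
Proof.
move=> hG hK hp hh hu hv.
have jG := leaf2_eta_sharp hG.
have k1 : arr1 (id1 d) d d by ty1. have k2 : arr1 (G^# □ G) d d by ty1.
have k3 : arr1 (p □ G) d d by ty1. have k4 : arr1 (K □ K^#) d d by ty1.
have s1 : arr3 (sigma u (eta K)^*) ((u ▷ id1 d) ∘ (id1 d ◁ (eta K)^*))
  (((p □ G) ◁ (eta K)^*) ∘ (u ▷ (K □ K^#))) by ty3.
have a1 : arr2 ((u ▷ id1 d) ∘ (id1 d ◁ (eta K)^*)) (K □ K^#) (p □ G) by ty2.
have a2 : arr2 (((p □ G) ◁ (eta K)^*) ∘ (u ▷ (K □ K^#))) (K □ K^#) (p □ G) by ty2.
have N1 := sigma_nat_l s1 a1 a2 k4 k3 jG k1 k2.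
set z := (h ◁ (eta K)^*) ∘ (v ▷ K^#).
have hz : arr2 z K^# h by rewrite /z; ty2.
have s2 : arr3 (sigma z u) ((z ▷ (p □ G)) ∘ (K^# ◁ u)) ((h ◁ u) ∘ (z ▷ id1 d)) by ty3.
have a3 : arr2 ((z ▷ (p □ G)) ∘ (K^# ◁ u)) K^# (h □ p □ G) by ty2.
have a4 : arr2 ((h ◁ u) ∘ (z ▷ id1 d)) K^# (h □ p □ G) by ty2.
have hK' := leaf1_sharp hK. have k6 : arr1 (h □ p □ G) d c by ty1.
have N2 := sigma_nat_l s2 a3 a4 hK' k6 jG k1 k2.
have a5 : arr2 (((eta G)^* ▷ G) ∘ (G ◁ eta G^#)) G G by ty2.
have a6 : arr2 (((eta K)^* ▷ K) ∘ (K ◁ eta K^#)) K K by ty2.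
have k7 : arr1 (K^# □ p) e c by ty1. have k8 : arr1 (h □ p) e c by ty1.
have a7 : arr2 (z ▷ p) (K^# □ p) (h □ p) by ty2.
have N3 := sigma_nat_r a7 k7 hG (leaf3_T G) a5 (id2_arr H2 G).
have N4 := sigma_nat_r hu k1 hK (leaf3_T K) a6 (id2_arr H2 K).
rewrite /z in N1 N2 N3 |- *.
by paths; sw [2;6;5]; rl 3 N1; sw [5;4;9]; rl 5 N2; sw [9;8;10;0;1;2;3;4;5]; rl 6 (eq_sym N3);
  rl 0 (eq_sym N4); pdone.
Qed.

Lemma psi_box (F G H K : m1 C) mu nu c d e :
  arr1 F d e -> arr1 G d e -> arr1 H c d -> arr1 K c d -> arr2 mu F G -> arr2 nu H K ->
  psi (F □ H) (G □ K) (box2 mu nu) • ((kappa mu nu ▶ (G □ K)) ⊚ id3 (eta (K^# □ G^#))) =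
  (id3 ((H^# □ F^#) ◁ mu ▷ K) ⊚ (H^# ◀ sigma (eta F^#) nu) ⊚ id3 (eta H^#)) •
  (id3 (H^# ◁ ((F^# ◁ mu) ∘ eta F^#) ▷ K) ⊚ psi H K nu) •
  (sigma (sharp2 nu) (((F^# ◁ mu) ∘ eta F^#) ▷ K) ⊚ id3 (eta K^#)) •
  (id3 (sharp2 nu ▷ (F^# □ G □ K)) ⊚ (K^# ◀ psi F G mu ▶ K) ⊚ id3 (eta K^#)).
Proof.
move=> hF hG hH hK hm hn.
have e1 : s1 F = Defs.t1 H by crush. have e2 : s1 G = Defs.t1 K by crush.
have hK' := leaf1_sharp hK; have hG' := leaf1_sharp hG.
have hF' := leaf1_sharp hF; have hH' := leaf1_sharp hH.
have hu : arr2 ((F^# ◁ mu) ∘ eta F^#) (id1 d) (F^# □ G) by ty2.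
have hv : arr2 ((H^# ◁ nu) ∘ eta H^#) (id1 c) (H^# □ K) by ty2.
have core := psi_box_core hG hK hF' hH' hu hv.
rewrite (box2E hm hn) (kappaE hm hn) /psi.
rewrite (sharp1_box HD e1) (sharp1_box HD e2) (eta_box_star hG hK) (eta_box_sharp hF hH).
rewrite (eta_box_sharp hG hK) (T_box HD e2).
rewrite (sharp2E hm) (sharp2E hn).
have k1 : arr1 (H^# □ H) c c by ty1. have k2 : arr1 (H^# □ F^# □ F □ K) c c by ty1.
have k3 : arr1 (id1 c) c c by ty1. have k4 : arr1 (K^# □ G^# □ G □ K) c c by ty1.
have b1 : arr2 ((K^# ◁ eta G^# ▷ K) ∘ eta K^#) (id1 c) (K^# □ G^# □ G □ K) by ty2.
have s : arr3 (H^# ◀ sigma (eta F^#) nu)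
  (H^# ◁ ((eta F^# ▷ K) ∘ (id1 d ◁ nu))) (H^# ◁ (((F^# □ F) ◁ nu) ∘ (eta F^# ▷ H))) by ty3.
have b2 : arr2 (H^# ◁ ((eta F^# ▷ K) ∘ (id1 d ◁ nu))) (H^# □ H) (H^# □ F^# □ F □ K) by ty2.
have b3 : arr2 (H^# ◁ (((F^# □ F) ◁ nu) ∘ (eta F^# ▷ H))) (H^# □ H) (H^# □ F^# □ F □ K) by ty2.
have N := sigma_nat_l s b2 b3 k1 k2 b1 k3 k4.
by paths; sw [10;9]; rl 5 N; sw [4;3;2;1;0]; rl 1 core; pdone.
Qed.

(** * Invertible 3-morphisms *)

Lemma is3_of (X : m3 C) P v w g f d c : repr3 X P v w g f d c ->
  is3 X (ev2 c f w) (ev2 c f v) (ev1 c f) (ev1 c g) c d.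
Proof. by move=> [/(ev3_is3 HG) h ->]. Qed.

Lemma inverse_is3 (X Y : m3 C) a b f g c d : is_inverse X Y -> is3 X a b f g c d ->
  is3 Y b a f g c d /\ Y • X = id3 a /\ X • Y = id3 b.
Proof. by move=> [h1 h2] [[e1 e2] [h3 h4]]; rewrite -e1 -e2 in h3 h4 *. Qed.
Lemma is_inverse_of (X Y : m3 C) a b f g c d : is3 X a b f g c d ->
  is3 Y b a f g c d -> Y • X = id3 a -> X • Y = id3 b -> is_inverse X Y.
Proof. by move=> [[e1 e2] _] [h _] h1 h2; rewrite /is_inverse e1 e2. Qed.

Lemma vcomp_idl' (X : m3 C) b : Defs.t3 X = b -> id3 b • X = X.
Proof. by move=> <-; exact: vcomp_idl H2 _. Qed.

Lemma inv_id (a : m2 C) : invertible (id3 a).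
Proof.
exists (id3 a); have := id3_arr H2 a; rewrite /is_inverse => -[e1 e2]; rewrite e1 e2.
have h := vcomp_idl H2 (id3 a); rewrite e2 in h; by split.
Qed.
Lemma inv_vc (A B : m3 C) P Q v u u' w g f g' f' d c :
  repr3 A P v u g f d c -> repr3 B Q u' w g' f' d c -> u = u' -> f = f' ->
  invertible A -> invertible B -> invertible (A • B).
Proof.
move=> /is3_of hA /is3_of hB e e' [A' hA'] [B' hB']; subst u' f'.
have [kA [a1 a2]] := inverse_is3 hA' hA; have [kB [b1 b2]] := inverse_is3 hB' hB.
have eg : ev1 c g = ev1 c g' by crush.
rewrite eg in hA kA; exists (B' • A').
apply: (is_inverse_of (is3_vc HG hA hB) (is3_vc HG kB kA)).
- rewrite (vcomp_assoc H2); try by crush.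
  + rewrite -(vcomp_assoc H2 (Psi := A')); try by crush.
    by rewrite a1 (vcomp_idl' (proj2 (proj1 hB))).
  + have := is3_vc HG hA hB; crush.
- rewrite (vcomp_assoc H2); try by crush.
  + rewrite -(vcomp_assoc H2 (Psi := B)); try by crush.
    by rewrite b2 (vcomp_idl' (proj2 (proj1 kA))).
  + have := is3_vc HG kB kA; crush.
Qed.
Lemma inv_hc (A B : m3 C) P Q v w v' w' h g g' f d c :
  repr3 A P v w h g d c -> repr3 B Q v' w' g' f d c -> g = g' ->
  invertible A -> invertible B -> invertible (A ⊚ B).
Proof.
move=> /is3_of hA /is3_of hB e [A' hA'] [B' hB']; subst g'.
have [kA [a1 a2]] := inverse_is3 hA' hA; have [kB [b1 b2]] := inverse_is3 hB' hB.
exists (A' ⊚ B'); apply: (is_inverse_of (is3_hc HG hA hB) (is3_hc HG kA kB)).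
- by rewrite -(interchange H2) ?a1 ?b1 ?(comp3_id H2) //; crush.
- by rewrite -(interchange H2) ?a2 ?b2 ?(comp3_id H2) //; crush.
Qed.
Lemma inv_wl (K : m1 C) k A P v w g f e d c : repr1 K k e d -> repr3 A P v w g f d c ->
  invertible A -> invertible (K ◀ A).
Proof.
move=> [/(ev1_arr HG) hK e1] /is3_of hA [A' hA']; rewrite -e1 in hK.
have [kA [a1 a2]] := inverse_is3 hA' hA.
exists (K ◀ A'); apply: (is_inverse_of (is3_wl HG hK hA) (is3_wl HG hK kA)).
- by rewrite -(wl3_vcomp HB) ?a1 ?(wl3_id HB) //; crush.
- by rewrite -(wl3_vcomp HB) ?a2 ?(wl3_id HB) //; crush.
Qed.
Lemma inv_wr (K : m1 C) k A P v w g f e d c : repr3 A P v w g f e d -> repr1 K k d c ->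
  invertible A -> invertible (A ▶ K).
Proof.
move=> /is3_of hA [/(ev1_arr HG) hK e1] [A' hA']; rewrite -e1 in hK.
have [kA [a1 a2]] := inverse_is3 hA' hA.
exists (A' ▶ K); apply: (is_inverse_of (is3_wr HG hK hA) (is3_wr HG hK kA)).
- by rewrite -(wr3_vcomp HB) ?a1 ?(wr3_id HB) //; crush.
- by rewrite -(wr3_vcomp HB) ?a2 ?(wr3_id HB) //; crush.
Qed.
Lemma inv_star (A : m3 C) : invertible A -> invertible A^⋆.
Proof.
move=> [A' [h1 [h2 h3]]]; exists A'^⋆; rewrite /is_inverse.
have := star3_arr HP A => -[-> ->]; have := leaf3_star h1 => h; split; first exact: h.
have e2 := f_equal (@star3 C) h2; have e3 := f_equal (@star3 C) h3.
by rewrite -!(star3_vcomp HP) ?h2 ?h3 ?(star3_id HP) //; crush.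
Qed.
Lemma inv_T (F : m1 C) : invertible (T F).
Proof. exact: T_inv HD F. Qed.
Lemma inv_sigma (mu nu : m2 C) w v k h g f d e c : repr2 mu w k h d e -> repr2 nu v g f e c ->
  invertible (sigma mu nu).
Proof.
move=> [/(ev2_is2 HG) h1 e1] [/(ev2_is2 HG) h2 e2]; rewrite -e1 -e2 in h1 h2.
apply: (sigma_inv HS); crush.
Qed.
Lemma inv_inv (A A' : m3 C) : is_inverse A A' -> invertible A'.
Proof.
move=> [[e1 e2] [h1 h2]]; exists A; rewrite /is_inverse e1 e2; by split.
Qed.
Lemma inv3_spec (A : m3 C) : invertible A -> is_inverse A (inv3 A).
Proof. by move=> h; apply: epsilon_spec. Qed.
Lemma cancel_r (A X Y : m3 C) a b : invertible A -> arr3 A a b -> s3 X = b -> s3 Y = b ->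
  X • A = Y • A -> X = Y.
Proof.
move=> [A' [h1 [h2 h3]]] [e1 e2] eX eY e.
have E Z : s3 Z = b -> Z = Z • A • A'.
  move=> hZ; rewrite (vcomp_assoc H2) ?h3 ?e2 -?hZ ?(vcomp_idr H2) //; crush.
by rewrite (E _ eX) (E _ eY) e.
Qed.
Lemma cancel_l (A X Y : m3 C) a b : invertible A -> arr3 A a b -> Defs.t3 X = a -> Defs.t3 Y = a ->
  A • X = A • Y -> X = Y.
Proof.
move=> [A' [h1 [h2 h3]]] [e1 e2] eX eY e.
have E Z : Defs.t3 Z = a -> Z = A' • (A • Z).
  move=> hZ; rewrite -(vcomp_assoc H2) ?h2 ?e1 -?hZ ?(vcomp_idl H2) //; crush.
by rewrite (E _ eX) (E _ eY) e.
Qed.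

Ltac inv :=
  lazymatch goal with
  | |- invertible (id3 _) => eapply inv_id
  | |- invertible (_ • _) => eapply inv_vc; [rp3 | rp3 | reflexivity | reflexivity | inv | inv]
  | |- invertible (_ ⊚ _) => eapply inv_hc; [rp3 | rp3 | reflexivity | inv | inv]
  | |- invertible (_ ◀ _) => eapply inv_wl; [rp1 | rp3 | inv]
  | |- invertible (_ ▶ _) => eapply inv_wr; [rp3 | rp1 | inv]
  | |- invertible (sigma _ _) => eapply inv_sigma; [rp2 | rp2]
  | |- invertible (T _) => eapply inv_T
  | |- invertible (_ ^⋆) => first [eassumption | eapply inv_star; inv]
  | |- _ => eassumption
  end.

(** * The isomorphism [Gamma] *)

Lemma GammaE (F G : m1 C) nu : arr2 nu F G -> Gamma nu =
  (T G ⊚ id3 nu) •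
  (id3 ((eta G)^* ▷ G) ⊚ sigma nu (eta G^#)) •
  (id3 (((eta G)^* ▷ G) ∘ (nu ▷ (G^# □ G)))
   ⊚ (T F ▶ (G^# □ G))
   ⊚ id3 (F ◁ eta G^#)) •
  (sigma (eta F)^* (((eta G)^* ▷ G) ∘ (nu ▷ (G^# □ G)))
   ⊚ id3 ((F ◁ eta F^# ▷ (G^# □ G)) ∘ (F ◁ eta G^#))).
Proof. by move=> [<- <-]. Qed.

Lemma sharp3_arr (F G : m1 C) X nu nu' c d : arr1 F c d -> arr1 G c d ->
  arr2 nu F G -> arr2 nu' F G -> arr3 X nu nu' -> arr3 (sharp3 X) (sharp2 nu) (sharp2 nu').
Proof.
by move=> hF hG hn hn' hX; rewrite (sharp3E hX hn) (sharp2E hn) (sharp2E hn'); ty3.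
Qed.

Lemma Phi2_arr (E F G : m1 C) rho nu c d :
  arr1 E c d -> arr1 F c d -> arr1 G c d -> arr2 rho E F -> arr2 nu F G ->
  arr3 (Phi2 rho nu) (sharp2 rho ∘ sharp2 nu) (sharp2 (nu ∘ rho)).
Proof.
move=> hE hF hG hr hn; have h : arr2 (nu ∘ rho) E G by ty2.
by rewrite (Phi2E hr hn) (sharp2E hr) (sharp2E hn) (sharp2E h); ty3.
Qed.

Section Unit.
Context (F G : m1 C) (c d : ob C) (hF : arr1 F c d) (hG : arr1 G c d).

(** Recovers [nu] from its composite with the star of [eta G]: bend back with [eta G^#], then
    straighten with [T G]. Being invertible and natural, it shows in [evaluate_inj] that this
    operation is faithful. *)
Definition untwist (nu : m2 C) : m3 C :=
  (T G ⊚ id3 nu) • (id3 ((eta G)^* ▷ G) ⊚ sigma nu (eta G^#)).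

Lemma untwist_arr nu : arr2 nu F G ->
  arr3 (untwist nu) (((eta G)^* ▷ G) ∘ (nu ▷ (G^# □ G)) ∘ (F ◁ eta G^#)) nu.
Proof. by move=> hn; rewrite /untwist; ty3. Qed.
Lemma untwist_inv nu : arr2 nu F G -> invertible (untwist nu).
Proof. by move=> hn; rewrite /untwist; inv. Qed.
Lemma untwist_nat nu nu' X : arr2 nu F G -> arr2 nu' F G -> arr3 X nu nu' ->
  X • untwist nu =
  untwist nu' • (((id3 (eta G)^* ⊚ (X ▶ G^#)) ▶ G) ⊚ id3 (F ◁ eta G^#)).
Proof.
move=> hn hn' hX; rewrite /untwist.
have k1 : arr1 (id1 c) c c by ty1. have k2 : arr1 (G^# □ G) c c by ty1.
have N := sigma_nat_l hX hn hn' hF hG (leaf2_eta_sharp hG) k1 k2.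
by paths; flip; rl 1 N; sw [0]; pdone.
Qed.
Lemma evaluate_inj nu nu' X Y : arr2 nu F G -> arr2 nu' F G -> arr3 X nu nu' -> arr3 Y nu nu' ->
  id3 (eta G)^* ⊚ (X ▶ G^#) = id3 (eta G)^* ⊚ (Y ▶ G^#) -> X = Y.
Proof.
move=> hn hn' hX hY e.
apply: (cancel_r (untwist_inv hn) (untwist_arr hn)).
- by case: hX.
- by case: hY.
- by rewrite (untwist_nat hn hn' hX) (untwist_nat hn hn' hY) e.
Qed.
End Unit.

(* The star of [psi F^# G^# b^*]. *)
Definition chi (F G : m1 C) (b : m2 C) : m3 C :=
  (sigma ((eta F)^* ∘ (F ◁ b)) (eta G)^* ⊚ id3 (F ◁ eta G^# ▷ G^#)) •
  (id3 ((eta F)^* ∘ (F ◁ b)) ⊚ (F ◀ (T G^#)^⋆)).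

(** The functor [*#*] on 2-morphisms; by [rsharp2E] it is the mate formed with the opposite
    duality. *)
Definition rsharp2 (b : m2 C) : m2 C := (sharp2 b^*)^*.

Section Chi.
Context (F G : m1 C) (c d : ob C) (hF : arr1 F c d) (hG : arr1 G c d).
Let hF' := leaf1_sharp hF.
Let hG' := leaf1_sharp hG.

Lemma sharp2_sharp_arr nu : arr2 nu F^# G^# -> arr2 (sharp2 nu) G F.
Proof. by move=> h; have := sharp2_arr hF' hG' h; rewrite !(sharp1_inv HD). Qed.
Lemma rsharp2_arr b : arr2 b G^# F^# -> arr2 (rsharp2 b) F G.
Proof. by move=> /leaf2_star /sharp2_sharp_arr /leaf2_star. Qed.
Lemma rsharp2E b : arr2 b G^# F^# ->
  rsharp2 b = ((eta F)^* ▷ G) ∘ (F ◁ b ▷ G) ∘ (F ◁ eta G^#).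
Proof.
move=> hb; rewrite /rsharp2 (sharp2E (leaf2_star hb)) !(sharp1_inv HD).
by eapply eq_trans; [st2 | eq2].
Qed.
Lemma psi_sharpE nu : psi F^# G^# nu =
  ((F ◀ T G^#) ⊚ id3 ((F ◁ nu) ∘ eta F)) •
  (id3 (F ◁ (eta G^#)^* ▷ G^#) ⊚ sigma ((F ◁ nu) ∘ eta F) (eta G)).
Proof. by rewrite /psi !(sharp1_inv HD). Qed.
Lemma psi_sharp_arr nu : arr2 nu F^# G^# ->
  arr3 (psi F^# G^# nu) ((sharp2 nu ▷ G^#) ∘ eta G) ((F ◁ nu) ∘ eta F).
Proof. by move=> h; have := psi_arr hF' hG' h; rewrite !(sharp1_inv HD). Qed.
Lemma chi_star b : arr2 b G^# F^# -> (psi F^# G^# b^*)^⋆ = chi F G b.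
Proof.
move=> hb; have h := leaf3_T_sharp_star hG.
rewrite psi_sharpE /chi; eapply eq_trans; [st3|].
by paths; pdone.
Qed.
Lemma chi_arr b : arr2 b G^# F^# ->
  arr3 (chi F G b) ((eta F)^* ∘ (F ◁ b)) ((eta G)^* ∘ (rsharp2 b ▷ G^#)).
Proof. by move=> hb; have h := leaf3_T_sharp_star hG; rewrite (rsharp2E hb) /chi; ty3. Qed.
Lemma chi_inv b : arr2 b G^# F^# -> invertible (chi F G b).
Proof.
move=> hb; have h := leaf3_T_sharp_star hG; have h' := inv_star (inv_T G^#).
by rewrite /chi; inv.
Qed.
Lemma chi_nat b b' Y : arr2 b G^# F^# -> arr2 b' G^# F^# -> arr3 Y b b' ->
  (id3 (eta G)^* ⊚ ((sharp3 Y^⋆)^⋆ ▶ G^#)) • chi F G b = chi F G b' • (id3 (eta F)^* ⊚ (F ◀ Y)).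
Proof.
move=> hb hb' hY; have hs := leaf2_star hb; have hs' := leaf2_star hb'.
have := psi_nat hF' hG' hs' hs (leaf3_star hY); rewrite !(sharp1_inv HD) => E.
have t1 := sharp2_sharp_arr hs; have t2 := sharp2_sharp_arr hs'.
have t3 := psi_sharp_arr hs; have t4 := psi_sharp_arr hs'.
have t5 := sharp3_arr hF' hG' hs' hs (leaf3_star hY).
have e1 := chi_star hb; have e2 := chi_star hb'.
by eapply star_eq in E; [|st3|st3]; rewrite e1 e2 in E.
Qed.
End Chi.

Lemma chi_unit (F : m1 C) c d : arr1 F c d ->
  (id3 (eta F)^* ⊚ ((Phi0 F^#)^⋆ ▶ F^#)) • chi F F (id2 F^#) = id3 (eta F)^*.
Proof.
move=> hF; have := psi_unit (leaf1_sharp hF); rewrite !(sharp1_inv HD) => E.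
have hi := id2_arr H2 F^#; have e := chi_star hF hF hi; rewrite (star2_id HP) in e.
have t := psi_sharp_arr hF hF hi; have t1 := sharp2_sharp_arr hF hF hi.
have h : arr3 (Phi0 F^#) (id2 F) (sharp2 (id2 F^#)).
  rewrite (sharp2E hi) /Phi0 !(sharp1_inv HD).
  have := leaf3_T_star hF.
  have -> : (F ◁ (eta F^#)^*) ∘ (F ◁ id2 F^# ▷ F) ∘ (eta F ▷ F) =
    (F ◁ (eta F^#)^*) ∘ (eta F ▷ F) by eq2.
  done.
by eapply star_eq in E; [|st3|st3]; rewrite e in E.
Qed.

Lemma chi_comp (E F G : m1 C) b b' c d : arr1 E c d -> arr1 F c d -> arr1 G c d ->
  arr2 b F^# E^# -> arr2 b' G^# F^# ->
  (id3 (eta G)^* ⊚ ((Phi2 b^* b'^*)^⋆ ▶ G^#)) • chi E G (b ∘ b') =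
  (chi F G b' ⊚ id3 (rsharp2 b ▷ G^#)) • (id3 (eta F)^* ⊚ sigma (rsharp2 b) b') •
  (chi E F b ⊚ id3 (E ◁ b')).
Proof.
move=> hE hF hG hb hb'; have hE' := leaf1_sharp hE; have hF' := leaf1_sharp hF.
have hG' := leaf1_sharp hG; have hs := leaf2_star hb; have hs' := leaf2_star hb'.
have := psi_comp hE' hF' hG' hs hs'; rewrite !(sharp1_inv HD) => X.
have hbb : arr2 (b ∘ b') G^# E^# by ty2.
have ebb : (b ∘ b')^* = b'^* ∘ b^* by st2.
have hsbb : arr2 (b'^* ∘ b^*) E^# G^# by ty2.
have e1 := chi_star hE hF hb; have e2 := chi_star hF hG hb'; have e3 := chi_star hE hG hbb.
have t1 := sharp2_sharp_arr hE hF hs; have t2 := sharp2_sharp_arr hF hG hs'.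
have t3 := sharp2_sharp_arr hE hG hsbb.
have t4 := psi_sharp_arr hE hF hs; have t5 := psi_sharp_arr hF hG hs'.
have t6 := psi_sharp_arr hE hG hsbb.
have t7 : arr3 (Phi2 b^* b'^*) (sharp2 b^* ∘ sharp2 b'^*) (sharp2 (b'^* ∘ b^*)).
  have := Phi2_arr hE' hF' hG' hs hs'.
  done.
rewrite ebb in e3.
eapply star_eq in X; [|st3|st3]; rewrite e1 e2 e3 in X.
have u1 := chi_arr hE hF hb; have u2 := chi_arr hF hG hb'.
rewrite /rsharp2 in u1 u2 *; by rewrite X; paths; pdone.
Qed.

Section One.
Context (F G : m1 C) (c d : ob C) (hF : arr1 F c d) (hG : arr1 G c d).

Lemma phi_inv nu : arr2 nu F G -> invertible (phi F G nu).
Proof. by move=> hn; rewrite /phi; inv. Qed.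
(** The last two factors of [Gamma] are the pairing whiskered by [G], the first two are [untwist].
    Both are invertible, hence so is [Gamma]. *)
Lemma Gamma_untwist nu : arr2 nu F G ->
  Gamma nu = untwist G nu • ((phi F G nu ▶ G) ⊚ id3 (F ◁ eta G^#)).
Proof. by move=> hn; rewrite (GammaE hn) /untwist /phi; paths; pdone. Qed.
Lemma Gamma_arr nu : arr2 nu F G -> arr3 (Gamma nu) (rsharp2 (sharp2 nu)) nu.
Proof.
move=> hn; have hs := sharp2_arr hF hG hn; have hp := phi_arr hF hG hn.
by rewrite (Gamma_untwist hn) (rsharp2E hF hG hs) /untwist; ty3.
Qed.
Lemma Gamma_inv nu : arr2 nu F G -> invertible (Gamma nu).
Proof.
move=> hn; have hs := sharp2_arr hF hG hn; have hp := phi_arr hF hG hn.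
by have h := phi_inv hn; rewrite (Gamma_untwist hn) /untwist; inv.
Qed.
(** After [phi] has crossed the tensorator of [chi], the cells that remain at [G] are exactly those
    of the swallowtail axiom. *)
Lemma Gamma_chi nu : arr2 nu F G ->
  (id3 (eta G)^* ⊚ (Gamma nu ▶ G^#)) • chi F G (sharp2 nu) = phi F G nu.
Proof.
move=> hn; have hb := sharp2_arr hF hG hn; have hf := phi_arr hF hG hn.
rewrite (Gamma_untwist hn) /untwist /chi; move: (sharp2 nu) (phi F G nu) hb hf => b f hb hf.
have h := leaf3_T_sharp_star hG; have h' := leaf2_star (leaf2_eta hG).
have a1 : arr2 ((eta F)^* ∘ (F ◁ b)) (F □ G^#) (id1 d) by ty2.
have a2 : arr2 ((eta G)^* ∘ (nu ▷ G^#)) (F □ G^#) (id1 d) by ty2.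
have k1 : arr1 (F □ G^#) d d by ty1. have k2 : arr1 (id1 d) d d by ty1.
have k3 : arr1 (G □ G^#) d d by ty1.
have N1 := sigma_nat_l hf a1 a2 k1 k2 h' k3 k2.
have a3 : arr2 (id2 G^#) G^# G^# by ty2.
have a4 : arr2 ((G^# ◁ (eta G)^*) ∘ (eta G^# ▷ G^#)) G^# G^# by ty2.
have N2 := sigma_nat_r hn hF (leaf1_sharp hG) h a3 a4.
have S := T_swallowtail HD G.
have -> : f = f • id3 ((eta F)^* ∘ (F ◁ b)) by paths; pdone.
by paths; rl 2 (eq_sym N1); sw [4;1]; rl 2 N2; rl 0 S; pdone.
Qed.
Lemma Gamma_nat nu nu' X : arr2 nu F G -> arr2 nu' F G -> arr3 X nu nu' ->
  Gamma nu' • star_sharp_sq3 X = X • Gamma nu.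
Proof.
move=> hn hn' hX; rewrite (Gamma_untwist hn) (Gamma_untwist hn').
have hb := sharp2_arr hF hG hn; have hf := phi_arr hF hG hn.
have hb' := sharp2_arr hF hG hn'; have hf' := phi_arr hF hG hn'.
have N := phi_nat hF hG hn hn' hX; have U := untwist_nat hF hG hn hn' hX.
have hs := sharp3_arr hF hG hn hn' hX; have hs' := leaf3_star hs.
have hu := untwist_arr hF hG hn; have hu' := untwist_arr hF hG hn'.
have e : star_sharp_sq3 X =
    id3 ((eta F)^* ▷ G) ⊚ (F ◀ sharp3 X ▶ G) ⊚ id3 (F ◁ eta G^#).
  rewrite /star_sharp_sq3 (sharp3E hs' (leaf2_star hb')) !(sharp1_inv HD).
  by eapply eq_trans; [st3|]; paths; pdone.
by rewrite e; paths; rl 1 N; rl 0 (eq_sym U); pdone.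
Qed.

(** Faithful evaluation combined with the invertible [chi]: both sides of a law of [Gamma] take a
    form in which [Gamma_chi] turns [Gamma] into [phi]. *)
Lemma chi_inj b nu X Y : arr2 b G^# F^# -> arr2 nu F G ->
  arr3 X (rsharp2 b) nu -> arr3 Y (rsharp2 b) nu ->
  (id3 (eta G)^* ⊚ (X ▶ G^#)) • chi F G b = (id3 (eta G)^* ⊚ (Y ▶ G^#)) • chi F G b -> X = Y.
Proof.
move=> hb hn hX hY e; have hr := rsharp2_arr hF hG hb.
apply: (evaluate_inj hF hG hr hn hX hY).
have h : forall Z, arr3 Z (rsharp2 b) nu ->
    s3 (id3 (eta G)^* ⊚ (Z ▶ G^#)) = (eta G)^* ∘ (rsharp2 b ▷ G^#).
  move=> Z hZ; have : arr3 (id3 (eta G)^* ⊚ (Z ▶ G^#)) ((eta G)^* ∘ (rsharp2 b ▷ G^#))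
    ((eta G)^* ∘ (nu ▷ G^#)) by ty3.
  by case.
exact: (cancel_r (chi_inv hF hG hb) (chi_arr hF hG hb) (h _ hX) (h _ hY) e).
Qed.
End One.

Lemma Phi0_arr (F : m1 C) c d : arr1 F c d -> arr3 (Phi0 F) (id2 F^#) (sharp2 (id2 F)).
Proof.
move=> hF; rewrite (sharp2E (id2_arr H2 F)) /Phi0.
have h := leaf3_T_sharp_star hF.
by have -> : (F^# ◁ (eta F)^*) ∘ (F^# ◁ id2 F ▷ F^#) ∘ (eta F^# ▷ F^#) =
    (F^# ◁ (eta F)^*) ∘ (eta F^# ▷ F^#) by eq2.
Qed.

Lemma Gamma_unit (F : m1 C) c d : arr1 F c d ->
  Gamma (id2 F) • (sharp3 (Phi0 F)^⋆)^⋆ = (Phi0 F^#)^⋆.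
Proof.
move=> hF; have hi := id2_arr H2 F; have hi' := id2_arr H2 F^#; have hF' := leaf1_sharp hF.
have h0 := Phi0_arr hF; have hs := sharp2_arr hF hF hi.
have hc := chi_nat hF hF hi' hs h0.
have hr := rsharp2_arr hF hF hs; have hr' := rsharp2_arr hF hF hi'.
have t1 := Gamma_arr hF hF hi.
have t2 : arr3 (sharp3 (Phi0 F)^⋆)^⋆ (rsharp2 (id2 F^#)) (rsharp2 (sharp2 (id2 F))).
  have := sharp3_arr hF' hF' (leaf2_star hs) (leaf2_star hi') (leaf3_star h0).
  exact: leaf3_star.
have t3 : arr3 (Phi0 F^#)^⋆ (rsharp2 (id2 F^#)) (id2 F).
  have := leaf3_star (Phi0_arr hF'); rewrite (sharp1_inv HD) (star2_id HP) => h.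
  by rewrite /rsharp2 (star2_id HP).
have t4 : arr3 (Gamma (id2 F) • (sharp3 (Phi0 F)^⋆)^⋆) (rsharp2 (id2 F^#)) (id2 F) by ty3.
have hc1 := chi_arr hF hF hi'; have hc2 := chi_arr hF hF hs.
have hp := phi_arr hF hF hi.
have E := Gamma_chi hF hF hi; have P := phi_unit hF; have Q := chi_unit hF.
apply: (chi_inj hF hF hi' hi t4 t3); rewrite Q -[RHS]P.
by paths; rl 1 hc; rl 0 E; pdone.
Qed.

(** Tested by [chi_inj], the law compares [chi_comp] with [phi_comp], whose right-hand sides have
    the same shape. Naturality of the tensorator in [Gamma rho] matches their middle factors. *)
Lemma Gamma_comp (E F G : m1 C) rho nu c d :
  arr1 E c d -> arr1 F c d -> arr1 G c d -> arr2 rho E F -> arr2 nu F G ->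
  (Gamma nu ⊚ Gamma rho) • (Phi2 (sharp2 rho)^* (sharp2 nu)^*)^⋆ =
  Gamma (nu ∘ rho) • (sharp3 (Phi2 rho nu)^⋆)^⋆.
Proof.
move=> hE hF hG hr hn; have hrn : arr2 (nu ∘ rho) E G by ty2.
have hE' := leaf1_sharp hE; have hF' := leaf1_sharp hF; have hG' := leaf1_sharp hG.
have hb := sharp2_arr hE hF hr; have hb' := sharp2_arr hF hG hn.
have hc := sharp2_arr hE hG hrn; have hbb : arr2 (sharp2 rho ∘ sharp2 nu) G^# E^# by ty2.
have hS := Phi2_arr hE hF hG hr hn.
have S := chi_comp hE hF hG hb hb'; have N := chi_nat hE hG hbb hc hS.
have P := phi_comp hE hF hG hr hn.
have E1 := Gamma_chi hE hF hr; have E2 := Gamma_chi hF hG hn; have E3 := Gamma_chi hE hG hrn.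
have g1 := Gamma_arr hE hF hr; have g2 := Gamma_arr hF hG hn; have g3 := Gamma_arr hE hG hrn.
have r1 := rsharp2_arr hE hF hb; have r2 := rsharp2_arr hF hG hb'.
have r3 := rsharp2_arr hE hG hc; have r4 := rsharp2_arr hE hG hbb.
have c1 := chi_arr hE hF hb; have c2 := chi_arr hF hG hb'.
have c3 := chi_arr hE hG hc; have c4 := chi_arr hE hG hbb.
have p1 := phi_arr hE hF hr; have p2 := phi_arr hF hG hn; have p3 := phi_arr hE hG hrn.
have t1 : arr3 (sharp3 (Phi2 rho nu)^⋆)^⋆ (rsharp2 (sharp2 rho ∘ sharp2 nu))
    (rsharp2 (sharp2 (nu ∘ rho))).
  exact: leaf3_star (sharp3_arr hE' hG' (leaf2_star hc) (leaf2_star hbb) (leaf3_star hS)).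
have t2 : arr3 (Phi2 (sharp2 rho)^* (sharp2 nu)^*)^⋆ (rsharp2 (sharp2 rho ∘ sharp2 nu))
    (rsharp2 (sharp2 nu) ∘ rsharp2 (sharp2 rho)).
  have hs := leaf2_star hb; have hs' := leaf2_star hb'.
  have u1 := sharp2_sharp_arr hE hF hs; have u2 := sharp2_sharp_arr hF hG hs'.
  have := leaf3_star (Phi2_arr hE' hF' hG' hs hs').
  have -> : (sharp2 (sharp2 rho)^* ∘ sharp2 (sharp2 nu)^*)^* =
    rsharp2 (sharp2 nu) ∘ rsharp2 (sharp2 rho) by st2.
  by rewrite -(star2_o hb hb').
have t3 : arr3 ((Gamma nu ⊚ Gamma rho) • (Phi2 (sharp2 rho)^* (sharp2 nu)^*)^⋆)
   (rsharp2 (sharp2 rho ∘ sharp2 nu)) (nu ∘ rho) by ty3.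
have t4 : arr3 (Gamma (nu ∘ rho) • (sharp3 (Phi2 rho nu)^⋆)^⋆)
   (rsharp2 (sharp2 rho ∘ sharp2 nu)) (nu ∘ rho) by ty3.
apply: (chi_inj hE hG hbb hrn t3 t4).
have N1 := sigma_nat_l g1 r1 hr hE hF hb' hG' hF'.
by paths; rl 2 S; sw [1]; rl 0 E2; rl 1 (eq_sym N1); rl 2 E1; flip; rl 1 N; rl 0 E3; rl 0 P; pdone.
Qed.

Lemma sharp1_box_arr (F H : m1 C) c d e : arr1 F d e -> arr1 H c d -> (F □ H)^# = H^# □ F^#.
Proof. by move=> [hF _] [_ hH]; apply: (sharp1_box HD); rewrite hF hH. Qed.

Section Arr.
Context (F G H K : m1 C) (c d e : ob C).
Context (hF : arr1 F d e) (hG : arr1 G d e) (hH : arr1 H c d) (hK : arr1 K c d).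

Lemma kappa_arr mu nu : arr2 mu F G -> arr2 nu H K ->
  arr3 (kappa mu nu) ((sharp2 nu ▷ F^#) ∘ (K^# ◁ sharp2 mu)) (sharp2 ((mu ▷ K) ∘ (F ◁ nu))).
Proof.
move=> hm hn; have h : arr2 ((mu ▷ K) ∘ (F ◁ nu)) (F □ H) (G □ K) by ty2.
rewrite (kappaE hm hn) (sharp2E h) (sharp2E hm) (sharp2E hn).
rewrite (sharp1_box_arr hF hH) (sharp1_box_arr hG hK) (eta_box_star hG hK) (eta_box_sharp hF hH).
by ty3.
Qed.

End Arr.

Section ChiBox.
Context (F G H K : m1 C) (c d e : ob C).
Context (hF : arr1 F d e) (hG : arr1 G d e) (hH : arr1 H c d) (hK : arr1 K c d).

(** Starring [psi_box] reverses the order of composition, so [chi] is taken at the other of the two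
    composites that the tensorator of [q] and [b] relates. This is why the Gray product law for
    [Gamma] contains [*#] of a tensorator. *)
Lemma chi_box b q : arr2 b G^# F^# -> arr2 q K^# H^# ->
  (id3 (eta (G □ K))^* ⊚ ((kappa q^* b^*)^⋆ ▶ (K^# □ G^#))) •
    chi (F □ H) (G □ K) ((H^# ◁ b) ∘ (q ▷ G^#)) =
  (id3 (eta G)^* ⊚ (G ◀ chi H K q ▶ G^#) ⊚ id3 (rsharp2 b ▷ (H □ K^# □ G^#))) •
  (id3 (eta G)^* ⊚ sigma (rsharp2 b) (((eta H)^* ∘ (H ◁ q)) ▷ G^#)) •
  (chi F G b ⊚ id3 (F ◁ ((eta H)^* ∘ (H ◁ q)) ▷ G^#)) •
  (id3 (eta F)^* ⊚ (F ◀ sigma (eta H)^* b) ⊚ id3 ((F □ H) ◁ q ▷ G^#)).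
Proof.
move=> hb hq; have hs := leaf2_star hb; have hs' := leaf2_star hq.
have hF' := leaf1_sharp hF; have hG' := leaf1_sharp hG.
have hH' := leaf1_sharp hH; have hK' := leaf1_sharp hK.
have X := psi_box hH' hK' hF' hG' hs' hs.
rewrite (box2E hs' hs) !(sharp1_inv HD) in X.
have hm : arr2 ((H^# ◁ b) ∘ (q ▷ G^#)) (K^# □ G^#) (H^# □ F^#) by ty2.
have hFH : arr1 (F □ H) c e by ty1. have hGK : arr1 (G □ K) c e by ty1.
have hm' : arr2 ((H^# ◁ b) ∘ (q ▷ G^#)) (G □ K)^# (F □ H)^#.
  by rewrite (sharp1_box_arr hF hH) (sharp1_box_arr hG hK).
have u1 := chi_star hFH hGK hm'.
have em : ((H^# ◁ b) ∘ (q ▷ G^#))^* = (q^* ▷ G^#) ∘ (H^# ◁ b^*) by st2.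
rewrite em (sharp1_box_arr hF hH) (sharp1_box_arr hG hK) in u1.
have e2 : (K^# □ G^#)^# = G □ K by rewrite (sharp1_box_arr hK' hG') !(sharp1_inv HD).
have e1 : (H^# □ F^#)^# = F □ H by rewrite (sharp1_box_arr hH' hF') !(sharp1_inv HD).
have k := kappa_arr hH' hK' hF' hG' hs' hs; rewrite !(sharp1_inv HD) in k.
have hn : arr2 ((q^* ▷ G^#) ∘ (H^# ◁ b^*)) (H^# □ F^#) (K^# □ G^#) by ty2.
have k1 : arr1 (H^# □ F^#) e c by ty1. have k2 : arr1 (K^# □ G^#) e c by ty1.
have t := psi_arr k1 k2 hn; have ts := sharp2_arr k1 k2 hn; rewrite e1 e2 in t ts.
have t1 := psi_sharp_arr hF hG hs; have t2 := psi_sharp_arr hH hK hs'.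
have t3 := sharp2_sharp_arr hF hG hs; have t4 := sharp2_sharp_arr hH hK hs'.
have v1 := chi_star hF hG hb; have v2 := chi_star hH hK hq.
have x1 := leaf2_eta hFH; have x2 := leaf2_eta hGK.
rewrite (sharp1_box_arr hF hH) in x1; rewrite (sharp1_box_arr hG hK) in x2.
have x3 := leaf2_star x1; have x4 := leaf2_star x2.
eapply star_eq in X; [|st3|st3]; rewrite u1 v1 v2 in X.
have w1 := chi_arr hF hG hb; have w2 := chi_arr hH hK hq.
rewrite /rsharp2 in w1 w2 *; rewrite X; paths; pdone.
Qed.
End ChiBox.

Lemma Gamma_box (F G H K : m1 C) mu nu c d e :
  arr1 F d e -> arr1 G d e -> arr1 H c d -> arr1 K c d -> arr2 mu F G -> arr2 nu H K ->
  Gamma (box2 mu nu) • (sharp3 (kappa mu nu)^⋆)^⋆ =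
  box3 (Gamma mu) (Gamma nu) • inv3 (sigma (rsharp2 (sharp2 mu)) (rsharp2 (sharp2 nu)))
    • (kappa (sharp2 nu)^* (sharp2 mu)^*)^⋆ • (sharp3 (sigma (sharp2 nu)^* (sharp2 mu)^*))^⋆.
Proof.
move=> hF hG hH hK hm hn.
have hF' := leaf1_sharp hF; have hG' := leaf1_sharp hG.
have hH' := leaf1_sharp hH; have hK' := leaf1_sharp hK.
have g1 := Gamma_arr hF hG hm; have g2 := Gamma_arr hH hK hn.
have E1 := Gamma_chi hF hG hm.
have P := phi_box hF hG hH hK hm hn.
have p1 := phi_arr hF hG hm; have p2 := phi_arr hH hK hn.
have E2 := Gamma_chi hH hK hn.
have hb := sharp2_arr hF hG hm; have hq := sharp2_arr hH hK hn.
have r1 := rsharp2_arr hF hG hb; have r2 := rsharp2_arr hH hK hq.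
have c1 := chi_arr hF hG hb; have c2 := chi_arr hH hK hq.
have -> : box3 (Gamma mu) (Gamma nu) = (Gamma mu ▶ K) ⊚ (F ◀ Gamma nu).
  by rewrite /box3 /t32 /s32; case: g1 => -> _; case: g2 => -> _; case: r1 => -> _; case: r2 => _ ->.
have X := chi_box hF hG hH hK hb hq.
have ks := kappa_arr hF hG hH hK hm hn.
have kk := kappa_arr hH' hK' hF' hG' (leaf2_star hq) (leaf2_star hb).
rewrite (box2E hm hn) in P *.
have [I1 [I2 _]] : is_inverse (sigma (rsharp2 (sharp2 mu)) (rsharp2 (sharp2 nu)))
   (inv3 (sigma (rsharp2 (sharp2 mu)) (rsharp2 (sharp2 nu)))).
  by apply: inv3_spec; inv.
have sg : arr3 (sigma (rsharp2 (sharp2 mu)) (rsharp2 (sharp2 nu)))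
  ((rsharp2 (sharp2 mu) ▷ K) ∘ (F ◁ rsharp2 (sharp2 nu)))
  ((G ◁ rsharp2 (sharp2 nu)) ∘ (rsharp2 (sharp2 mu) ▷ H)) by ty3.
case: sg => q1 q2; rewrite q1 q2 in I1 I2; clear q1 q2.
have hmn : arr2 ((mu ▷ K) ∘ (F ◁ nu)) (F □ H) (G □ K) by ty2.
have hFH : arr1 (F □ H) c e by ty1. have hGK : arr1 (G □ K) c e by ty1.
have G3 := Gamma_arr hFH hGK hmn; have E3 := Gamma_chi hFH hGK hmn.
have hc := sharp2_arr hFH hGK hmn.
have m1a : arr2 ((sharp2 nu ▷ F^#) ∘ (K^# ◁ sharp2 mu)) (K^# □ G^#) (H^# □ F^#) by ty2.
have m2a : arr2 ((H^# ◁ sharp2 mu) ∘ (sharp2 nu ▷ G^#)) (K^# □ G^#) (H^# □ F^#) by ty2.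
have sa : arr3 (sigma (sharp2 nu) (sharp2 mu)) ((sharp2 nu ▷ F^#) ∘ (K^# ◁ sharp2 mu))
  ((H^# ◁ sharp2 mu) ∘ (sharp2 nu ▷ G^#)) by ty3.
have eb := sharp1_box_arr hF hH; have eb' := sharp1_box_arr hG hK.
rewrite -eb -eb' in m1a m2a.
have N1 := chi_nat hFH hGK m1a hc ks.
have N2 := chi_nat hFH hGK m1a m2a sa.
have z1 := chi_arr hFH hGK m1a; have z2 := chi_arr hFH hGK m2a; have z3 := chi_arr hFH hGK hc.
have y1 := rsharp2_arr hFH hGK m1a; have y2 := rsharp2_arr hFH hGK m2a.
have y3 := rsharp2_arr hFH hGK hc.
have z4 := phi_arr hFH hGK hmn.
have w1 := leaf3_star (sharp3_arr (leaf1_sharp hFH) (leaf1_sharp hGK)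
   (leaf2_star hc) (leaf2_star m1a) (leaf3_star ks)).
have w2 := leaf3_star (sharp3_arr (leaf1_sharp hFH) (leaf1_sharp hGK)
   (leaf2_star m2a) (leaf2_star m1a) (leaf3_star sa)).
rewrite (sigma_star hq hK' hH' hb hG' hF') in N2 w2.
have em : ((H^# ◁ sharp2 mu) ∘ (sharp2 nu ▷ G^#))^* =
    ((sharp2 nu)^* ▷ G^#) ∘ (H^# ◁ (sharp2 mu)^*) by st2.
have w3 : arr3 (kappa (sharp2 nu)^* (sharp2 mu)^*)^⋆ (rsharp2 ((H^# ◁ sharp2 mu) ∘ (sharp2 nu ▷ G^#)))
  ((G ◁ rsharp2 (sharp2 nu)) ∘ (rsharp2 (sharp2 mu) ▷ H)).
  rewrite !(sharp1_inv HD) in kk; have := leaf3_star kk; rewrite -em.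
  have u1 := sharp2_sharp_arr hF hG (leaf2_star hb).
  have u2 := sharp2_sharp_arr hH hK (leaf2_star hq).
  have -> : ((sharp2 (sharp2 mu)^* ▷ H) ∘ (G ◁ sharp2 (sharp2 nu)^*))^* =
     (G ◁ rsharp2 (sharp2 nu)) ∘ (rsharp2 (sharp2 mu) ▷ H) by st2.
  done.
rewrite -/(rsharp2 _) -/(rsharp2 _) in w1 w2.
have tX : arr3 (Gamma ((mu ▷ K) ∘ (F ◁ nu)) • (sharp3 (kappa mu nu)^⋆)^⋆)
  (rsharp2 ((sharp2 nu ▷ F^#) ∘ (K^# ◁ sharp2 mu))) ((mu ▷ K) ∘ (F ◁ nu)) by ty3.
have tY : arr3 (((Gamma mu ▶ K) ⊚ (F ◀ Gamma nu))
    • inv3 (sigma (rsharp2 (sharp2 mu)) (rsharp2 (sharp2 nu)))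
    • (kappa (sharp2 nu)^* (sharp2 mu)^*)^⋆ • (sharp3 (sigma (sharp2 nu)^* (sharp2 mu)^*))^⋆)
  (rsharp2 ((sharp2 nu ▷ F^#) ∘ (K^# ◁ sharp2 mu))) ((mu ▷ K) ∘ (F ◁ nu)) by ty3.
apply: (chi_inj hFH hGK m1a hmn tX tY).
have eF := eta_box_star hF hH; have eG := eta_box_star hG hK.
rewrite eb eb' in hc m1a m2a; rewrite eb' eG eF in N1 z1 z2 z3 N2 z4 E3; rewrite eG in X; rewrite eF in P.
rewrite eb' eG.
have a1 : arr2 ((eta H)^* ∘ (H ◁ sharp2 nu)) (H □ K^#) (id1 d) by ty2.
have a2 : arr2 ((eta K)^* ∘ (rsharp2 (sharp2 nu) ▷ K^#)) (H □ K^#) (id1 d) by ty2.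
have k1 : arr1 (H □ K^#) d d by ty1. have k2 : arr1 (id1 d) d d by ty1.
have k3 : arr1 (K □ K^#) d d by ty1.
(* [S1] produces the tensorator of the two images under [*#*#], which cancels its inverse by [I2].
   The other three carry [chi] of [#nu] and the two values of [Gamma] across the remaining
   tensorators, until [E1] and [E2] apply. *)
have S1 := sigma_nat_r r1 hF k1 c2 a1 a2.
have S2 := sigma_nat_l c2 a1 a2 k1 k2 hb hG' hF'.
have S3 := sigma_nat_l g1 r1 hm hF hG (leaf2_star (leaf2_eta hK)) k3 k2.
have b1 : arr2 (K^# ◁ sharp2 mu) (K^# □ G^#) (K^# □ F^#) by ty2.
have k4 : arr1 (K^# □ G^#) e c by ty1. have k5 : arr1 (K^# □ F^#) e c by ty1.
have S4 := sigma_nat_l g2 r2 hn hH hK b1 k4 k5.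
clear tX tY em.
paths; rl 1 N1; rl 0 E3; rl 0 P; flip; rl 4 N2; rl 3 X; rl 3 (eq_sym S1); rl 2 I2; sw [0]; rl 1 (eq_sym S3); sw [2]; rl 3 E1; sw [2]; rl 3 (eq_sym S2); sw [0;1;2]; rl 3 (eq_sym S4); rl 4 E2; pdone.
Qed.

Lemma arr1_self (F : m1 C) : arr1 F (s1 F) (Defs.t1 F).
Proof. by []. Qed.
Lemma arr2_self (nu : m2 C) : arr2 nu (s2 nu) (t2 nu).
Proof. by []. Qed.
Lemma arr1_t2 (nu : m2 C) : arr1 (t2 nu) (s21 nu) (t21 nu).
Proof. exact: glob2 H2 nu. Qed.
Lemma arr2_t3 (X : m3 C) : arr2 (Defs.t3 X) (s32 X) (t32 X).
Proof. exact: glob3 H2 X. Qed.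

Lemma Gamma_natiso : natiso_star_sharp_sq (@Gamma C).
Proof.
split.
- by move=> nu; exact: (Gamma_arr (arr1_self (s2 nu)) (arr1_t2 nu) (arr2_self nu)).
- by move=> nu; exact: (Gamma_inv (arr1_self (s2 nu)) (arr1_t2 nu) (arr2_self nu)).
- move=> X; have h : arr1 (t2 (s3 X)) (s31 X) (t31 X) := arr1_t2 (s3 X).
  have hX : arr3 X (s3 X) (Defs.t3 X) by [].
  exact: (Gamma_nat (arr1_self (s32 X)) h (arr2_self (s3 X)) (arr2_t3 X) hX).
- by move=> F; exact: Gamma_unit (arr1_self F).
- move=> mu nu e; have hm := arr2_self mu; have hG := arr1_t2 mu; have hF := arr1_t2 nu.
  have [h _] := hm; rewrite e in hm.
  have hE := arr1_self (s2 nu).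
  rewrite /s21 /t21 e in hG; case: (hF) => e1 e2; rewrite e1 e2 in hG.
  exact: Gamma_comp hE hF hG (arr2_self nu) hm.
- move=> mu nu e; have hG := arr1_t2 mu; have hK := arr1_t2 nu.
  have hF : arr1 (s2 mu) (s21 mu) (t21 mu) by []. have hH : arr1 (s2 nu) (s21 nu) (t21 nu) by [].
  rewrite -e in hK hH.
  exact: Gamma_box hF hG hH hK (arr2_self mu) (arr2_self nu).
Qed.

(** * The isomorphism [Theta] *)

Lemma leaf3_cap (mu : m2 C) f g : arr2 mu f g -> arr3 (eps mu^*)^⋆ (mu^* ∘ mu) (id2 f).
Proof. by move=> h; have := leaf3_eps_star (leaf2_star h); rewrite (star2_inv HP). Qed.

(** Read from the last factor on: [nu^*] crosses [#nu], a pair for [eta F] is created, [phi]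
    replaces [#nu] by [nu], and two caps remove [nu] with [nu^*] and the pair for [eta G]. *)
Definition omega (F G : m1 C) (nu : m2 C) : m3 C :=
  (id3 (eta F) ⊚ (eps (eta G)^*)^⋆) •
  (id3 (eta F ∘ (eta G)^*) ⊚ ((eps nu)^⋆ ▶ G^#) ⊚ id3 (eta G)) •
  (id3 (eta F) ⊚ phi F G nu ⊚ id3 ((nu^* ▷ G^#) ∘ eta G)) •
  (eps (eta F) ⊚ id3 ((F ◁ sharp2 nu) ∘ (nu^* ▷ G^#) ∘ eta G)) •
  (sigma nu^* (sharp2 nu) ⊚ id3 (eta G)).

Section One.
Context (F G : m1 C) (c d : ob C) (hF : arr1 F c d) (hG : arr1 G c d).

Lemma omega_arr nu : arr2 nu F G ->
  arr3 (omega F G nu) ((nu^* ▷ F^#) ∘ (G ◁ sharp2 nu) ∘ eta G) (eta F).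
Proof.
move=> hn; have hb := sharp2_arr hF hG hn; have hf := phi_arr hF hG hn.
by have h := leaf3_cap (leaf2_eta hG); rewrite /omega; ty3.
Qed.

Lemma omega_nat nu nu' X : arr2 nu F G -> arr2 nu' F G -> arr3 X nu nu' ->
  omega F G nu • ((X^⋆ ▶ F^#) ⊚ id3 ((G ◁ sharp2 nu) ∘ eta G)) =
  omega F G nu' • (id3 (nu'^* ▷ F^#) ⊚ (G ◀ sharp3 X) ⊚ id3 (eta G)).
Proof.
move=> hn hn' hX; have N := phi_nat hF hG hn hn' hX.
have hb := sharp2_arr hF hG hn; have hf := phi_arr hF hG hn.
have hb' := sharp2_arr hF hG hn'; have hf' := phi_arr hF hG hn'.
have hs := sharp3_arr hF hG hn hn' hX; have h := leaf3_cap (leaf2_eta hG).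
have E := eps_nat HP X; case: (hX) => e1 e2; rewrite e1 e2 in E; clear e1 e2.
eapply star_eq in E; [|st3|st3].
have S1 := sigma_nat_r (leaf2_star hn') hG (leaf1_sharp hG) hs hb hb'.
have S2 := sigma_nat_l (leaf3_star hX) (leaf2_star hn') (leaf2_star hn) hG hF hb (leaf1_sharp hG) (leaf1_sharp hF).
rewrite /omega; paths. rl 4 S2. sw [3;2]. rl 1 E. flip. rl 4 S1. sw [3]. rl 2 N. pdone.
Qed.
End One.

(** The cell is idempotent because [eps] is multiplicative, and the zigzag makes its star a left
    inverse. *)
Lemma eps_id (F : m1 C) : eps (id2 F) = id3 (id2 F).
Proof.
have hF : arr1 F (s1 F) (Defs.t1 F) by [].
have hi := id2_arr H2 F; have h := leaf3_eps hi; rewrite (star2_id HP) in h.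
have e1 : id2 F ∘ id2 F = id2 F by eq2.
have h' := h; rewrite e1 in h'.
have hs := leaf3_star h'; rewrite (star2_id HP) in hs.
have Z : (eps (id2 F))^⋆ • eps (id2 F) = id3 (id2 F).
  have := eps_zigzag HP (id2 F); rewrite (star2_id HP) => E.
  rewrite -[RHS]E; paths; pdone.
have K : eps (id2 F) • eps (id2 F) = eps (id2 F).
  have := eps_o hi hi; rewrite (star2_id HP) e1 => E.
  by apply: (eq_trans _ (eq_sym E)); paths; pdone.
have L : (eps (id2 F))^⋆ • (eps (id2 F) • eps (id2 F)) = eps (id2 F).
  have [a1 a2] := h'; have [a3 a4] := hs.
  by rewrite -(vcomp_assoc H2) ?Z ?(vcomp_idl' a2) // ?a1 ?a2 ?a3 ?a4.
by rewrite -L K Z.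
Qed.

Lemma omega_unit (F : m1 C) c d : arr1 F c d ->
  omega F F (id2 F) • ((F ◀ Phi0 F) ⊚ id3 (eta F)) = id3 (eta F).
Proof.
move=> hF; have hi := id2_arr H2 F; rewrite /omega eps_id (star3_id HP) (star2_id HP).
have h0 := Phi0_arr hF; have hb := sharp2_arr hF hF hi; have hf := phi_arr hF hF hi.
have h := leaf3_cap (leaf2_eta hF); have P := phi_unit hF.
have Z := eps_zigzag HP (eta F).
by paths; sw [2]; rl 1 P; rl 0 Z; pdone.
Qed.

(** Given [phi_comp], the two sides differ by a pair for [eta F], created in [omega F G nu] and
    removed in [omega E F rho]; the zigzag of [eta F] cancels it. *)
Lemma omega_comp (E F G : m1 C) rho nu c d :
  arr1 E c d -> arr1 F c d -> arr1 G c d -> arr2 rho E F -> arr2 nu F G ->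
  omega E G (nu ∘ rho) • (id3 ((nu ∘ rho)^* ▷ E^#) ⊚ (G ◀ Phi2 rho nu) ⊚ id3 (eta G)) =
  omega E F rho • (id3 ((rho^* ▷ E^#) ∘ (F ◁ sharp2 rho)) ⊚ omega F G nu) •
  (id3 (rho^* ▷ E^#) ⊚ sigma nu^* (sharp2 rho) ⊚ id3 ((G ◁ sharp2 nu) ∘ eta G)).
Proof.
move=> hE hF hG hr hn; have hE' := leaf1_sharp hE; have hF' := leaf1_sharp hF.
have hG' := leaf1_sharp hG.
have hrn : arr2 (nu ∘ rho) E G by ty2.
have hb := sharp2_arr hE hF hr; have hb' := sharp2_arr hF hG hn; have hc := sharp2_arr hE hG hrn.
have hS := Phi2_arr hE hF hG hr hn; have P := phi_comp hE hF hG hr hn.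
have p1 := phi_arr hE hF hr; have p2 := phi_arr hF hG hn; have p3 := phi_arr hE hG hrn.
have h1 := leaf3_cap (leaf2_eta hF); have h2 := leaf3_cap (leaf2_eta hG).
have es := star2_o hn hr; have ee := eps_o hn hr; have hrn' : arr2 (rho^* ∘ nu^*) G E by ty2.
have eS : (eps (nu ∘ rho))^⋆ = (eps nu)^⋆ • (id3 nu ⊚ (eps rho)^⋆ ⊚ id3 nu^*).
  by rewrite ee; eapply eq_trans; [st3|]; paths; pdone.
rewrite /omega es eS.
have hbb : arr2 (sharp2 rho ∘ sharp2 nu) G^# E^# by ty2.
have N1 := sigma_nat_r hrn' hG hG' hS hbb hc.
have i1 : arr2 (rho ∘ rho^*) F F by ty2.
have N2 := sigma_nat_l (leaf3_eps_star hr) i1 (id2_arr H2 F) hF hF hb' hG' hF'.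
have k1 : arr1 (F □ F^#) d d by ty1. have k2 : arr1 (id1 d) d d by ty1.
have Z := eps_zigzag_l (leaf2_eta hF) k2 k1.
paths. rl 5 N1. sw [4]. rl 3 P. sw [2;6;5]. rl 3 (eq_sym N2). flip. sw [4;3;2;1;0;5;4;3;2;1;6;5;4;3;2;7;6;5;4]. rl 3 Z. pdone.
Qed.

Lemma eta_box_arr (F H : m1 C) c d e : arr1 F d e -> arr1 H c d ->
  eta (F □ H) = (F ◁ eta H ▷ F^#) ∘ eta F.
Proof. by move=> [hF _] [_ hH]; apply: (eta_box HD); rewrite hF hH. Qed.

(* The star of [eps_nat] for [sigma mu nu]. *)
Lemma sigma_cap (mu nu : m2 C) f g f' g' c d e :
  arr2 mu f g -> arr1 f d e -> arr1 g d e -> arr2 nu f' g' -> arr1 f' c d -> arr1 g' c d ->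
  (g ◀ (eps nu)^⋆) • (id3 (g ◁ nu) ⊚ ((eps mu)^⋆ ▶ f') ⊚ id3 (g ◁ nu^*)) •
  (sigma mu nu ⊚ id3 ((mu^* ▷ f') ∘ (g ◁ nu^*))) =
  ((eps mu)^⋆ ▶ g') • (id3 (mu ▷ g') ⊚ (f ◀ (eps nu)^⋆) ⊚ id3 (mu^* ▷ g')) •
  (id3 ((mu ▷ g') ∘ (f ◁ nu)) ⊚ sigma mu^* nu^*).
Proof.
move=> hm hf hg hn hf' hg'.
have t1 : arr2 (g ◁ nu) (g □ f') (g □ g') by ty2.
have t2 : arr2 (f ◁ nu) (f □ f') (f □ g') by ty2.
have t3 : arr2 (mu ▷ f') (f □ f') (g □ f') by ty2.
have t4 : arr2 (mu ▷ g') (f □ g') (g □ g') by ty2.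
have [e1 e2] : arr3 (sigma mu nu) ((mu ▷ g') ∘ (f ◁ nu)) ((g ◁ nu) ∘ (mu ▷ f')) by ty3.
have es : ((mu ▷ g') ∘ (f ◁ nu))^* = (f ◁ nu^*) ∘ (mu^* ▷ g') by st2.
have E := eps_nat HP (sigma mu nu); rewrite e1 e2 es (sigma_star hm hf hg hn hf' hg') in E.
rewrite (eps_o t4 t2) (eps_o t1 t3) (star2_wr hg' hm hf hg) (star2_wl hg hn hf' hg') in E.
rewrite (eps_wl hf hn hf' hg') (eps_wl hg hn hf' hg') (eps_wr hf' hm hf hg) (eps_wr hg' hm hf hg) in E.
eapply star_eq in E; [|st3|st3].
paths. flip. rl 0 E. pdone.
Qed.

(** In the source [eta K] stands beside [#nu], as [omega H K nu] requires; the tensorator with [#mu]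
    brings it to the place that it has in [eta (G □ K)]. The [eps] cells are expanded along the Gray
    product, and [phi_box] does the rest up to caps sliding through tensorators. *)
Lemma omega_box (F G H K : m1 C) mu nu c d e :
  arr1 F d e -> arr1 G d e -> arr1 H c d -> arr1 K c d -> arr2 mu F G -> arr2 nu H K ->
  omega (F □ H) (G □ K) ((mu ▷ K) ∘ (F ◁ nu)) •
  (id3 (((mu ▷ K) ∘ (F ◁ nu))^* ▷ (H^# □ F^#)) ⊚ ((G □ K) ◀ kappa mu nu) ⊚ id3 (eta (G □ K))) •
  (id3 ((((mu ▷ K) ∘ (F ◁ nu))^* ▷ (H^# □ F^#)) ∘ ((G □ K) ◁ sharp2 nu ▷ F^#)) ⊚
   (G ◀ sigma (eta K) (sharp2 mu)) ⊚ id3 (eta G)) =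
  ((F ◀ omega H K nu ▶ F^#) ⊚ id3 (eta F)) •
  (id3 (F ◁ ((nu^* ▷ H^#) ∘ (K ◁ sharp2 nu) ∘ eta K) ▷ F^#) ⊚ omega F G mu) •
  (id3 (F ◁ nu^* ▷ (H^# □ F^#)) ⊚ sigma mu^* (((K ◁ sharp2 nu) ∘ eta K) ▷ F^#) ⊚
   id3 ((G ◁ sharp2 mu) ∘ eta G)).
Proof.
move=> hF hG hH hK hm hn.
have hF' := leaf1_sharp hF; have hG' := leaf1_sharp hG.
have hH' := leaf1_sharp hH; have hK' := leaf1_sharp hK.
have hFH : arr1 (F □ H) c e by ty1. have hGK : arr1 (G □ K) c e by ty1.
have P := phi_box hF hG hH hK hm hn; rewrite (box2E hm hn) in P.
have hmn : arr2 ((mu ▷ K) ∘ (F ◁ nu)) (F □ H) (G □ K) by ty2.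
have hb := sharp2_arr hF hG hm; have hq := sharp2_arr hH hK hn; have hc := sharp2_arr hFH hGK hmn.
have p1 := phi_arr hF hG hm; have p2 := phi_arr hH hK hn; have p3 := phi_arr hFH hGK hmn.
have ks := kappa_arr hF hG hH hK hm hn.
have h1 := leaf3_cap (leaf2_eta hF); have h2 := leaf3_cap (leaf2_eta hG).
have h3 := leaf3_cap (leaf2_eta hK).
have am : arr2 (mu ▷ K) (F □ K) (G □ K) by ty2. have an : arr2 (F ◁ nu) (F □ H) (F □ K) by ty2.
have es : ((mu ▷ K) ∘ (F ◁ nu))^* = (F ◁ nu^*) ∘ (mu^* ▷ K) by st2.
have ee : eps ((mu ▷ K) ∘ (F ◁ nu)) =
   (id3 (mu ▷ K) ⊚ (F ◀ eps nu) ⊚ id3 (mu^* ▷ K)) • (eps mu ▶ K).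
  rewrite (eps_o am an) (star2_wr hK hm hF hG) (eps_wr hK hm hF hG) (eps_wl hF hn hH hK) //.
have eS : (eps ((mu ▷ K) ∘ (F ◁ nu)))^⋆ =
    ((eps mu)^⋆ ▶ K) • (id3 (mu ▷ K) ⊚ (F ◀ (eps nu)^⋆) ⊚ id3 (mu^* ▷ K)).
  by rewrite ee; eapply eq_trans; [st3|]; paths; pdone.
have b1 : arr2 (G ◁ (eta K)^* ▷ G^#) (G □ K □ K^# □ G^#) (G □ G^#) by ty2.
have k1 : arr1 (G □ K □ K^# □ G^#) e e by ty1. have k2 : arr1 (id1 d) d d by ty1.
have k3 : arr1 (K □ K^#) d d by ty1. have k4 : arr1 (G □ id1 d) d e by ty1.
have k5 : arr1 (G □ (K □ K^#)) d e by ty1.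
have eF : eps (eta (F □ H)) = (id3 (F ◁ eta H ▷ F^#) ⊚ eps (eta F) ⊚ id3 (F ◁ (eta H)^* ▷ F^#)) •
    (F ◀ eps (eta H) ▶ F^#).
  have c1 : arr2 (F ◁ eta H) (F □ id1 d) (F □ (H □ H^#)) by ty2.
  have c2 : arr2 (F ◁ eta H ▷ F^#) (F □ F^#) (F □ (H □ H^#) □ F^#) by ty2.
  have i1 : arr1 (F □ id1 d) d e by ty1. have i2 : arr1 (F □ (H □ H^#)) d e by ty1.
  have i3 : arr1 (H □ H^#) d d by ty1.
  rewrite (eta_box_arr hF hH) (eps_o c2 (leaf2_eta hF)) (eps_wr hF' c1 i1 i2).
  rewrite (eps_wl hF (leaf2_eta hH) k2 i3) (star2_wr hF' c1 i1 i2).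
  by rewrite (star2_wl hF (leaf2_eta hH) k2 i3).
have eG : (eps (eta (G □ K))^*)^⋆ =
    (eps (eta G)^*)^⋆ • (id3 (eta G)^* ⊚ (G ◀ (eps (eta K)^*)^⋆ ▶ G^#) ⊚ id3 (eta G)).
  have c1 : arr2 (G ◁ (eta K)^*) (G □ (K □ K^#)) (G □ id1 d) by ty2.
  have c2 : arr2 (G ◁ (eta K)^* ▷ G^#) (G □ (K □ K^#) □ G^#) (G □ G^#) by ty2.
  have c3 := leaf2_star (leaf2_eta hG); have c4 := leaf2_star (leaf2_eta hK).
  have E : eps (eta (G □ K))^* =
    (id3 (eta G)^* ⊚ (G ◀ eps (eta K)^* ▶ G^#) ⊚ id3 (eta G)^*^*) • eps (eta G)^*.
    rewrite (eta_box_star hG hK) (eps_o c3 c2) (eps_wr hG' c1 k5 k4).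
    by rewrite (eps_wl hG c4 k3 k2).
  have j2 := leaf3_eps c3; have j3 := leaf3_eps c4; rewrite !(star2_inv HP) in j2 j3.
  rewrite (star2_inv HP) in E; rewrite E; eapply eq_trans; [st3|].
  paths. pdone.
rewrite (sharp1_box_arr hF hH) (sharp1_box_arr hG hK) in hc.
rewrite (eta_box_star hF hH) (eta_box_star hG hK) (sharp1_box_arr hG hK) in p3.
rewrite (eta_box_star hF hH) in P.
rewrite /omega eS es eF eG (sharp1_box_arr hG hK) (eta_box_star hG hK) (eta_box_arr hF hH) (eta_box_arr hG hK).
have amn : arr2 ((F ◁ nu^*) ∘ (mu^* ▷ K)) (G □ K) (F □ H) by ty2.
have kq : arr1 (K^# □ G^#) e c by ty1.
have m1a : arr2 ((sharp2 nu ▷ F^#) ∘ (K^# ◁ sharp2 mu)) (K^# □ G^#) (H^# □ F^#) by ty2.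
have N1 := sigma_nat_r amn hGK kq ks m1a hc.
paths. rl 7 N1. sw [6;5]. rl 4 P.
(* The tensorator of [mu] with the star of [eta K], left over by [phi_box], is passed through the
   two caps that follow it. *)
have TR := sigma_cap hm hF hG (leaf2_star (leaf2_eta hK)) k3 k2; rewrite (star2_inv HP) in TR.
sw [3]. rl 1 TR. sw [3;4;5;6;7;8;9;10;11;14].
have c1 : arr2 ((eta K ▷ F^#) ∘ (id1 d ◁ sharp2 mu)) (id1 d □ G^#) (K □ K^# □ F^#) by ty2.
have c2 : arr2 (((K □ K^#) ◁ sharp2 mu) ∘ (eta K ▷ G^#)) (id1 d □ G^#) (K □ K^# □ F^#) by ty2.
have c3 : arr3 (sigma (eta K) (sharp2 mu)) ((eta K ▷ F^#) ∘ (id1 d ◁ sharp2 mu))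
  (((K □ K^#) ◁ sharp2 mu) ∘ (eta K ▷ G^#)) by ty3.
have k6 : arr1 (id1 d □ G^#) e d by ty1.
have N2 := sigma_nat_r (leaf2_star hm) hG k6 c3 c1 c2.
rl 12 N2.
have i1 : arr2 (nu ∘ nu^*) K K by ty2.
have b2 : arr2 (K^# ◁ sharp2 mu) (K^# □ G^#) (K^# □ F^#) by ty2.
have k7 : arr1 (K^# □ F^#) e c by ty1.
have N3 := sigma_nat_l (leaf3_eps_star hn) i1 (id2_arr H2 K) hK hK b2 kq k7.
have i2 : arr2 ((eta K)^* ∘ eta K) (id1 d) (id1 d) by ty2.
have N4 := sigma_nat_l h3 i2 (id2_arr H2 _) k2 k2 hb hG' hF'.
sw [9;8;7;3;4]. rl 5 (eq_sym N3). sw [9;8;7;6;5;2]. rl 3 (eq_sym N4). sw [5;4;3].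
flip. sw [4;3;2;1;0;5;4;3;2;1;6;5;4;3;2;7;6;5;4;3]. pdone.
Qed.

Lemma inv3_arr (A : m3 C) a b : arr3 A a b -> invertible A -> arr3 (inv3 A) b a.
Proof. by move=> [<- <-] /inv3_spec []. Qed.
Lemma inv3_l (A : m3 C) a b : arr3 A a b -> invertible A -> inv3 A • A = id3 a.
Proof. by move=> [<- _] /inv3_spec [_ []]. Qed.
Lemma inv3_r (A : m3 C) a b : arr3 A a b -> invertible A -> A • inv3 A = id3 b.
Proof. by move=> [_ <-] /inv3_spec [_ []]. Qed.

Lemma inv3_T_star_arr (F : m1 C) c d : arr1 F c d ->
  arr3 (inv3 (T F)^⋆) ((F ◁ (eta F^#)^*) ∘ (eta F ▷ F)) (id2 F).
Proof. by move=> /leaf3_T_star h; exact: inv3_arr h (inv_star (inv_T F)). Qed.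

(** The starred swallowtail determines the inverse of the star of [T F] after testing on [eta F];
    the formal inverse gives way to [T F^#]. *)
Lemma inv3_T_star_eta (F : m1 C) c d : arr1 F c d ->
  (inv3 (T F)^⋆ ▶ F^#) ⊚ id3 (eta F) =
  ((F ◀ T F^#) ⊚ id3 (eta F)) • (id3 (F ◁ (eta F^#)^* ▷ F^#) ⊚ sigma (eta F) (eta F)).
Proof.
move=> hF; have h := leaf3_T_star hF; have h1 := inv3_T_star_arr hF.
have h2 := inv3_r h (inv_star (inv_T F)).
have S := swallowtail_star hF; set R := RHS.
have -> : R = R • (((T F)^⋆ • inv3 (T F)^⋆) ▶ F^# ⊚ id3 (eta F)).
  by rewrite /R h2; paths; pdone.
by rewrite /R; clear R; paths; flip; rl 0 S; pdone.
Qed.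

(** * [Theta] through [omega] and [psi], and its laws *)

Section One.
Context (F G : m1 C) (c d : ob C) (hF : arr1 F c d) (hG : arr1 G c d).

(** [sigma_compr] splits the first tensorator of [Theta] into a crossing with the star of [eta F^#]
    and a crossing with [#nu]. The second part and the cells from [eps (eta F)] to the last caps
    form [omega]. *)
Lemma ThetaE nu : arr2 nu F G -> Theta nu =
  (id3 nu ⊚ inv3 (T F)^⋆) •
  (id3 (nu ∘ (F ◁ (eta F^#)^*)) ⊚ (omega F G nu ▶ F)) •
  (id3 nu ⊚ sigma nu^* (eta F^#)^* ⊚ id3 ((G ◁ sharp2 nu ▷ F) ∘ (eta G ▷ F))) •
  (eps nu ⊚ id3 ((G ◁ (eta F^#)^*) ∘ (G ◁ sharp2 nu ▷ F) ∘ (eta G ▷ F))).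
Proof.
move=> hn; case: (hn) => e1 e2; rewrite /Theta /sharp_sq2 e1 e2.
have hb := sharp2_arr hF hG hn; have hf := phi_arr hF hG hn.
rewrite (sharp2E hb) !(sharp1_inv HD).
have hF' := leaf1_sharp hF; have hG' := leaf1_sharp hG.
have k1 : arr1 (id1 d) d d by ty1. have k2 : arr1 (F □ F^#) d d by ty1.
have k3 : arr1 (G □ G^#) d d by ty1.
have k4 : arr1 (G^# □ F) c c by ty1.
have h := leaf3_cap (leaf2_eta hG); have h1 := inv3_T_star_arr hF.
rewrite (eps_wr hF (leaf2_eta hF) k1 k2) (eps_wr hF (leaf2_star (leaf2_eta hG)) k3 k1) (eps_wr k4 hn hF hG).
have j2 := leaf3_eps (leaf2_star (leaf2_eta hG)); rewrite (star2_inv HP) in j2.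
have -> : (eps (eta G)^* ▶ F)^⋆ = (eps (eta G)^*)^⋆ ▶ F by st3.
have -> : (eps nu ▶ (G^# □ F))^⋆ = (eps nu)^⋆ ▶ (G^# □ F) by st3.
rewrite /omega /phi (sharp2E hn).
by paths; sw [1;0]; pdone.
Qed.

Lemma sharp_sq2_arr nu : arr2 nu F G -> arr2 (sharp2 (sharp2 nu)) F G.
Proof. by move=> hn; have h := sharp2_sharp_arr hG hF (sharp2_arr hF hG hn). Qed.
Lemma sharp_sq2E nu : arr2 nu F G ->
  sharp2 (sharp2 nu) = (G ◁ (eta F^#)^*) ∘ (G ◁ sharp2 nu ▷ F) ∘ (eta G ▷ F).
Proof. by move=> hn; rewrite (sharp2E (sharp2_arr hF hG hn)) !(sharp1_inv HD). Qed.
Lemma Theta_arr nu : arr2 nu F G -> arr3 (Theta nu) (sharp2 (sharp2 nu)) nu.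
Proof.
move=> hn; have hb := sharp2_arr hF hG hn; have ho := omega_arr hF hG hn.
by have h1 := inv3_T_star_arr hF; rewrite (ThetaE hn) (sharp_sq2E hn); ty3.
Qed.

(** Testing on [eta F] trades the inverse in [ThetaE] for [T F^#]. Once [omega] and the crossing of
    [nu^*] are moved past it, this cell completes the copairing of [#nu]. *)
Lemma Theta_eta nu : arr2 nu F G ->
  (Theta nu ▶ F^#) ⊚ id3 (eta F) =
  (id3 (nu ▷ F^#) ⊚ omega F G nu) • ((eps nu ▶ F^#) ⊚ id3 ((G ◁ sharp2 nu) ∘ eta G)) •
  psi G^# F^# (sharp2 nu).
Proof.
move=> hn; have hb := sharp2_arr hF hG hn; have ho := omega_arr hF hG hn.
have h1 := inv3_T_star_arr hF; have I := inv3_T_star_eta hF.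
have hF' := leaf1_sharp hF; have hG' := leaf1_sharp hG.
rewrite (ThetaE hn) psi_sharpE.
have k1 : arr1 (id1 d) d d by ty1. have k2 : arr1 (F □ F^#) d d by ty1.
have a1 : arr2 ((nu^* ▷ F^#) ∘ (G ◁ sharp2 nu) ∘ eta G) (id1 d) (F □ F^#) by ty2.
have N1 := sigma_nat_l ho a1 (leaf2_eta hF) k1 k2 (leaf2_eta hF) k1 k2.
have b1 : arr2 (((eta F^#)^* ▷ F^#) ∘ (F^# ◁ eta F)) F^# F^# by ty2.
have N2 := sigma_nat_r (leaf2_star hn) hG hF' (leaf3_T_sharp F) b1 (id2_arr H2 F^#).
paths. rl 0 I. rl 1 N1. sw [0;4;3]. rl 1 (eq_sym N2). sw [3;2;1]. pdone.
Qed.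

(** Extends [Theta_eta] to the case where a cell [z] separates [Theta nu] from [eta F]. The
    composition law needs it for [z] the sharp of the other factor, the Gray product law for a cell
    built from [#nu] and [eta K]. *)
Lemma Theta_slide nu z Y : arr2 nu F G -> arr1 Y d c -> arr2 z F^# Y ->
  (Theta nu ▶ Y) ⊚ id3 ((F ◁ z) ∘ eta F) =
  (id3 ((nu ▷ Y) ∘ (F ◁ z)) ⊚ omega F G nu) •
  (id3 (nu ▷ Y) ⊚ sigma nu^* z ⊚ id3 ((G ◁ sharp2 nu) ∘ eta G)) •
  ((eps nu ▶ Y) ⊚ id3 ((G ◁ z) ∘ (G ◁ sharp2 nu) ∘ eta G)) •
  (id3 (G ◁ z) ⊚ psi G^# F^# (sharp2 nu)) •
  (sigma (sharp2 (sharp2 nu)) z ⊚ id3 (eta F)).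
Proof.
move=> hn hY hz; have hb := sharp2_arr hF hG hn; have ho := omega_arr hF hG hn.
have hF' := leaf1_sharp hF; have hG' := leaf1_sharp hG.
have hbb := sharp_sq2_arr hn; have ht := Theta_arr hn; have Q := Theta_eta hn.
have hp := psi_arr hG' hF' hb; rewrite !(sharp1_inv HD) in hp.
have si : invertible (sigma nu z) by inv.
have sa : arr3 (sigma nu z) ((nu ▷ Y) ∘ (F ◁ z)) ((G ◁ z) ∘ (nu ▷ F^#)) by ty3.
have [I [I1 [I2 _]]] := si; case: (sa) => e1 e2; rewrite e1 e2 in I1 I2.
have N1 := sigma_nat_l ht hbb hn hF hG hz hF' hY.
have i1 : arr2 (nu ∘ nu^*) G G by ty2.
have N2 := sigma_nat_l (leaf3_eps hn) (id2_arr H2 G) i1 hG hG hz hF' hY.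
(* The invertible tensorator of [nu] and [z] is inserted with its inverse, so that [Theta nu] can
   pass [z] by naturality and meet [eta F]. *)
have -> : Theta nu ▶ Y ⊚ id3 ((F ◁ z) ∘ eta F) =
  ((I • sigma nu z) ⊚ id3 (eta F)) • (Theta nu ▶ Y ⊚ id3 ((F ◁ z) ∘ eta F)).
  by rewrite I2; paths; pdone.
paths. rl 1 N1. rl 1 Q. sw [0]. rl 2 (eq_sym N2). rl 1 I2. pdone.
Qed.

(** Counterpart of [untwist] for testing on [eta F]: the star of [T F] opens a zigzag, and a
    tensorator carries [nu] into it. *)
Definition retwist (nu : m2 C) : m3 C :=
  (sigma nu (eta F^#)^* ⊚ id3 (eta F ▷ F)) • (id3 nu ⊚ (T F)^⋆).
Lemma retwist_arr nu : arr2 nu F G ->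
  arr3 (retwist nu) nu ((G ◁ (eta F^#)^*) ∘ ((nu ▷ (F^# □ F)) ∘ (eta F ▷ F))).
Proof. by move=> hn; have h := leaf3_T_star hF; rewrite /retwist; ty3. Qed.
Lemma retwist_inv nu : arr2 nu F G -> invertible (retwist nu).
Proof.
move=> hn; have h := leaf3_T_star hF; have h' := inv_star (inv_T F).
by rewrite /retwist; inv.
Qed.
Lemma retwist_nat nu nu' X : arr2 nu F G -> arr2 nu' F G -> arr3 X nu nu' ->
  retwist nu' • X = (id3 (G ◁ (eta F^#)^*) ⊚ (((X ▶ F^#) ⊚ id3 (eta F)) ▶ F)) • retwist nu.
Proof.
move=> hn hn' hX; have h := leaf3_T_star hF; rewrite /retwist.
have k1 : arr1 (id1 c) c c by ty1. have k2 : arr1 (F^# □ F) c c by ty1.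
have N := sigma_nat_l hX hn hn' hF hG (leaf2_star (leaf2_eta_sharp hF)) k2 k1.
paths. sw [1]. rl 0 N. pdone.
Qed.
Lemma coevaluate_inj nu nu' X Y : arr2 nu F G -> arr2 nu' F G -> arr3 X nu nu' -> arr3 Y nu nu' ->
  (X ▶ F^#) ⊚ id3 (eta F) = (Y ▶ F^#) ⊚ id3 (eta F) -> X = Y.
Proof.
move=> hn hn' hX hY e.
apply: (cancel_l (retwist_inv hn') (retwist_arr hn')).
- by case: hX.
- by case: hY.
- by rewrite (retwist_nat hn hn' hX) (retwist_nat hn hn' hY) e.
Qed.

Lemma Theta_nat nu nu' X : arr2 nu F G -> arr2 nu' F G -> arr3 X nu nu' ->
  Theta nu' • sharp3 (sharp3 X) = X • Theta nu.
Proof.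
move=> hn hn' hX; have hb := sharp2_arr hF hG hn; have hb' := sharp2_arr hF hG hn'.
have hF' := leaf1_sharp hF; have hG' := leaf1_sharp hG.
have hs := sharp3_arr hF hG hn hn' hX; have hss := sharp3_arr hG' hF' hb hb' hs.
have t1 := Theta_arr hn; have t2 := Theta_arr hn'.
have b1 := sharp_sq2_arr hn; have b2 := sharp_sq2_arr hn'.
have o1 := omega_arr hF hG hn; have o2 := omega_arr hF hG hn'.
have q1 := psi_arr hG' hF' hb; have q2 := psi_arr hG' hF' hb'; rewrite !(sharp1_inv HD) in q1 q2.
have Q1 := Theta_eta hn; have Q2 := Theta_eta hn'.
have N := psi_nat hG' hF' hb hb' hs; rewrite !(sharp1_inv HD) in N.
have O := omega_nat hF hG hn hn' hX.
have E := eps_nat HP X; case: (hX) => e1 e2; rewrite e1 e2 in E; clear e1 e2.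
apply: (coevaluate_inj b1 hn'); try by ty3.
paths. rl 0 Q2. rl 2 N. sw [1]. rl 0 (eq_sym O). rl 1 (eq_sym E). flip. rl 1 Q1. sw [0]. pdone.
Qed.
End One.

Lemma Theta_unit (F : m1 C) c d : arr1 F c d ->
  Theta (id2 F) • sharp3 (Phi0 F) • Phi0 F^# = id3 (id2 F).
Proof.
move=> hF; have hi := id2_arr H2 F; have hi' := id2_arr H2 F^#; have hF' := leaf1_sharp hF.
have h0 := Phi0_arr hF; have h0' := Phi0_arr hF'; rewrite (sharp1_inv HD) in h0'.
have hb := sharp2_arr hF hF hi; have hb' := sharp2_arr hF' hF' hi'; rewrite (sharp1_inv HD) in hb'.
have hs := sharp3_arr hF' hF' hi' hb h0.
have t1 := Theta_arr hF hF hi; have b1 := sharp_sq2_arr hF hF hi.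
have o1 := omega_arr hF hF hi; have Q := Theta_eta hF hF hi.
have N := psi_nat hF' hF' hi' hb h0; rewrite !(sharp1_inv HD) in N.
have q1 := psi_arr hF' hF' hb; have q2 := psi_arr hF' hF' hi'; rewrite !(sharp1_inv HD) in q1 q2.
have U := omega_unit hF; have P := psi_unit hF'; rewrite !(sharp1_inv HD) in P.
rewrite eps_id in Q; rewrite (star2_id HP) in o1.
apply: (coevaluate_inj hF hF hi hi); try by ty3.
paths. rl 0 Q. rl 1 N. rl 0 U. rl 0 P. pdone.
Qed.

(** Tested on [eta E], the left side splits by [psi_comp] and [omega_comp]. [Theta_slide]
    reassembles the pieces of [Theta nu] across [#rho], and [Theta_eta] those of [Theta rho]. *)
Lemma Theta_comp (E F G : m1 C) rho nu c d :
  arr1 E c d -> arr1 F c d -> arr1 G c d -> arr2 rho E F -> arr2 nu F G ->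
  Theta (nu ∘ rho) • sharp3 (Phi2 rho nu) • Phi2 (sharp2 nu) (sharp2 rho) =
  Theta nu ⊚ Theta rho.
Proof.
move=> hE hF hG hr hn; have hrn : arr2 (nu ∘ rho) E G by ty2.
have hE' := leaf1_sharp hE; have hF' := leaf1_sharp hF; have hG' := leaf1_sharp hG.
have hb := sharp2_arr hE hF hr; have hb' := sharp2_arr hF hG hn.
have hc := sharp2_arr hE hG hrn; have hbb : arr2 (sharp2 rho ∘ sharp2 nu) G^# E^# by ty2.
have hS := Phi2_arr hE hF hG hr hn; have hSS := sharp3_arr hG' hE' hbb hc hS.
have hT := Phi2_arr hG' hF' hE' hb' hb.
have t1 := Theta_arr hE hF hr; have t2 := Theta_arr hF hG hn; have t3 := Theta_arr hE hG hrn.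
have r1 := sharp_sq2_arr hE hF hr; have r2 := sharp_sq2_arr hF hG hn.
have r3 := sharp_sq2_arr hE hG hrn; have r4 := sharp2_sharp_arr hG hE hbb.
have o1 := omega_arr hE hF hr; have o2 := omega_arr hF hG hn; have o3 := omega_arr hE hG hrn.
have q1 := psi_sharp_arr hF hE hb; have q2 := psi_sharp_arr hG hF hb'.
have q3 := psi_sharp_arr hG hE hc; have q4 := psi_sharp_arr hG hE hbb.
have N := psi_nat hG' hE' hbb hc hS; have P := psi_comp hG' hF' hE' hb' hb.
rewrite !(sharp1_inv HD) in N P.
have O := omega_comp hE hF hG hr hn; rewrite (star2_o hn hr) in O o3.
have Q1 := Theta_eta hE hF hr; have Q3 := Theta_eta hE hG hrn; rewrite (eps_o hn hr) in Q3.
have SL := Theta_slide hF hG hn hE' hb.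
have hrr : arr2 (sharp2 (sharp2 nu) ∘ sharp2 (sharp2 rho)) E G by ty2.
apply: (coevaluate_inj hE hG hrr hrn); try by ty3.
paths. rl 0 Q3. rl 3 N. rl 4 P. sw [2;1]. rl 0 O. sw [2;1]. rl 2 (eq_sym SL). sw [1;0]. rl 1 (eq_sym Q1).
pdone.
Qed.

(** The same pattern with [psi_box] and [omega_box]; the slide now carries [Theta mu] across [#nu]
    and [eta K], and [Theta nu] is reassembled last. *)
Lemma Theta_box (F G H K : m1 C) mu nu c d e :
  arr1 F d e -> arr1 G d e -> arr1 H c d -> arr1 K c d -> arr2 mu F G -> arr2 nu H K ->
  Theta (box2 mu nu) • sharp3 (kappa mu nu) • kappa (sharp2 nu) (sharp2 mu) =
  box3 (Theta mu) (Theta nu).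
Proof.
move=> hF hG hH hK hm hn.
have hF' := leaf1_sharp hF; have hG' := leaf1_sharp hG.
have hH' := leaf1_sharp hH; have hK' := leaf1_sharp hK.
have hFH : arr1 (F □ H) c e by ty1. have hGK : arr1 (G □ K) c e by ty1.
have hFH' := leaf1_sharp hFH; have hGK' := leaf1_sharp hGK.
have hmn : arr2 ((mu ▷ K) ∘ (F ◁ nu)) (F □ H) (G □ K) by ty2.
have hb := sharp2_arr hF hG hm; have hq := sharp2_arr hH hK hn; have hc := sharp2_arr hFH hGK hmn.
have t1 := Theta_arr hF hG hm; have t2 := Theta_arr hH hK hn; have t3 := Theta_arr hFH hGK hmn.
have r1 := sharp_sq2_arr hF hG hm; have r2 := sharp_sq2_arr hH hK hn.
have r3 := sharp_sq2_arr hFH hGK hmn.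
have -> : box3 (Theta mu) (Theta nu) = (Theta mu ▶ K) ⊚ (F ◀ Theta nu).
  by rewrite /box3 /t32 /s32; case: t1 => -> _; case: t2 => -> _; case: r1 => -> _; case: r2 => _ ->.
have ks := kappa_arr hF hG hH hK hm hn.
have kk := kappa_arr hK' hH' hG' hF' hq hb; rewrite !(sharp1_inv HD) in kk.
have hM : arr2 ((sharp2 nu ▷ F^#) ∘ (K^# ◁ sharp2 mu)) (G □ K)^# (F □ H)^#.
  by rewrite (sharp1_box_arr hF hH) (sharp1_box_arr hG hK); ty2.
have hSS := sharp3_arr hGK' hFH' hM hc ks.
have r4 := sharp2_sharp_arr hGK hFH hM.
have o1 := omega_arr hF hG hm; have o2 := omega_arr hH hK hn; have o3 := omega_arr hFH hGK hmn.
have q1 := psi_sharp_arr hG hF hb; have q2 := psi_sharp_arr hK hH hq.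
have q3 := psi_sharp_arr hGK hFH hc; have q4 := psi_sharp_arr hGK hFH hM.
have N := psi_nat hGK' hFH' hM hc ks.
have P := psi_box hK' hH' hG' hF' hq hb; rewrite (box2E hq hb) in P.
have O := omega_box hF hG hH hK hm hn.
have Q2 := Theta_eta hH hK hn; have Q3 := Theta_eta hFH hGK hmn.
have zK : arr2 (((K ◁ sharp2 nu) ∘ eta K) ▷ F^#) F^# (K □ H^# □ F^#) by ty2.
have kY : arr1 (K □ H^# □ F^#) e d by ty1.
have SL := Theta_slide hF hG hm kY zK.
have hrr : arr2 ((sharp2 (sharp2 mu) ▷ K) ∘ (F ◁ sharp2 (sharp2 nu))) (F □ H) (G □ K) by ty2.
rewrite (box2E hm hn).
apply: (coevaluate_inj hFH hGK hrr hmn); try by ty3.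
rewrite !(sharp1_inv HD) in N P.
have am : arr2 (mu ▷ K) (F □ K) (G □ K) by ty2. have an : arr2 (F ◁ nu) (F □ H) (F □ K) by ty2.
have es : ((mu ▷ K) ∘ (F ◁ nu))^* = (F ◁ nu^*) ∘ (mu^* ▷ K) by st2.
have ee : eps ((mu ▷ K) ∘ (F ◁ nu)) =
   (id3 (mu ▷ K) ⊚ (F ◀ eps nu) ⊚ id3 (mu^* ▷ K)) • (eps mu ▶ K).
  rewrite (eps_o am an) (star2_wr hK hm hF hG) (eps_wr hK hm hF hG) (eps_wl hF hn hH hK) //.
have eb := sharp1_box_arr hF hH; have eb' := sharp1_box_arr hG hK.
have eF := eta_box_arr hF hH; have eG := eta_box_arr hG hK.
rewrite ee in Q3; rewrite es in O; rewrite es in o3.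
rewrite eb eF eG in o3; rewrite eb eb' in hc hM.
rewrite eb eb' eF eG in q3 q4; rewrite eb eb' eF eG in N; rewrite eF in P; rewrite eG in O.
rewrite eb eb' eF eG in Q3.
rewrite eb eF.
paths. rl 0 Q3. rl 3 N. rl 4 P. sw [2;1;3;2]. rl 0 O. sw [3;2;1]. rl 2 (eq_sym SL).
sw [1;0]. rl 1 (eq_sym Q2). pdone.
Qed.

(** * Duality of [#nu] and [#nu^*], and invertibility of [Theta] *)

Lemma leaf3_cup (mu : m2 C) f g : arr2 mu f g -> arr3 (eps mu^*) (id2 f) (mu^* ∘ mu).
Proof. by move=> h; have := leaf3_eps (leaf2_star h); rewrite (star2_inv HP). Qed.

Lemma Phi0_inv (F : m1 C) : invertible (Phi0 F).
Proof. exact: inv_star (inv_T _). Qed.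
Lemma Phi2_inv (E F G : m1 C) rho nu c d :
  arr1 E c d -> arr1 F c d -> arr1 G c d -> arr2 rho E F -> arr2 nu F G -> invertible (Phi2 rho nu).
Proof. by move=> hE hF hG hr hn; rewrite (Phi2E hr hn) (sharp2E hn); inv. Qed.

Section One.
Context (F G : m1 C) (c d : ob C) (hF : arr1 F c d) (hG : arr1 G c d).

(** The map [v] opens a zigzag in [F^#] and is invertible and natural, so a 3-morphism between duals
    can be recovered from its pairing. *)
Lemma pair_inj b b' Y Y' : arr2 b G^# F^# -> arr2 b' G^# F^# -> arr3 Y b b' -> arr3 Y' b b' ->
  id3 (eta F)^* ⊚ (F ◀ Y) = id3 (eta F)^* ⊚ (F ◀ Y') -> Y = Y'.
Proof.
move=> hb hb' hY hY' e; have h := leaf3_T_sharp_star hF.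
have hF' := leaf1_sharp hF; have hG' := leaf1_sharp hG.
pose v x := (id3 (F^# ◁ (eta F)^*) ⊚ sigma (eta F^#) x) • ((T F^#)^⋆ ⊚ id3 x).
have h' := inv_star (inv_T F^#).
have iv : invertible (v b') by rewrite /v; inv.
have av : arr3 (v b') b' ((F^# ◁ (eta F)^*) ∘ (((F^# □ F) ◁ b') ∘ (eta F^# ▷ G^#))).
  by rewrite /v; ty3.
have N Z : arr3 Z b b' ->
    v b' • Z = ((F^# ◀ (id3 (eta F)^* ⊚ (F ◀ Z))) ⊚ id3 (eta F^# ▷ G^#)) • v b.
  move=> hZ; rewrite /v.
  have S := sigma_nat_r (leaf2_eta_sharp hF) (id1_arr HB c) hG' hZ hb hb'.
  by paths; sw [1]; rl 0 S; pdone.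
apply: (cancel_l iv av); [by case: hY | by case: hY' | by rewrite (N _ hY) (N _ hY') e].
Qed.
End One.

Section Adjoint.
Context (F G : m1 C) (nu : m2 C) (c d : ob C).
Context (hF : arr1 F c d) (hG : arr1 G c d) (hn : arr2 nu F G).
(** [U] and [N] are the images under [#] of the unit and counit relating [nu] and [nu^*]. They are
    given by equations free of inverses, which can be used directly as rewriting rules. *)
Context (U N : m3 C).
Context (hU : arr3 U (id2 F^#) (sharp2 nu ∘ sharp2 nu^*)).
Context (hN : arr3 N (sharp2 nu^* ∘ sharp2 nu) (id2 G^#)).
Context (eU : Phi2 nu nu^* • U = sharp3 (eps nu^*) • Phi0 F).
Context (eN : Phi0 G • N = sharp3 (eps nu)^⋆ • Phi2 nu^* nu).

(** The pairing translates [U] into [eps nu^*]; the next lemma likewise translates [N] into the star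
    of [eps nu]. Both combine the composition, naturality and unit laws of [phi]. *)
Lemma phi_unit_of_adjunction :
  (phi G F nu^* ⊚ id3 (nu ▷ F^#)) • (id3 (eta G)^* ⊚ sigma nu (sharp2 nu^*)) •
  (phi F G nu ⊚ id3 (F ◁ sharp2 nu^*)) • (id3 (eta F)^* ⊚ (F ◀ U)) =
  id3 (eta F)^* ⊚ (eps nu^* ▶ F^#).
Proof.
have hs := leaf2_star hn; have hb := sharp2_arr hF hG hn; have hb' := sharp2_arr hG hF hs.
have hi := id2_arr H2 F; have hc := sharp2_arr hF hF hi; have h0 := Phi0_arr hF.
have he := leaf3_cup hn; have hss : arr2 (nu^* ∘ nu) F F by ty2.
have hd := sharp2_arr hF hF hss.
have hse := sharp3_arr hF hF hi hss he.
have hp := Phi2_arr hF hG hF hn hs.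
have p1 := phi_arr hF hG hn; have p2 := phi_arr hG hF hs; have p3 := phi_arr hF hF hi.
have p4 := phi_arr hF hF hss.
have P := phi_comp hF hG hF hn hs; have Q := phi_nat hF hF hi hss he; have R := phi_unit hF.
paths. rl 0 (eq_sym P). rl 1 eU. rl 0 Q. rl 1 R. pdone.
Qed.

Lemma phi_counit_of_adjunction :
  id3 (eta G)^* ⊚ (G ◀ N) =
  (id3 (eta G)^* ⊚ ((eps nu)^⋆ ▶ G^#)) • (phi F G nu ⊚ id3 (nu^* ▷ G^#)) •
  (id3 (eta F)^* ⊚ sigma nu^* (sharp2 nu)) • (phi G F nu^* ⊚ id3 (G ◁ sharp2 nu)).
Proof.
have hs := leaf2_star hn; have hb := sharp2_arr hF hG hn; have hb' := sharp2_arr hG hF hs.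
have hi := id2_arr H2 G; have hc := sharp2_arr hG hG hi; have h0 := Phi0_arr hG.
have he := leaf3_eps_star hn; have hss : arr2 (nu ∘ nu^*) G G by ty2.
have hd := sharp2_arr hG hG hss.
have hse := sharp3_arr hG hG hss hi he.
have hp := Phi2_arr hG hF hG hs hn.
have p1 := phi_arr hF hG hn; have p2 := phi_arr hG hF hs; have p3 := phi_arr hG hG hi.
have p4 := phi_arr hG hG hss.
have P := phi_comp hG hF hG hs hn; have Q := phi_nat hG hG hss hi he; have R := phi_unit hG.
paths. flip. rl 1 (eq_sym P). rl 0 (eq_sym Q). rl 1 (eq_sym eN). rl 0 R. pdone.
Qed.

(** Tested by [pair_inj] and followed by the invertible [phi F G nu], the triangle for [#nu] turns
    into a zigzag for [nu]. *)
Lemma sharp_triangle : (id3 (sharp2 nu) ⊚ N) • (U ⊚ id3 (sharp2 nu)) = id3 (sharp2 nu).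
Proof.
have hs := leaf2_star hn; have hb := sharp2_arr hF hG hn; have hb' := sharp2_arr hG hF hs.
have hG' := leaf1_sharp hG; have hF' := leaf1_sharp hF.
have p1 := phi_arr hF hG hn; have p2 := phi_arr hG hF hs.
have D1 := phi_unit_of_adjunction; have D2 := phi_counit_of_adjunction.
have he := leaf3_cup hn.
apply: (pair_inj hF hG hb hb); try by ty3.
have ip := phi_inv hF hG hn.
have i1 : arr2 (sharp2 nu^* ∘ sharp2 nu) G^# G^# by ty2.
have i2 : arr2 (nu^* ∘ nu) F F by ty2.
have S1 := sigma_nat_r hn hF hG' hN i1 (id2_arr H2 _).
have S2 := sigma_nat_l he (id2_arr H2 F) i2 hF hF hb hG' hF'.
have Z := eps_zigzag_l hs hG hF.
rewrite !(star2_inv HP) in Z.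
have t0 : arr3 (id3 (eta F)^* ⊚ (F ◀ ((id3 (sharp2 nu) ⊚ N) • (U ⊚ id3 (sharp2 nu)))))
  ((eta F)^* ∘ (F ◁ sharp2 nu)) ((eta F)^* ∘ (F ◁ sharp2 nu)) by ty3.
have t1 : arr3 (id3 (eta F)^* ⊚ (F ◀ id3 (sharp2 nu)))
  ((eta F)^* ∘ (F ◁ sharp2 nu)) ((eta F)^* ∘ (F ◁ sharp2 nu)) by ty3.
apply: (cancel_l ip p1); [by case: t0 | by case: t1 |].
paths. sw [0]. rl 0 S1. rl 0 D2. sw [3]. rl 4 D1. rl 2 S2. sw [1]. rl 0 Z. pdone.
Qed.

(** By [omega_comp] the two factors merge into [omega] of [nu^* ∘ nu]. Naturality at [eps nu^*] and
    [omega_unit] eliminate it, and the zigzag of [nu] remains. *)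
Lemma omega_right_inverse :
  ((id3 (nu ▷ F^#) ⊚ omega F G nu) • ((eps nu ▶ F^#) ⊚ id3 ((G ◁ sharp2 nu) ∘ eta G))) •
  ((id3 (G ◁ sharp2 nu) ⊚ omega G F nu^*) • (sigma nu (sharp2 nu) ⊚ id3 ((F ◁ sharp2 nu^*) ∘ eta F)) •
   (id3 (nu ▷ F^#) ⊚ (F ◀ U) ⊚ id3 (eta F))) = id3 ((nu ▷ F^#) ∘ eta F).
Proof.
have hs := leaf2_star hn; have hb := sharp2_arr hF hG hn; have hb' := sharp2_arr hG hF hs.
have hi := id2_arr H2 F; have hc := sharp2_arr hF hF hi; have h0 := Phi0_arr hF.
have he := leaf3_cup hn; have hss : arr2 (nu^* ∘ nu) F F by ty2.
have hd := sharp2_arr hF hF hss.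
have hse := sharp3_arr hF hF hi hss he.
have hp := Phi2_arr hF hG hF hn hs.
have es : (nu^* ∘ nu)^* = nu^* ∘ nu by st2.
have o1 := omega_arr hF hG hn; have o2 := omega_arr hG hF hs; rewrite (star2_inv HP) in o2.
have o3 := omega_arr hF hF hss; have o4 := omega_arr hF hF hi; rewrite (star2_id HP) in o4.
rewrite es in o3.
have O := omega_comp hF hG hF hn hs; rewrite es (star2_inv HP) in O.
have M := omega_nat hF hF hi hss he; rewrite es in M.
have R := omega_unit hF; have Z := eps_zigzag HP nu.
have hes := leaf3_star he; rewrite es (star2_id HP) in hes.
paths. sw [1;2;3]. rl 0 (eq_sym O). rl 1 eU. rl 0 (eq_sym M). sw [1]. rl 0 R. rl 0 Z. pdone.
Qed.

(** The same merging, now at [nu ∘ nu^*] and with the star of [eps nu]; what remains is the triangle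
    for [#nu] instead of a zigzag of [nu]. *)
Lemma omega_left_inverse :
  ((id3 (G ◁ sharp2 nu) ⊚ omega G F nu^*) • (sigma nu (sharp2 nu) ⊚ id3 ((F ◁ sharp2 nu^*) ∘ eta F)) •
   (id3 (nu ▷ F^#) ⊚ (F ◀ U) ⊚ id3 (eta F))) •
  ((id3 (nu ▷ F^#) ⊚ omega F G nu) • ((eps nu ▶ F^#) ⊚ id3 ((G ◁ sharp2 nu) ∘ eta G))) =
  id3 ((G ◁ sharp2 nu) ∘ eta G).
Proof.
have hs := leaf2_star hn; have hb := sharp2_arr hF hG hn; have hb' := sharp2_arr hG hF hs.
have hG' := leaf1_sharp hG; have hF' := leaf1_sharp hF.
have hi := id2_arr H2 G; have hc := sharp2_arr hG hG hi; have h0 := Phi0_arr hG.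
have he := leaf3_eps_star hn; have hss : arr2 (nu ∘ nu^*) G G by ty2.
have hd := sharp2_arr hG hG hss.
have hse := sharp3_arr hG hG hss hi he.
have hp := Phi2_arr hG hF hG hs hn.
have es : (nu ∘ nu^*)^* = nu ∘ nu^* by st2.
have o1 := omega_arr hF hG hn; have o2 := omega_arr hG hF hs; rewrite (star2_inv HP) in o2.
have o3 := omega_arr hG hG hss; have o4 := omega_arr hG hG hi; rewrite (star2_id HP) in o4.
rewrite es in o3.
have O := omega_comp hG hF hG hs hn; rewrite es (star2_inv HP) in O.
have M := omega_nat hG hG hss hi he; rewrite (star3_inv HP) (star2_id HP) in M.
have R := omega_unit hG; have Z := sharp_triangle.
have hes := leaf3_eps hn.
have i1 : arr2 (sharp2 nu ∘ sharp2 nu^*) F^# F^# by ty2.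
have S1 := sigma_nat_r hs hG hF' hU (id2_arr H2 _) i1.
have S2 := sigma_nat_l hes hi hss hG hG hb hG' hF'.
paths. sw [2]. rl 3 (eq_sym S1). sw [1;2]. rl 0 (eq_sym O). sw [4]. rl 2 S2. sw [1]. rl 0 M.
rl 1 (eq_sym eN). rl 0 R. rl 0 Z. pdone.
Qed.
End Adjoint.

Lemma omega_mate_inv (F G : m1 C) nu c d : arr1 F c d -> arr1 G c d -> arr2 nu F G ->
  invertible ((id3 (nu ▷ F^#) ⊚ omega F G nu) •
    ((eps nu ▶ F^#) ⊚ id3 ((G ◁ sharp2 nu) ∘ eta G))).
Proof.
move=> hF hG hn; have hs := leaf2_star hn.
have hb := sharp2_arr hF hG hn; have hb' := sharp2_arr hG hF hs.
have iF := id2_arr H2 F; have iG := id2_arr H2 G.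
have h1 : arr2 (nu^* ∘ nu) F F by ty2. have h2 : arr2 (nu ∘ nu^*) G G by ty2.
have c1 := sharp2_arr hF hF iF; have c2 := sharp2_arr hG hG iG.
have c3 := sharp2_arr hF hF h1; have c4 := sharp2_arr hG hG h2.
have e1 := leaf3_cup hn; have e2 := leaf3_eps_star hn.
have s1 := sharp3_arr hF hF iF h1 e1; have s2 := sharp3_arr hG hG h2 iG e2.
have f1 := Phi0_arr hF; have f2 := Phi0_arr hG.
have g1 := Phi2_arr hF hG hF hn hs; have g2 := Phi2_arr hG hF hG hs hn.
have i1 := Phi2_inv hF hG hF hn hs; have i2 := Phi0_inv G.
have j1 := inv3_arr g1 i1; have j2 := inv3_arr f2 i2.
have k1 := inv3_r g1 i1; have k2 := inv3_r f2 i2.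
(* Both cells are obtained by solving their defining equations, the coherence cells of [#] being
   invertible. *)
pose U := inv3 (Phi2 nu nu^*) • (sharp3 (eps nu^*) • Phi0 F).
pose N := inv3 (Phi0 G) • (sharp3 (eps nu)^⋆ • Phi2 nu^* nu).
have hU : arr3 U (id2 F^#) (sharp2 nu ∘ sharp2 nu^*) by rewrite /U; ty3.
have hN : arr3 N (sharp2 nu^* ∘ sharp2 nu) (id2 G^#) by rewrite /N; ty3.
have eU : Phi2 nu nu^* • U = sharp3 (eps nu^*) • Phi0 F.
  by rewrite /U; paths; rl 0 k1; pdone.
have eN : Phi0 G • N = sharp3 (eps nu)^⋆ • Phi2 nu^* nu.
  by rewrite /N; paths; rl 0 k2; pdone.
have o1 := omega_arr hF hG hn; have o2 := omega_arr hG hF hs; rewrite (star2_inv HP) in o2.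
have R := omega_right_inverse hF hG hn hU eU; have L := omega_left_inverse hF hG hn hU hN eU eN.
move: R L; set X := (Y in Y • _ = _ -> _); set X' := (Y in X • Y = _ -> _) => R L; exists X'.
have [a1 a2] : arr3 X ((G ◁ sharp2 nu) ∘ eta G) ((nu ▷ F^#) ∘ eta F) by rewrite /X; ty3.
have hX' : arr3 X' ((nu ▷ F^#) ∘ eta F) ((G ◁ sharp2 nu) ∘ eta G) by rewrite /X'; ty3.
by rewrite /is_inverse a1 a2.
Qed.

(** Tested on [eta F], [Theta nu] is a composite of two invertible cells, the copairing and the mate
    of [omega]. Naturality of [retwist] then expresses [Theta nu] itself through invertible
    cells. *)
Lemma Theta_inv (F G : m1 C) nu c d : arr1 F c d -> arr1 G c d -> arr2 nu F G ->
  invertible (Theta nu).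
Proof.
move=> hF hG hn; have Q := Theta_eta hF hG hn; have iy := omega_mate_inv hF hG hn.
have hF' := leaf1_sharp hF; have hG' := leaf1_sharp hG.
have hb := sharp2_arr hF hG hn; have ho := omega_arr hF hG hn; have ht := Theta_arr hF hG hn.
have hbb := sharp_sq2_arr hF hG hn.
have hp := psi_sharp_arr hG hF hb.
have ip : invertible (psi G^# F^# (sharp2 nu)) by rewrite psi_sharpE; inv.
have hy : arr3 ((id3 (nu ▷ F^#) ⊚ omega F G nu) •
    ((eps nu ▶ F^#) ⊚ id3 ((G ◁ sharp2 nu) ∘ eta G)))
   ((G ◁ sharp2 nu) ∘ eta G) ((nu ▷ F^#) ∘ eta F) by ty3.
have N := retwist_nat hF hG hbb hn ht; rewrite Q in N.
move: iy hy N; set y := _ • _ => iy hy N; clearbody y.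
have h1 := retwist_arr hF hG hn; have h2 := retwist_arr hF hG hbb.
have i1 := retwist_inv hF hG hn; have i2 := retwist_inv hF hG hbb.
have j := inv3_arr h1 i1; have k := inv3_l h1 i1.
have ij := inv_inv (inv3_spec i1).
have -> : Theta nu = inv3 (retwist F nu) •
   ((id3 (G ◁ (eta F^#)^*) ⊚ (y • psi G^# F^# (sharp2 nu)) ▶ F) • retwist F (sharp2 (sharp2 nu))).
  by rewrite -N; paths; flip; rl 0 k; pdone.
by inv.
Qed.

(** Solves [Theta_unit] for [Theta (id2 F)], the form that the unit law of a natural isomorphism
    requires. *)
Lemma Theta_id (F : m1 C) c d : arr1 F c d ->
  Theta (id2 F) = inv3 (Phi0 F^#) • inv3 (sharp3 (Phi0 F)).
Proof.
move=> hF; have hi := id2_arr H2 F; have hi' := id2_arr H2 F^#; have hF' := leaf1_sharp hF.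
have h0 := Phi0_arr hF; have h0' := Phi0_arr hF'; rewrite (sharp1_inv HD) in h0'.
have hb := sharp2_arr hF hF hi; have hb' := sharp2_arr hF' hF' hi'; rewrite (sharp1_inv HD) in hb'.
have hs := sharp3_arr hF' hF' hi' hb h0.
have t1 := Theta_arr hF hF hi; have b1 := sharp_sq2_arr hF hF hi.
have i0 := Phi0_inv F; have i1 := Phi0_inv F^#.
have iS : invertible (sharp3 (Phi0 F)).
  by rewrite (sharp3E h0 hi') (sharp1_inv HD); inv.
have U := Theta_unit hF.
have a1 := inv3_arr h0' i1; have a2 := inv3_arr hs iS.
have r1 := inv3_r h0' i1; have r2 := inv3_r hs iS.
have -> : Theta (id2 F) = (Theta (id2 F) • sharp3 (Phi0 F) • Phi0 F^#) •
    (inv3 (Phi0 F^#) • inv3 (sharp3 (Phi0 F))).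
  by paths; flip; rl 2 r1; rl 1 r2; pdone.
by rewrite U; paths; pdone.
Qed.

Lemma Theta_natiso : natiso_sharp_sq (@Theta C).
Proof.
split.
- by move=> nu; exact: (Theta_arr (arr1_self (s2 nu)) (arr1_t2 nu) (arr2_self nu)).
- by move=> nu; exact: (Theta_inv (arr1_self (s2 nu)) (arr1_t2 nu) (arr2_self nu)).
- move=> X; have h : arr1 (t2 (s3 X)) (s31 X) (t31 X) := arr1_t2 (s3 X).
  have hX : arr3 X (s3 X) (Defs.t3 X) by [].
  exact: (Theta_nat (arr1_self (s32 X)) h (arr2_self (s3 X)) (arr2_t3 X) hX).
- by move=> F; exact: Theta_id (arr1_self F).
- move=> mu nu e; have hm := arr2_self mu; have hG := arr1_t2 mu; have hF := arr1_t2 nu.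
  have [h _] := hm; rewrite e in hm.
  have hE := arr1_self (s2 nu).
  rewrite /s21 /t21 e in hG; case: (hF) => e1 e2; rewrite e1 e2 in hG.
  exact: Theta_comp hE hF hG (arr2_self nu) hm.
- move=> mu nu e; have hG := arr1_t2 mu; have hK := arr1_t2 nu.
  have hF : arr1 (s2 mu) (s21 mu) (t21 mu) by []. have hH : arr1 (s2 nu) (s21 nu) (t21 nu) by [].
  rewrite -e in hK hH.
  exact: Theta_box hF hG hH hK (arr2_self mu) (arr2_self nu).
Qed.
End Duals.

Theorem theorem4p5 (C : gray_category_with_duals) :
  natiso_star_sharp_sq (@Gamma C) /\ natiso_sharp_sq (@Theta C).
Proof. exact (conj (Gamma_natiso C) (Theta_natiso C)). Qed.
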